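(* Let $A:L^2(\mathbb{R}_+)\rightarrow L^2(\mathbb{R}_+)$ be a linear operator (not assumed to be bounded) of rank at least two such that $A(\widetilde{\mathcal{M}})\subset\widetilde{\mathcal{M}}$ or $A(\mathcal{M})\subset\mathcal{M}$. Then $A$ is injective.
   Context: $\mathbb{D}$ is the open unit disk, $\mathbb{R}_+$ the half line $[0,\infty)$; $L^2(\mathbb{R}_+)$ consists of complex-valued functions. $H^2_{\mathbb{D}}$ is the Hardy space of analytic functions on $\mathbb{D}$ with square summable Taylor coefficients. The map $\mathcal{H}:L^2(\mathbb{R}_+)\to H^2_{\mathbb{D}}$, $(\mathcal{H}f)(z)=\frac{\sqrt{2}}{1+z}\int_0^\infty f(t)\exp\!\left(\frac{t(z-1)}{z+1}\right)dt$, is a surjective isometry. A nonzero $G\in H^2_{\mathbb{D}}$ is outer if there is a scalar $\lambda$ with $|\lambda|=1$ such that $G(z)=\lambda\exp\!\left(\frac{1}{2\pi}\int_0^{2\pi}\frac{e^{i\theta}+z}{e^{i\theta}-z}\log|G(e^{i\theta})|\,d\theta\right)$ for all $z\in\mathbb{D}$, where $G(e^{i\theta})$ denotes the boundary function. A function $f\in L^2(\mathbb{R}_+)$ is minimum phase if $\mathcal{H}f$ is outer; $\mathcal{M}$ is the set of all minimum phase functions. For $\tau\ge 0$, $(T_\tau f)(t)=f(t-\tau)$ if $t\geq\tau$ and $0$ if $t<\tau$. $\widetilde{\mathcal{M}}=\{T_\tau f : f\in\mathcal{M},\ \tau\geq 0\}$. The rank of a linear operator is the dimension of its range. *)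

(* Defs.v *)
From HB Require Import structures.
From mathcomp Require Import all_boot all_order all_algebra complex.
From mathcomp Require Import ring_quotient.
From mathcomp Require Import all_classical all_reals all_analysis.
From mathcomp Require Import measurable_realfun.
From mathcomp Require Import ring lra.

Set Implicit Arguments.
Unset Strict Implicit.
Unset Printing Implicit Defensive.

Import Order.TTheory GRing.Theory Num.Theory.
Import numFieldNormedType.Exports.

Local Open Scope classical_set_scope.
Local Open Scope complex_scope.
Local Open Scope ring_scope.
Local Open Scope quotient_scope.

(* [R[i]] has no topology in the libraries; it receives the one of its norm. *)
HB.instance Definition _ (R : rcfType) := NormedModule.copy R[i] (R[i])^o.

Section SquareIntegrable.
Variable R : realType.
Local Notation C := R[i].
Local Notation leb := (@lebesgue_measure R).

Definition Rplus : set R := `[0, +oo[.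

(* Only the values on the half line matter; [Rplus -> C] is encoded as
   [R -> C] with junk values at negative reals. *)
Definition square_integrable (f : R -> C) : Prop :=
  [/\ measurable_fun Rplus (fun t => complex.Re (f t)),
      measurable_fun Rplus (fun t => complex.Im (f t)) &
      (\int[leb]_(t in Rplus) (Normc.normc (f t) ^+ 2)%:E < +oo)%E].

Lemma measurable_Rplus : measurable Rplus.
Proof. exact: measurable_itv. Qed.

Lemma normc2E (z : C) :
  Normc.normc z ^+ 2 = complex.Re z ^+ 2 + complex.Im z ^+ 2.
Proof. by case: z => a b /=; rewrite sqr_sqrtr// addr_ge0// sqr_ge0. Qed.

Lemma measurable_normc2 (D : set R) (f : R -> C) :
  measurable_fun D (fun t => complex.Re (f t)) ->
  measurable_fun D (fun t => complex.Im (f t)) ->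
  measurable_fun D (fun t => (Normc.normc (f t) ^+ 2)%:E : \bar R).
Proof.
move=> mr mi; apply/measurable_EFinP.
under eq_fun do rewrite normc2E.
by apply: measurable_funD; apply: measurable_funX.
Qed.

Definition L2pred : {pred R -> C} := fun f => `[< square_integrable f >].

Lemma L2pred_submod_closed : submod_closed L2pred.
Proof.
split.
  apply/asboolP; split; [exact: measurable_cst|exact: measurable_cst|].
  rewrite integral0_eq ?ltry// => t _.
  by rewrite normc2E /= !expr0n /= addr0.
move=> a f g /asboolP[fr fi f2] /asboolP[gr gi g2]; apply/asboolP.
have hr : measurable_fun Rplus (fun t => complex.Re ((a *: f + g) t)).
  rewrite (_ : (fun _ => _) = fun t => complex.Re a * complex.Re (f t)
    - complex.Im a * complex.Im (f t) + complex.Re (g t)); last first.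
    apply/funext => t; rewrite -[(a *: f + g) t]/(a * f t + g t).
    by case: a (f t) (g t) => [a1 a2] [b1 b2] [c1 c2].
  apply: measurable_funD => //; apply: measurable_funB;
  by apply: measurable_funM => //; exact: measurable_cst.
have hi : measurable_fun Rplus (fun t => complex.Im ((a *: f + g) t)).
  rewrite (_ : (fun _ => _) = fun t => complex.Re a * complex.Im (f t)
    + complex.Im a * complex.Re (f t) + complex.Im (g t)); last first.
    apply/funext => t; rewrite -[(a *: f + g) t]/(a * f t + g t).
    by case: a {hr} (f t) (g t) => [a1 a2] [b1 b2] [c1 c2].
  apply: measurable_funD => //; apply: measurable_funD;
  by apply: measurable_funM => //; exact: measurable_cst.
split=> //.
set k := 2 * Normc.normc a ^+ 2.
have k0 : 0 <= k by rewrite mulr_ge0// sqr_ge0.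
apply: (@le_lt_trans _ _ (\int[leb]_(t in Rplus)
  (k%:E * (Normc.normc (f t) ^+ 2)%:E + 2%:E * (Normc.normc (g t) ^+ 2)%:E))%E).
  apply: ge0_le_integral => //=.
  - exact: measurable_Rplus.
  - by move=> t _; rewrite lee_fin sqr_ge0.
  - exact: measurable_normc2.
  - by apply: emeasurable_funD; apply: measurable_funeM; apply: measurable_normc2.
  move=> t _; rewrite -!EFinM -EFinD lee_fin /k !normc2E.
  rewrite -[(a *: f + g) t]/(a * f t + g t).
  case: a {k k0 hr hi} (f t) (g t) => [a1 a2] [b1 b2] [c1 c2] /=.
  have h1 := sqr_ge0 (a1 * b1 - a2 * b2 - c1).
  have h2 := sqr_ge0 (a1 * b2 + a2 * b1 - c2).
  rewrite -subr_ge0.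
  rewrite (_ : _ - _ =
    (a1 * b1 - a2 * b2 - c1) ^+ 2 + (a1 * b2 + a2 * b1 - c2) ^+ 2).
    exact: addr_ge0.
  by ring.
have mR := measurable_Rplus.
rewrite ge0_integralD//=; last 4 first.
- by move=> t _; rewrite -EFinM lee_fin mulr_ge0// sqr_ge0.
- by apply: measurable_funeM; apply: measurable_normc2.
- by move=> t _; rewrite -EFinM lee_fin mulr_ge0// sqr_ge0.
- by apply: measurable_funeM; apply: measurable_normc2.
rewrite !ge0_integralZl_EFin//; last 4 first.
- by move=> t _; rewrite lee_fin sqr_ge0.
- exact: measurable_normc2.
- by move=> t _; rewrite lee_fin sqr_ge0.
- exact: measurable_normc2.
by rewrite lte_add_pinfty// lte_mul_pinfty.
Qed.

HB.instance Definition _ :=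
  GRing.isSubmodClosed.Build C (R -> C) L2pred L2pred_submod_closed.

Record L2fun := MkL2fun { L2val :> R -> C ; _ : L2val \in L2pred }.

HB.instance Definition _ := [isSub for L2val].
HB.instance Definition _ := [Choice of L2fun by <:].
HB.instance Definition _ := [SubChoice_isSubLmodule of L2fun by <:].

Definition ae_zero : {pred L2fun} :=
  fun f => `[< ae_eq leb Rplus f (cst 0) >].

Lemma ae_zero_scale (a : C) : {in ae_zero, forall f, a *: f \in ae_zero}.
Proof.
move=> f /asboolP f0; apply/asboolP; apply: filterS f0 => t f0 /f0 ft.
by rewrite -[LHS]/(a * f t) ft mulr0.
Qed.

Lemma ae_zero_zmod_closed : zmod_closed ae_zero.
Proof.
split; first by apply/asboolP; exact: nearW.
move=> f g /asboolP f0 /asboolP g0; apply/asboolP.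
apply: filterS2 f0 g0 => t f0 g0 Rt.
have [ft gt] := (f0 Rt, g0 Rt).
by rewrite /= -[(_ - _) t]/(f t - g t) ft gt subrr.
Qed.

HB.instance Definition _ :=
  GRing.isZmodClosed.Build L2fun ae_zero ae_zero_zmod_closed.

Definition L2 : Type := Quotient.quot ae_zero.
HB.instance Definition _ := Choice.on L2.
HB.instance Definition _ := EqQuotient.on L2.
HB.instance Definition _ := GRing.Zmodule.on L2.

Definition L2scale (a : C) (f : L2) : L2 := \pi_L2 (a *: repr f).

Lemma L2scale_pi a (f : L2fun) : L2scale a (\pi_L2 f) = \pi_L2 (a *: f).
Proof.
apply/eqP; rewrite /L2scale -Quotient.idealrBE -scalerBr.
by apply: ae_zero_scale; rewrite Quotient.idealrBE reprK.
Qed.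

Lemma L2pi_add (f g : L2fun) :
  \pi_L2 f + \pi_L2 g = \pi_L2 (f + g) :> L2.
Proof. exact/esym/(Quotient.pi_add ae_zero). Qed.

Lemma L2scaleA a b f : L2scale a (L2scale b f) = L2scale (a * b) f.
Proof. by elim/quotW: f => f; rewrite (L2scale_pi b) !L2scale_pi scalerA. Qed.
Lemma L2scale1 : left_id 1 L2scale.
Proof. by elim/quotW => f; rewrite L2scale_pi scale1r. Qed.
Lemma L2scaleDr : right_distributive L2scale +%R.
Proof.
move=> a; elim/quotW => f; elim/quotW => g.
by rewrite L2pi_add !L2scale_pi L2pi_add scalerDr.
Qed.
Lemma L2scaleDl (f : L2) : {morph L2scale^~ f : a b / a + b}.
Proof.
by elim/quotW: f => f a b /=; rewrite !L2scale_pi L2pi_add scalerDl.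
Qed.

HB.instance Definition _ := GRing.Zmodule_isLmodule.Build C L2
  L2scaleA L2scale1 L2scaleDr L2scaleDl.

Definition L2repr (f : L2) : R -> C := L2val (repr f).
Coercion L2repr : L2 >-> Funclass.

Lemma L2_piP (f g : L2fun) :
  \pi_L2 f = \pi_L2 g <-> ae_eq leb Rplus f g.
Proof.
have E : (\pi_L2 f == \pi_L2 g) = `[< ae_eq leb Rplus (f - g) (cst 0) >].
  by rewrite -Quotient.idealrBE.
split.
  move=> /eqP; rewrite E => /asboolP; apply: filterS => t h /h /= fg.
  by apply/eqP; rewrite -subr_eq0; apply/eqP; exact: fg.
move=> h; apply/eqP; rewrite E; apply/asboolP; apply: filterS h => t h /h fg.
by rewrite /= -[(_ - _) t]/(f t - g t) fg subrr.
Qed.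

Lemma L2_eqP (f g : L2) : f = g <-> ae_eq leb Rplus f g.
Proof. by rewrite -L2_piP !reprK. Qed.

Lemma L2_reprP (f : L2fun) : ae_eq leb Rplus (\pi_L2 f : L2) f.
Proof. by apply/L2_piP; rewrite reprK. Qed.

Lemma L2addE (f g : L2) : ae_eq leb Rplus (f + g : L2) (fun t => f t + g t).
Proof.
rewrite -{1}[f]reprK -{1}[g]reprK L2pi_add.
by apply: filterS (L2_reprP (repr f + repr g)) => t /[apply].
Qed.

Lemma L2scaleE (a : C) (f : L2) :
  ae_eq leb Rplus (a *: f : L2) (fun t => a * f t).
Proof. by apply: filterS (L2_reprP (a *: repr f)) => t /[apply]. Qed.

Lemma L2repr_square_integrable (f : L2) : square_integrable f.
Proof. by rewrite /L2repr; case: (repr f) => g /= /asboolP. Qed.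

End SquareIntegrable.

Section Delay.
Variable R : realType.
Local Notation C := R[i].
Local Notation leb := (@lebesgue_measure R).

Definition delay (tau : R) (f : R -> C) : R -> C :=
  fun t => if tau <= t then f (t - tau) else 0.

Lemma measurable_subr (tau : R) :
  measurable_fun [set: R] (fun t : R => t - tau : R).
Proof. by apply: measurable_funB => //; exact: measurable_cst. Qed.

Lemma lebesgue_measure_translation (tau : R) (A : set R) : measurable A ->
  pushforward leb ((fun t => t - tau) : _ -> measurableTypeR R) A = leb A.
Proof.
move=> mA; apply/esym/lebesgue_measure_unique => //=.
  exact: measurable_subr.
move=> Hm _ [[a b]] _ <-.
rewrite /pushforward (_ : _ @^-1` _ = `]a + tau, b + tau]%classic); last first.
  by apply/seteqP; split=> x /=; rewrite !in_itv/= ltrBrDr lerBlDr.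
by rewrite !lebesgue_measure_itv/= !lte_fin ltrD2r -!EFinB opprD addrACA subrr addr0.
Qed.

Lemma ge0_integral_translation (tau : R) (h : R -> \bar R) :
  measurable_fun [set: R] h -> (forall t, 0 <= h t)%E ->
  (\int[leb]_t h (t - tau)%R = \int[leb]_t h t)%E.
Proof.
move=> mh h0; transitivity (\int[leb]_(t in
   ((fun t => t - tau)%R : _ -> measurableTypeR R) @^-1` [set: R])
   (h \o (fun t => t - tau)%R) t)%E => //.
rewrite -ge0_integral_pushforward//=; last exact: measurable_subr.
apply: eq_measure_integral => /=; first exact: measurable_subr.
by move=> Hm A mA _; exact: lebesgue_measure_translation.
Qed.

Lemma delay_patch (u : C -> R) (tau : R) (f : R -> C) : u 0 = 0 ->
  (fun t => u (delay tau f t)) =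
  ((fun s => u (f s)) \_ (@Rplus R)) \o (fun t => t - tau).
Proof.
move=> u0; apply/funext => t; rewrite /delay /= patchE.
rewrite /Rplus mem_setE/= in_itv/= andbT subr_ge0; case: ifP => //.
Qed.

Lemma square_integrable_delay (tau : R) (f : R -> C) :
  square_integrable f -> square_integrable (delay tau f).
Proof.
have mR := @measurable_Rplus R.
move=> [fr fi f2].
have mdelay (u : C -> R) : u 0 = 0 ->
    measurable_fun (@Rplus R) (fun t => u (f t)) ->
    measurable_fun (@Rplus R) (fun t => u (delay tau f t)).
  move=> u0 mu; rewrite delay_patch//; apply: measurable_funTS.
  apply: measurableT_comp; last exact: measurable_subr.
  exact: (measurable_restrictT (fun s => u (f s)) mR).1.
have mr := mdelay (@complex.Re R) erefl fr.
have mi := mdelay (@complex.Im R) erefl fi.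
split=> //.
have n0 : Normc.normc (0 : C) ^+ 2 = 0 by rewrite normc2E/= expr0n/= addr0.
set h : R -> \bar R := (fun t => (Normc.normc (f t) ^+ 2)%:E) \_ (@Rplus R).
have hE t : (Normc.normc (delay tau f t) ^+ 2)%:E = h (t - tau).
  have := congr1 (@^~ t) (@delay_patch (fun z => Normc.normc z ^+ 2) tau f n0).
  by rewrite /= /h => ->; rewrite !patchE; case: ifP.
have mh : measurable_fun [set: R] h.
  exact: (measurable_restrictT _ mR).1 (measurable_normc2 fr fi).
have h0 t : (0 <= h t)%E.
  by rewrite /h patchE; case: ifP => // _; rewrite lee_fin sqr_ge0.
under eq_integral do rewrite hE.
apply: (@le_lt_trans _ _ (\int[leb]_t h (t - tau)%R)%E).
  apply: ge0_subset_integral => //.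
  by apply: measurableT_comp => //; exact: measurable_subr.
by rewrite ge0_integral_translation// /h -integral_mkcond.
Qed.

Lemma L2pred_delay (tau : {nonneg R}) (f : L2 R) :
  delay tau%:num f \in @L2pred R.
Proof.
exact/asboolP/square_integrable_delay/L2repr_square_integrable.
Qed.

Definition translate (tau : {nonneg R}) (f : L2 R) : L2 R :=
  \pi_(L2 R) (MkL2fun (L2pred_delay tau f)).

Lemma translateE (tau : {nonneg R}) (f : L2 R) :
  ae_eq leb (@Rplus R) (translate tau f) (delay tau%:num f).
Proof. exact: L2_reprP. Qed.

End Delay.

Section Hardy.
Variable R : realType.
Local Notation C := R[i].
Local Notation leb := (@lebesgue_measure R).

Definition cis (theta : R) : C := cos theta +i* sin theta.

Definition cexp (z : C) : C := (expR (complex.Re z))%:C * cis (complex.Im z).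

Definition cintegral (D : set R) (f : R -> C) : C :=
  (\int[leb]_(t in D) complex.Re (f t))
    +i* (\int[leb]_(t in D) complex.Im (f t)).

Definition disk : set C := [set z | `|z| < 1].

(* Functions on the disk are encoded as [C -> C] with junk values outside.
   The sequence [a] is the sequence of Taylor coefficients of [G] at 0. *)
Definition Hardy2 (G : C -> C) : Prop :=
  exists a : nat -> C,
    (\sum_(0 <= n <oo) (Normc.normc (a n) ^+ 2)%:E < +oo)%E /\
    forall z, disk z -> series (fun n => a n * z ^+ n) @ \oo --> G z.

(* Radial limit, which exists for almost every theta when [Hardy2 G]. *)
Definition boundary (G : C -> C) (theta : R) : C :=
  lim (G (r%:C * cis theta) @[r --> (1 : R)^'-]).

(* For nonzero [G] with [Hardy2 G], log |boundary G| is integrable, so the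
   totalized [ln 0 = 0] and the default values of [lim] and of the integral
   play no role. *)
Definition outer (G : C -> C) : Prop :=
  [/\ Hardy2 G,
      exists2 z, disk z & G z != 0 &
      exists2 lambda : C, `|lambda| = 1 &
        forall z, disk z ->
          G z = lambda * cexp (((2 * pi)^-1)%:C *
            cintegral `[0, 2 * pi] (fun theta =>
              (cis theta + z) / (cis theta - z)
                * (ln (Normc.normc (boundary G theta)))%:C))].

Definition HardyTransform (f : L2 R) (z : C) : C :=
  (Num.sqrt 2)%:C / (1 + z) *
    cintegral (@Rplus R) (fun t => f t * cexp (t%:C * (z - 1) / (z + 1))).

Definition minimum_phase : set (L2 R) := [set f | outer (HardyTransform f)].

Definition delayed_minimum_phase : set (L2 R) :=
  [set g | exists tau f, minimum_phase f /\ g = translate tau f].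

End Hardy.

Section Dimension.
Variables (K : fieldType) (V : lmodType K).

Definition linearly_independent (B : set V) : Prop :=
  forall (s : seq V) (c : V -> K), uniq s -> {in s, forall v, B v} ->
    \sum_(v <- s) c v *: v = 0 -> {in s, forall v, c v = 0}.

Definition linear_span (B : set V) : set V :=
  [set v | exists (s : seq V) (c : V -> K),
     {in s, forall b, B b} /\ v = \sum_(b <- s) c b *: b].

Definition hamel_basis (S B : set V) : Prop :=
  linearly_independent B /\ linear_span B = S.

(* [S] is a possibly infinite-dimensional subspace. *)
Definition dim_ge (n : nat) (S : set V) : Prop :=
  exists2 B, hamel_basis S B & (`I_n #<= B)%card.

End Dimension.

Definition rank_ge (K : fieldType) (V W : lmodType K) (n : nat)
    (A : {linear V -> W}) : Prop :=
  dim_ge n (range A).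

(* Main.v *)
Require Import Defs.
From HB Require Import structures.
From mathcomp Require Import all_boot all_order all_algebra complex.
From mathcomp Require Import all_classical all_reals all_analysis.
From mathcomp Require Import measurable_realfun ring_quotient.
From mathcomp Require Import ring lra.

Set Implicit Arguments.
Unset Strict Implicit.
Unset Printing Implicit Defensive.

Import Order.TTheory GRing.Theory Num.Theory.
Import numFieldNormedType.Exports.

Local Open Scope classical_set_scope.
Local Open Scope ring_scope.

(** Under the Hardy transform the space of square integrable functions on the
    half line becomes the space of power series on the disk with square summable
    coefficients, and both invariance hypotheses imply that the transform of the
    image of a minimum phase function never vanishes on the disk: translation
    multiplies the transform by an exponential ([HT_translate]).

    Fix a point of the disk and let psi be the value there of the transform of
    the image under the operator. This is a linear functional on the Hardy space
    that vanishes at no outer function, and no continuity is known. In the spirit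
    of the theorem of Gleason, Kahane and Zelazko such a functional is a multiple
    of evaluation at some point of the disk ([functional_evaluation]). If s has
    real part at least 1, then (lam - z)^n s is outer for |lam| >= 1
    ([outer_fejer]), so the polynomial psi ((lam - z)^n s) in lam has all its
    zeros in the open disk; comparing the first two power sums of the zeros as n grows
    gives psi (z^2 s) psi (s) = psi (z s)^2 ([psi_square]). Every Hardy function
    is p - q + i c with p and q of nonnegative real part and c a real constant
    ([hardy_decomposition]); with s = 1 + q + t (p - q + i c), 0 <= t <= 1, the
    identity becomes an equality of polynomials in t and shows that the kernel of
    psi is invariant under multiplication by z ([psi_mulz_eq0]). Hence
    psi (z a) = w psi (a) for a number w, which lies in the disk since w - z would
    otherwise be outer, and division of a - a(w) by z - w gives psi (a) = a(w) psi (1).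

    The operator is therefore a weighted composition operator with zero-free
    weight and with a symbol w that is a quotient of two Hardy functions
    ([weighted_composition]). It is not constant because the rank is at least two;
    being continuous, it takes infinitely many values in a compact part of the
    disk, by the intermediate value theorem on a segment
    ([symbol_many_values]). A function in the kernel of the operator has a
    transform that vanishes at all these values, hence everywhere
    ([ps_identity]), and the transform is injective ([HT_injective]).

    The two analytic inputs are Fatou's theorem on radial limits
    ([fatou_radial]), which identifies boundary functions, and the expansion in
    Laguerre functions ([psum_lcoef]), which turns the transform into a power
    series. *)

(** * The modulus of complex numbers *)

Section Modulus.
Variable R : realType.
Local Notation C := R[i].
Implicit Types (z w : C) (x : R).
Local Notation nc := (@Normc.normc R).
Local Notation cj := (@conjc R).
Local Notation Re := (@complex.Re R).
Local Notation Im := (@complex.Im R).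
Local Open Scope complex_scope.

Lemma normrC z : `|z| = (nc z)%:C.
Proof. by []. Qed.

Lemma diskE z : disk z <-> nc z < 1.
Proof. by rewrite /disk /= normrC -(ltcR (nc z) 1). Qed.

Lemma nc_ge0 z : 0 <= nc z.
Proof. by case: z => a b /=; exact: sqrtr_ge0. Qed.

Lemma ncM z w : nc (z * w) = nc z * nc w.
Proof. exact: Normc.normcM. Qed.

Lemma ncN z : nc (- z) = nc z.
Proof. exact: normcN. Qed.

Lemma ncD z w : nc (z + w) <= nc z + nc w.
Proof. exact: le_normcD. Qed.

Lemma ncB z w : nc (z - w) <= nc z + nc w.
Proof. by rewrite -(ncN w) ncD. Qed.

Lemma nc_eq0 z : (nc z == 0) = (z == 0).
Proof.
apply/eqP/eqP => [|->]; [exact: Normc.eq0_normc|exact: Normc.normc0].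
Qed.

Lemma nc0 : nc 0 = 0. Proof. exact: Normc.normc0. Qed.
Lemma nc1 : nc 1 = 1. Proof. exact: Normc.normc1. Qed.

Lemma nc_gt0 z : (0 < nc z) = (z != 0).
Proof. by rewrite lt_def nc_ge0 andbT nc_eq0. Qed.

Lemma ncV z : nc z^-1 = (nc z)^-1.
Proof. exact: Normc.normcV. Qed.

Lemma ncX z n : nc (z ^+ n) = nc z ^+ n.
Proof. by elim: n => [|n IH]; rewrite ?expr0 ?nc1// !exprS ncM IH. Qed.

Lemma ncR x : nc x%:C = `|x|.
Proof. by rewrite /= expr0n/= addr0 sqrtr_sqr. Qed.

Lemma nc_conj z : nc (cj z) = nc z.
Proof. by case: z => a b /=; rewrite sqrrN. Qed.

Lemma ler_nc_dist z w : nc z - nc w <= nc (z - w).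
Proof. by rewrite lerBlDr (le_trans _ (ncD _ _))// subrK. Qed.

Lemma nc_distC z w : nc (z - w) = nc (w - z).
Proof. by rewrite -ncN opprB. Qed.

Lemma ler_dist_nc z w : `|nc z - nc w| <= nc (z - w).
Proof. by rewrite ler_norml lerNl opprB ler_nc_dist nc_distC ler_nc_dist. Qed.

Lemma cReD z w : Re (z + w) = Re z + Re w. Proof. by case: z w => ? ? []. Qed.
Lemma cImD z w : Im (z + w) = Im z + Im w. Proof. by case: z w => ? ? []. Qed.
Lemma cReN z : Re (- z) = - Re z. Proof. by case: z. Qed.
Lemma cImN z : Im (- z) = - Im z. Proof. by case: z. Qed.
Lemma cReB z w : Re (z - w) = Re z - Re w. Proof. by rewrite cReD cReN. Qed.
Lemma cImB z w : Im (z - w) = Im z - Im w. Proof. by rewrite cImD cImN. Qed.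
Lemma cReM z w : Re (z * w) = Re z * Re w - Im z * Im w.
Proof. by case: z w => ? ? []. Qed.
Lemma cImM z w : Im (z * w) = Re z * Im w + Im z * Re w.
Proof. by case: z w => ? ? []. Qed.
Lemma cReJ z : Re (cj z) = Re z. Proof. by case: z. Qed.
Lemma cImJ z : Im (cj z) = - Im z. Proof. by case: z. Qed.
Lemma cReZ x z : Re (x%:C * z) = x * Re z.
Proof. by rewrite cReM /= mul0r subr0. Qed.
Lemma cImZ x z : Im (x%:C * z) = x * Im z.
Proof. by rewrite cImM /= mul0r addr0. Qed.

Lemma Re_sum I (s : seq I) (F : I -> C) :
  Re (\sum_(i <- s) F i) = \sum_(i <- s) Re (F i).
Proof. by elim/big_rec2 : _ => // i x y _ <-; rewrite cReD. Qed.
Lemma nc_sum I (s : seq I) (F : I -> C) :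
  nc (\sum_(i <- s) F i) <= \sum_(i <- s) nc (F i).
Proof.
elim/big_rec2 : _ => [|i y x _ h]; first by rewrite nc0.
by rewrite (le_trans (ncD _ _))// lerD2l.
Qed.

Lemma cJM z w : (cj (z * w)) = (cj z) * (cj w). Proof. exact: rmorphM. Qed.
Lemma cJD z w : (cj (z + w)) = (cj z) + (cj w). Proof. exact: rmorphD. Qed.
Lemma cJ_sum I (s : seq I) (F : I -> C) :
  (cj (\sum_(i <- s) F i)) = \sum_(i <- s) (cj (F i)).
Proof. exact: rmorph_sum. Qed.

Lemma RtoC_sum I (s : seq I) (F : I -> R) :
  (\sum_(i <- s) F i)%:C = \sum_(i <- s) (F i)%:C.
Proof. exact: rmorph_sum. Qed.

Lemma cJR x : (cj (x%:C)) = x%:C. Proof. exact: conjc_real. Qed.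
Lemma cJK z : (cj ((cj z))) = z. Proof. exact: conjcK. Qed.

Lemma Ceq z w : Re z = Re w -> Im z = Im w -> z = w.
Proof. by case: z w => ? ? [? ?] /= -> ->. Qed.

Lemma mulCJ z : z * (cj z) = (nc z ^+ 2)%:C.
Proof.
by rewrite normc2E; case: z => a b; simpc; apply: Ceq => /=; ring.
Qed.

Lemma Re_le_nc z : `|Re z| <= nc z.
Proof.
case: z => a b; rewrite -sqrtr_sqr /=; apply: ler_wsqrtr.
by rewrite lerDl sqr_ge0.
Qed.

Lemma Im_le_nc z : `|Im z| <= nc z.
Proof.
case: z => a b; rewrite -sqrtr_sqr /=; apply: ler_wsqrtr.
by rewrite lerDr sqr_ge0.
Qed.

Lemma nc_le_ReIm z : nc z <= `|Re z| + `|Im z|.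
Proof.
rewrite {1}(complexE z) (le_trans (ncD _ _))// ncM !ncR.
by rewrite [nc (Complex 0 1)]/= expr0n expr1n add0r sqrtr1 mul1r.
Qed.

Lemma nc2D z w :
  nc (z + w) ^+ 2 = nc z ^+ 2 + nc w ^+ 2 + 2 * Re (z * (cj w)).
Proof.
by rewrite !normc2E cReM cReD cImD cReJ cImJ; ring.
Qed.

Lemma nc2D_le z w : nc (z + w) ^+ 2 <= 2 * nc z ^+ 2 + 2 * nc w ^+ 2.
Proof.
rewrite !normc2E cReD cImD.
have := sqr_ge0 (Re z - Re w); have := sqr_ge0 (Im z - Im w).
move: (Re z) (Re w) (Im z) (Im w) => a b c d; nra.
Qed.

(** The topology of the complex numbers is that of the modulus. *)
Lemma cvgC T (F : set_system T) (FF : Filter F) (u : T -> C) (l : C) :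
  u @ F --> l <-> (forall e, 0 < e -> \forall x \near F, nc (l - u x) < e).
Proof.
split.
  move=> /cvgrPdist_lt h e e0; have := h e%:C.
  rewrite -[X in (X < _) -> _]/(0%:C) ltcR => /(_ e0); apply: filterS => x.
  by rewrite normrC ltcR.
move=> h; apply/cvgrPdist_lt => e e0.
have eE : e = (Re e)%:C.
  by move: e0; rewrite ltcE => /andP[/eqP]; case: (e) => a b /= ->.
move: e0; rewrite eE -[X in (X < _) -> _]/(0%:C) ltcR => e0.
by apply: filterS (h _ e0) => x; rewrite normrC ltcR.
Qed.
End Modulus.

(** * Integrals of complex-valued functions *)

Section ComplexIntegral.
Variable R : realType.
Local Notation C := R[i].
Local Notation nc := (@Normc.normc R).
Local Notation cj := (@conjc R).
Local Notation Re := (@complex.Re R).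
Local Notation Im := (@complex.Im R).
Local Notation leb := (@lebesgue_measure R).
Local Open Scope complex_scope.
Variable D : set R.
Hypothesis mD : measurable (D : set (measurableTypeR R)).
Implicit Types (f g : R -> C) (u v : R -> R).

Definition rintble u := leb.-integrable D (fun t => (u t)%:E).

Lemma rintbleD u v : rintble u -> rintble v -> rintble (fun t => u t + v t).
Proof.
by move=> hu hv; have := integrableD mD hu hv; apply: eq_integrable.
Qed.

Lemma rintbleZ k u : rintble u -> rintble (fun t => k * u t).
Proof.
by move=> hu; have := integrableZl mD k hu; apply: eq_integrable.
Qed.

Lemma rintbleB u v : rintble u -> rintble v -> rintble (fun t => u t - v t).
Proof.
by move=> hu hv; have := integrableB mD hu hv; apply: eq_integrable.
Qed.

Lemma rintble0 : rintble (fun=> 0).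
Proof. by have := integrable0 leb D; apply: eq_integrable. Qed.

Lemma rintble_norm u : rintble u -> rintble (fun t => `|u t|).
Proof. by move=> hu; exact: integrable_norm. Qed.

Lemma rintble_le u v : measurable_fun D u ->
  (forall t, D t -> `|u t| <= v t) -> rintble v -> rintble u.
Proof.
move=> mu uv; apply: le_integrable => //; first exact/measurable_EFinP.
move=> t Dt; rewrite lee_fin (le_trans (uv _ Dt))//.
by rewrite real_ler_norm// num_real.
Qed.

Lemma rintble_meas u : rintble u -> measurable_fun D u.
Proof. by move=> /measurable_int /measurable_EFinP. Qed.

Definition cmeas f := measurable_fun D (Re \o f) /\ measurable_fun D (Im \o f).

Lemma cmeas_cst c : cmeas (fun=> c).
Proof. by split; exact: measurable_cst. Qed.

Lemma cmeas_real u : measurable_fun D u -> cmeas (fun t => (u t)%:C).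
Proof. by split => //; exact: measurable_cst. Qed.

Lemma cmeasD f g : cmeas f -> cmeas g -> cmeas (fun t => f t + g t).
Proof.
move=> [a b] [a' b']; split.
  by under [_ \o _]eq_fun do rewrite cReD; exact: measurable_funD.
by under [_ \o _]eq_fun do rewrite cImD; exact: measurable_funD.
Qed.

Lemma cmeasM f g : cmeas f -> cmeas g -> cmeas (fun t => f t * g t).
Proof.
move=> [a b] [a' b']; split.
  under [_ \o _]eq_fun do rewrite cReM.
  by apply: measurable_funB; exact: measurable_funM.
under [_ \o _]eq_fun do rewrite cImM.
by apply: measurable_funD; exact: measurable_funM.
Qed.

Lemma cmeasJ f : cmeas f -> cmeas (fun t => (cj (f t))).
Proof.
move=> [a b]; split; first by under [_ \o _]eq_fun do rewrite cReJ.
by under [_ \o _]eq_fun do rewrite cImJ; exact: measurableT_comp.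
Qed.

Lemma cmeasN f : cmeas f -> cmeas (fun t => - f t).
Proof.
move=> mf; under eq_fun do rewrite -mulN1r; apply: cmeasM => //.
exact: cmeas_cst.
Qed.

Lemma cmeasB f g : cmeas f -> cmeas g -> cmeas (fun t => f t - g t).
Proof. by move=> mf mg; apply: cmeasD => //; exact: cmeasN. Qed.

Lemma cmeas_sum (I : Type) (s : seq I) (F : I -> R -> C) :
  (forall i, cmeas (F i)) -> cmeas (fun t => \sum_(i <- s) F i t).
Proof.
move=> h; elim: s => [|i s IH].
  by under eq_fun do rewrite big_nil; exact: cmeas_cst.
by under eq_fun do rewrite big_cons; exact: cmeasD.
Qed.

Lemma cmeas_nc2 f : cmeas f -> measurable_fun D (fun t => nc (f t) ^+ 2).
Proof. by move=> [a b]; apply/measurable_EFinP; exact: measurable_normc2. Qed.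

Lemma cmeas_nc f : cmeas f -> measurable_fun D (fun t => nc (f t)).
Proof.
move=> /cmeas_nc2 m.
rewrite (_ : (fun t => _) =
    (fun x : R => x `^ 2^-1) \o (fun t => nc (f t) ^+ 2)); last first.
  apply/funext => t /=.
  by rewrite powR12_sqrt ?sqr_ge0// sqrtr_sqr ger0_norm// nc_ge0.
by apply: measurableT_comp => //; exact: measurable_powR.
Qed.

Lemma cmeas_inv f : (forall t, D t -> f t != 0) -> cmeas f ->
  cmeas (fun t => (f t)^-1).
Proof.
move=> f0 mf.
have m : measurable_fun D (fun t => (nc (f t) ^+ 2)^-1).
  rewrite (_ : (fun t => _) =
      (fun x : R => x `^ (-1)) \o (fun t => nc (f t) ^+ 2)); last first.
    by apply/funext => t /=; rewrite powR_inv1// sqr_ge0.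
  by apply: measurableT_comp (cmeas_nc2 mf); exact: measurable_powR.
have h t : (f t)^-1 = (cj (f t)) * ((nc (f t) ^+ 2)^-1)%:C.
  have [->|ft] := eqVneq (f t) 0; first by rewrite invr0 rmorph0 mul0r.
  apply: (mulfI ft); rewrite mulfV// mulrA mulCJ -rmorphM/= mulfV//.
  by rewrite expf_neq0// nc_eq0.
under eq_fun do rewrite h; apply: cmeasM; first exact: cmeasJ.
exact: cmeas_real.
Qed.

Definition cintble f := rintble (Re \o f) /\ rintble (Im \o f).

Lemma cintble_meas f : cintble f -> cmeas f.
Proof. by move=> [a b]; split; exact: rintble_meas. Qed.

Lemma cintbleD f g : cintble f -> cintble g -> cintble (fun t => f t + g t).
Proof.
move=> [a b] [a' b']; rewrite /cintble.
have -> : Re \o (fun t => f t + g t) = fun t => Re (f t) + Re (g t).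
  by apply/funext => t; rewrite /= cReD.
have -> : Im \o (fun t => f t + g t) = fun t => Im (f t) + Im (g t).
  by apply/funext => t; rewrite /= cImD.
by split; exact: rintbleD.
Qed.

Lemma cintbleZ c f : cintble f -> cintble (fun t => c * f t).
Proof.
move=> [a b]; rewrite /cintble.
have -> : Re \o (fun t => c * f t) = fun t => Re c * Re (f t) - Im c * Im (f t).
  by apply/funext => t; rewrite /= cReM.
have -> : Im \o (fun t => c * f t) = fun t => Re c * Im (f t) + Im c * Re (f t).
  by apply/funext => t; rewrite /= cImM.
by split; [apply: rintbleB|apply: rintbleD]; exact: rintbleZ.
Qed.

Lemma cintbleN f : cintble f -> cintble (fun t => - f t).
Proof. by move=> /(cintbleZ (-1)); under eq_fun do rewrite mulN1r. Qed.

Lemma cintbleB f g : cintble f -> cintble g -> cintble (fun t => f t - g t).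
Proof. by move=> hf /cintbleN; exact: cintbleD. Qed.

Lemma cintble0 : cintble (fun=> 0).
Proof. by split; exact: rintble0. Qed.

Lemma cintble_sum (I : Type) (s : seq I) (F : I -> R -> C) :
  (forall i, cintble (F i)) -> cintble (fun t => \sum_(i <- s) F i t).
Proof.
move=> h; elim: s => [|i s IH].
  by under eq_fun do rewrite big_nil; exact: cintble0.
by under eq_fun do rewrite big_cons; exact: cintbleD.
Qed.

Lemma cintbleJ f : cintble f -> cintble (fun t => (cj (f t))).
Proof.
move=> [a b]; rewrite /cintble.
have -> : Re \o (fun t => (cj (f t))) = Re \o f.
  by apply/funext => t; rewrite /= cReJ.
have -> : Im \o (fun t => (cj (f t))) = fun t => (-1) * Im (f t).
  by apply/funext => t; rewrite /= cImJ mulN1r.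
by split => //; exact: rintbleZ.
Qed.

Lemma cintble_le f v : cmeas f -> rintble v ->
  (forall t, D t -> nc (f t) <= v t) -> cintble f.
Proof.
move=> [a b] hv h; split; apply: rintble_le hv => // t /h; apply: le_trans.
  exact: Re_le_nc.
exact: Im_le_nc.
Qed.

Lemma cintble_nc f : cintble f -> rintble (fun t => nc (f t)).
Proof.
move=> hf; have [a b] := hf.
apply: (@rintble_le _ (fun t => `|Re (f t)| + `|Im (f t)|)).
  exact: cmeas_nc (cintble_meas hf).
- by move=> t _; rewrite ger0_norm ?nc_ge0// nc_le_ReIm.
- by apply: rintbleD; exact: rintble_norm.
Qed.

Lemma RintD u v : rintble u -> rintble v ->
  \int[leb]_(t in D) (u t + v t) =
  \int[leb]_(t in D) u t + \int[leb]_(t in D) v t.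
Proof. exact: RintegralD. Qed.

Lemma RintB u v : rintble u -> rintble v ->
  \int[leb]_(t in D) (u t - v t) =
  \int[leb]_(t in D) u t - \int[leb]_(t in D) v t.
Proof. exact: RintegralB. Qed.

Lemma RintZ k u : rintble u ->
  \int[leb]_(t in D) (k * u t) = k * \int[leb]_(t in D) u t.
Proof. exact: RintegralZl. Qed.

Lemma Rint_le u v : rintble u -> rintble v ->
  (forall t, D t -> u t <= v t) ->
  \int[leb]_(t in D) u t <= \int[leb]_(t in D) v t.
Proof. exact: le_Rintegral. Qed.

Lemma eq_Rint u v : (forall t, D t -> u t = v t) ->
  \int[leb]_(t in D) u t = \int[leb]_(t in D) v t.
Proof. by move=> h; apply: eq_Rintegral => t /set_mem; exact: h. Qed.

Local Notation cint := (cintegral D).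

Lemma eq_cint f g : (forall t, D t -> f t = g t) -> cint f = cint g.
Proof.
by move=> h; rewrite /cintegral; congr Complex; apply: eq_Rint => t /h ->.
Qed.

Lemma cintD f g : cintble f -> cintble g ->
  cint (fun t => f t + g t) = cint f + cint g.
Proof.
move=> [a b] [a' b']; apply: Ceq; rewrite ?cReD ?cImD /=.
  by under eq_Rintegral do rewrite cReD; exact: RintD.
by under eq_Rintegral do rewrite cImD; exact: RintD.
Qed.

Lemma cintZ c f : cintble f -> cint (fun t => c * f t) = c * cint f.
Proof.
move=> [a b]; apply: Ceq; rewrite ?cReM ?cImM /=.
  under eq_Rintegral do rewrite cReM.
  by rewrite RintB ?RintZ//; exact: rintbleZ.
under eq_Rintegral do rewrite cImM.
by rewrite RintD ?RintZ//; exact: rintbleZ.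
Qed.

Lemma cintN f : cintble f -> cint (fun t => - f t) = - cint f.
Proof.
move=> hf; rewrite -mulN1r -cintZ//.
by apply: eq_cint => t _; rewrite mulN1r.
Qed.

Lemma cintB f g : cintble f -> cintble g ->
  cint (fun t => f t - g t) = cint f - cint g.
Proof. by move=> hf hg; rewrite cintD ?cintN//; exact: cintbleN. Qed.

Lemma cint0 : cint (fun=> 0) = 0.
Proof.
by apply: Ceq; rewrite /= /Rintegral integral0.
Qed.

Lemma cint_sum (I : Type) (s : seq I) (F : I -> R -> C) :
  (forall i, cintble (F i)) ->
  cint (fun t => \sum_(i <- s) F i t) = \sum_(i <- s) cint (F i).
Proof.
move=> h; elim: s => [|i s IH].
  by rewrite big_nil -[RHS]cint0; apply: eq_cint => t _; rewrite big_nil.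
rewrite big_cons -IH -cintD//; last exact: cintble_sum.
by apply: eq_cint => t _; rewrite big_cons.
Qed.

Lemma cintJ f : cintble f -> cint (fun t => (cj (f t))) = (cj (cint f)).
Proof.
move=> [a b]; apply: Ceq; rewrite ?cReJ ?cImJ /=.
  by apply: eq_Rint => t _; rewrite cReJ.
rewrite -mulN1r -RintZ//; apply: eq_Rint => t _; by rewrite cImJ mulN1r.
Qed.

Lemma cint_real u : cint (fun t => (u t)%:C) = (\int[leb]_(t in D) u t)%:C.
Proof. by apply: Ceq => //=; rewrite /Rintegral integral0. Qed.

Lemma nc_cint f : cintble f ->
  nc (cint f) <= 2 * \int[leb]_(t in D) nc (f t).
Proof.
move=> hf; have [a b] := hf; have hn := cintble_nc hf.
rewrite (le_trans (nc_le_ReIm _))// mulr_natl mulr2n lerD//.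
  apply: le_trans (le_normr_Rintegral mD a) _.
  by apply: Rint_le => // [|t _]; [exact: rintble_norm|exact: Re_le_nc].
apply: le_trans (le_normr_Rintegral mD b) _.
by apply: Rint_le => // [|t _]; [exact: rintble_norm|exact: Im_le_nc].
Qed.

Lemma nc_cint_le f v : cmeas f -> rintble v ->
  (forall t, D t -> nc (f t) <= v t) ->
  nc (cint f) <= 2 * \int[leb]_(t in D) v t.
Proof.
move=> mf hv h; have hf := cintble_le mf hv h.
apply: le_trans (nc_cint hf) _; rewrite ler_pM2l//.
by apply: Rint_le => //; exact: cintble_nc.
Qed.

End ComplexIntegral.

(** * Square summable sequences and square integrable functions *)

Section SquareSummable.
Variable R : realType.
Local Notation C := R[i].
Local Notation nc := (@Normc.normc R).
Local Notation cj := (@conjc R).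
Implicit Type a : nat -> C.

(** Bounding the partial sums keeps the condition inside the reals. *)
Definition l2 a := exists M : R, forall N, \sum_(n < N) nc (a n) ^+ 2 <= M.

Lemma l2_sumW a N M : (N <= M)%N ->
  \sum_(n < N) nc (a n) ^+ 2 <= \sum_(n < M) nc (a n) ^+ 2.
Proof.
move=> NM; rewrite -!(big_mkord xpredT (fun n => nc (a n) ^+ 2)).
rewrite (big_cat_nat (leq0n _) NM)//= lerDl sumr_ge0// => *; exact: sqr_ge0.
Qed.

(** The tails are dominated by one null sequence, in the form that Cauchy arguments
    consume. *)
Lemma l2_tail a : l2 a -> exists eps : nat -> R,
  [/\ eps @ \oo --> (0 : R), (forall n, 0 <= eps n) &
      forall m n, \sum_(m <= k < n) nc (a k) ^+ 2 <= eps m].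
Proof.
move=> [M aM]; pose s N := \sum_(n < N) nc (a n) ^+ 2.
have s_nd : nondecreasing_seq s by move=> m n mn; exact: l2_sumW.
have s_cv : cvgn s.
  apply: nondecreasing_is_cvgn => //; exists M => _ [n _ <-]; exact: aM.
have s_le n : s n <= limn s by exact: nondecreasing_cvgn_le.
exists (fun n => limn s - s n); split.
- rewrite -[X in _ --> X](subrr (limn s)).
  by apply: cvgB; [exact: cvg_cst|exact: s_cv].
- by move=> n; rewrite subr_ge0.
- move=> m n; have [nm|/ltnW mn] := leqP n m.
    by rewrite big_geq// subr_ge0.
  apply: le_trans (lerB (s_le n) (lexx _)); rewrite le_eqVlt; apply/orP; left.
  rewrite /s -!(big_mkord xpredT (fun n => nc (a n) ^+ 2)).
  by rewrite (big_cat_nat (leq0n _) mn)//= addrAC subrr add0r.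
Qed.

Lemma l2D a b : l2 a -> l2 b -> l2 (fun n => a n + b n).
Proof.
move=> [M aM] [K bK]; exists (2 * M + 2 * K) => N.
apply: (@le_trans _ _ (\sum_(n < N) (2 * nc (a n) ^+ 2 + 2 * nc (b n) ^+ 2))).
  by apply: ler_sum => i _; exact: nc2D_le.
by rewrite big_split/= -!mulr_sumr; apply: lerD; rewrite ler_pM2l ?aM ?bK ?ltr0n.
Qed.

Lemma l2Z c a : l2 a -> l2 (fun n => c * a n).
Proof.
move=> [M aM]; exists (nc c ^+ 2 * M) => N.
under eq_bigr do rewrite ncM exprMn.
by rewrite -mulr_sumr ler_wpM2l// sqr_ge0.
Qed.

Lemma l2_bnd a : l2 a -> exists2 K, 0 <= K & forall n, nc (a n) <= K.
Proof.
move=> [M aM]; exists (1 + M) => [|n].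
  by have := aM 0%N; rewrite big_ord0 => M0; rewrite addr_ge0.
have h : nc (a n) ^+ 2 <= M.
  by apply: le_trans (aM n.+1); rewrite big_ord_recr/= lerDr sumr_ge0// => *;
    exact: sqr_ge0.
have := nc_ge0 (a n); move: (nc (a n)) h => x; nra.
Qed.
End SquareSummable.

Section L2space.
Variable R : realType.
Local Notation C := R[i].
Local Notation nc := (@Normc.normc R).
Local Notation cj := (@conjc R).
Local Notation Re := (@complex.Re R).
Local Notation Im := (@complex.Im R).
Local Notation leb := (@lebesgue_measure R).
Local Open Scope complex_scope.
Variable D : set R.
Hypothesis mD : measurable (D : set (measurableTypeR R)).
Implicit Types (f g : R -> C) (u v : R -> R).
Local Notation rintble := (rintble D).
Local Notation cmeas := (cmeas D).
Local Notation cintble := (cintble D).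

Definition sq f := cmeas f /\ rintble (fun t => nc (f t) ^+ 2).

Definition N2 f : R := \int[leb]_(t in D) nc (f t) ^+ 2.

Definition ip f g : C := cintegral D (fun t => f t * (cj (g t))).

Lemma N2_ge0 f : 0 <= N2 f.
Proof. by apply: Rintegral_ge0 => t _; exact: sqr_ge0. Qed.

Lemma rintble_ge0_le u v : measurable_fun D u ->
  (forall t, 0 <= u t <= v t) -> rintble v -> rintble u.
Proof.
move=> mu uv; apply: rintble_le => // t _.
by have /andP[u0] := uv t; rewrite ger0_norm.
Qed.

Lemma sq_mul f g : sq f -> sq g -> cintble (fun t => f t * g t).
Proof.
move=> [mf f2] [mg g2].
apply: (@cintble_le _ _ mD _ (fun t => nc (f t) ^+ 2 + nc (g t) ^+ 2)).
- exact: cmeasM.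
- exact: rintbleD.
- move=> t _; rewrite ncM; move: (nc_ge0 (f t)) (nc_ge0 (g t)).
  by move: (nc (f t)) (nc (g t)) => x y; have := sqr_ge0 (x - y); nra.
Qed.

Lemma sqJ f : sq f -> sq (fun t => (cj (f t))).
Proof.
move=> [mf f2]; split; first exact: cmeasJ.
by under [fun _ => _]eq_fun do rewrite nc_conj.
Qed.

Lemma sqD f g : sq f -> sq g -> sq (fun t => f t + g t).
Proof.
move=> [mf f2] [mg g2]; split; first exact: cmeasD.
apply: (@rintble_ge0_le _ (fun t => 2 * nc (f t) ^+ 2 + 2 * nc (g t) ^+ 2)).
- exact: cmeas_nc2 (cmeasD mf mg).
- by move=> t; rewrite sqr_ge0 nc2D_le.
- by apply: rintbleD => //; exact: rintbleZ.
Qed.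

Lemma sqZ c f : sq f -> sq (fun t => c * f t).
Proof.
move=> [mf f2]; split; first by apply: cmeasM => //; exact: cmeas_cst.
under [fun _ => _]eq_fun do rewrite ncM exprMn; exact: rintbleZ.
Qed.

Lemma sqN f : sq f -> sq (fun t => - f t).
Proof. by move=> /(sqZ (-1)); under eq_fun do rewrite mulN1r. Qed.

Lemma sqB f g : sq f -> sq g -> sq (fun t => f t - g t).
Proof. by move=> hf /sqN; exact: sqD. Qed.

Lemma sq0 : sq (fun=> 0).
Proof.
split; first exact: cmeas_cst.
by under [fun _ => _]eq_fun do rewrite nc0 expr0n; exact: rintble0.
Qed.

Lemma sq_sum (I : Type) (s : seq I) (F : I -> R -> C) :
  (forall i, sq (F i)) -> sq (fun t => \sum_(i <- s) F i t).
Proof.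
move=> h; elim: s => [|i s IH].
  by under eq_fun do rewrite big_nil; exact: sq0.
by under eq_fun do rewrite big_cons; exact: sqD.
Qed.

Lemma ip_cintble f g : sq f -> sq g -> cintble (fun t => f t * (cj (g t))).
Proof. by move=> hf hg; apply: sq_mul => //; exact: sqJ. Qed.

Lemma ipE f : ip f f = (N2 f)%:C.
Proof. by rewrite -cint_real; apply: eq_cint => t _; rewrite mulCJ. Qed.

Lemma ipC f g : sq f -> sq g -> ip g f = (cj (ip f g)).
Proof.
move=> hf hg; rewrite -cintJ//; last exact: ip_cintble.
by apply: eq_cint => t _; rewrite cJM cJK mulrC.
Qed.

Lemma ipDl f f' g : sq f -> sq f' -> sq g ->
  ip (fun t => f t + f' t) g = ip f g + ip f' g.
Proof.
move=> hf hf' hg; rewrite -cintD//; [|exact: ip_cintble..].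
by apply: eq_cint => t _; rewrite mulrDl.
Qed.

Lemma ipZl c f g : sq f -> sq g -> ip (fun t => c * f t) g = c * ip f g.
Proof.
move=> hf hg; rewrite -cintZ//; last exact: ip_cintble.
by apply: eq_cint => t _; rewrite mulrA.
Qed.

Lemma ipBl f f' g : sq f -> sq f' -> sq g ->
  ip (fun t => f t - f' t) g = ip f g - ip f' g.
Proof.
move=> hf hf' hg; rewrite -cintB//; [|exact: ip_cintble..].
by apply: eq_cint => t _; rewrite mulrBl.
Qed.

Lemma ip_suml (I : Type) (s : seq I) (F : I -> R -> C) g :
  (forall i, sq (F i)) -> sq g ->
  ip (fun t => \sum_(i <- s) F i t) g = \sum_(i <- s) ip (F i) g.
Proof.
move=> h hg; rewrite -cint_sum//; last by move=> i; exact: ip_cintble.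
by apply: eq_cint => t _; rewrite mulr_suml.
Qed.

Lemma ipDr f g g' : sq f -> sq g -> sq g' ->
  ip f (fun t => g t + g' t) = ip f g + ip f g'.
Proof.
move=> hf hg hg'; rewrite -cintD//; [|exact: ip_cintble..].
by apply: eq_cint => t _; rewrite cJD mulrDr.
Qed.

Lemma ipZr c f g : sq f -> sq g -> ip f (fun t => c * g t) = (cj c) * ip f g.
Proof.
move=> hf hg; rewrite -cintZ//; last exact: ip_cintble.
by apply: eq_cint => t _; rewrite cJM mulrCA.
Qed.

Lemma ip_sumr (I : Type) (s : seq I) (F : I -> R -> C) g :
  (forall i, sq (F i)) -> sq g ->
  ip g (fun t => \sum_(i <- s) F i t) = \sum_(i <- s) ip g (F i).
Proof.
move=> h hg; rewrite -cint_sum//; last by move=> i; exact: ip_cintble.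
by apply: eq_cint => t _; rewrite cJ_sum mulr_sumr.
Qed.

Lemma N2E f : N2 f = Re (ip f f).
Proof. by rewrite ipE. Qed.

Lemma N2D f g : sq f -> sq g ->
  N2 (fun t => f t + g t) = N2 f + N2 g + 2 * Re (ip f g).
Proof.
move=> hf hg; have hfg := sqD hf hg.
rewrite [LHS]N2E ipDl// !ipDr// !cReD -!N2E (ipC hf hg) cReJ; ring.
Qed.

Lemma N2Z c f : sq f -> N2 (fun t => c * f t) = nc c ^+ 2 * N2 f.
Proof.
move=> [_ hf]; rewrite -[RHS](RintZ mD)//.
by apply: eq_Rint => t _; rewrite ncM exprMn.
Qed.

Lemma N2N f : N2 (fun t => - f t) = N2 f.
Proof. by apply: eq_Rint => t _; rewrite ncN. Qed.

Lemma N2B f g : sq f -> sq g ->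
  N2 (fun t => f t - g t) = N2 f + N2 g - 2 * Re (ip f g).
Proof.
move=> hf hg; rewrite (N2D hf (sqN hg)) N2N.
rewrite (_ : ip f _ = - ip f g); first by rewrite cReN mulrN.
rewrite -cintN//; last exact: ip_cintble.
by apply: eq_cint => t _; rewrite rmorphN/= mulrN.
Qed.

Lemma N2D_le f g : sq f -> sq g ->
  N2 (fun t => f t + g t) <= 2 * N2 f + 2 * N2 g.
Proof.
move=> hf hg; have [_ h] := sqD hf hg; have [_ h1] := hf; have [_ h2] := hg.
rewrite /N2 -!RintZ// -RintD//; [|exact: rintbleZ..].
apply: Rint_le => //; first by apply: rintbleD => //; exact: rintbleZ.
by move=> t _; exact: nc2D_le.
Qed.

Lemma cauchy_schwarz f g : sq f -> sq g -> nc (ip f g) ^+ 2 <= N2 f * N2 g.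
Proof.
move=> hf hg; set z := ip f g.
have key x : 0 <= N2 f + x ^+ 2 * nc z ^+ 2 * N2 g - 2 * x * nc z ^+ 2.
  have := N2_ge0 (fun t => f t - (x%:C * z) * g t).
  rewrite N2B//; last exact: sqZ.
  rewrite N2Z// ncM ncR ipZr// -/z.
  rewrite (_ : Re ((cj (x%:C * z)) * z) = x * nc z ^+ 2); last first.
    by rewrite normc2E cJM cJR !cReM !cImM cReJ cImJ /=; ring.
  rewrite exprMn real_normK ?num_real//; set p := nc z ^+ 2; nra.
move: key; have := N2_ge0 f; have := N2_ge0 g; have := sqr_ge0 (nc z).
move: (nc z ^+ 2) (N2 f) (N2 g) => p F G p0 G0 F0 key.
have [G_eq0|Gn0] := eqVneq G 0.
  have := key ((F + 1) / (2 * p)); rewrite G_eq0 !mulr0 addr0.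
  have [->|pn0] := eqVneq p 0; first by [].
  rewrite (_ : 2 * _ * p = F + 1); last by field.
  by move=> h; exfalso; lra.
have := key (G^-1); rewrite (_ : _ + _ - _ = F - p / G); last by field.
have Gp : 0 < G by rewrite lt_def Gn0.
by rewrite subr_ge0 ler_pdivrMr.
Qed.

Section Orthogonal.
Variables (e : nat -> R -> C) (k : R).
Hypothesis k0 : 0 < k.
Hypothesis sqe : forall n, sq (e n).
Hypothesis orth : forall m n, ip (e m) (e n) = if m == n then k%:C else 0.

Definition osum (a : nat -> C) m n t : C := \sum_(m <= i < n) a i * e i t.

Lemma sq_osum a m n : sq (osum a m n).
Proof. by apply: sq_sum => i; exact: sqZ. Qed.

Lemma ip_osum a m n i :
  ip (osum a m n) (e i) = if (m <= i < n)%N then k%:C * a i else 0.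
Proof.
rewrite ip_suml//; last by move=> j; exact: sqZ.
under eq_bigr do rewrite ipZl// orth.
case: ifP => hi.
  rewrite (bigD1_seq i) ?mem_index_iota ?iota_uniq//= eqxx big1 ?addr0.
    by rewrite mulrC.
  by move=> j /negbTE; rewrite eq_sym => ->; rewrite mulr0.
rewrite big_seq big1// => j; rewrite mem_index_iota.
by case: eqP => [->|]; rewrite ?hi// mulr0.
Qed.

Lemma parseval a m n : N2 (osum a m n) = k * \sum_(m <= i < n) nc (a i) ^+ 2.
Proof.
rewrite N2E {2}/osum ip_sumr//; last 2 first.
- by move=> i; exact: sqZ.
- exact: sq_osum.
rewrite Re_sum mulr_sumr big_seq [RHS]big_seq; apply: eq_bigr => i.
rewrite mem_index_iota => hi; rewrite ipZr//; last exact: sq_osum.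
by rewrite ip_osum hi mulrCA [(cj _) * _]mulrC mulCJ cReZ.
Qed.

Definition ocoef f n : C := ip f (e n) / k%:C.

(** The difference is orthogonal to the partial sum, so squared norms subtract. *)
Lemma N2_rest f N : sq f ->
  N2 (fun t => f t - osum (ocoef f) 0 N t) =
  N2 f - k * \sum_(n < N) nc (ocoef f n) ^+ 2.
Proof.
move=> hf; rewrite N2B//; last exact: sq_osum.
rewrite parseval !big_mkord.
suff -> : Re (ip f (osum (ocoef f) 0 N)) =
    k * \sum_(n < N) nc (ocoef f n) ^+ 2 by ring.
rewrite /osum ip_sumr//; last by move=> i; exact: sqZ.
rewrite Re_sum mulr_sumr big_mkord; apply: eq_bigr => i _.
rewrite ipZr// (_ : ip f (e i) = k%:C * ocoef f i).
  by rewrite mulrCA [(cj _) * _]mulrC mulCJ cReZ.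
by rewrite /ocoef mulrCA mulfV ?mulr1// (inj_eq (@complexI R)) gt_eqF.
Qed.

Lemma bessel f : sq f -> l2 (ocoef f).
Proof.
move=> hf; exists (N2 f / k) => N; rewrite ler_pdivlMr// mulrC -subr_ge0.
by rewrite -N2_rest// N2_ge0.
Qed.

End Orthogonal.
End L2space.

(** * The Riesz-Fischer theorem *)

Section RieszFischer.
Context d (T : measurableType d) (R : realType)
  (mu : {measure set T -> \bar R}) (D : set T).
Hypothesis mD : measurable D.

Lemma cvgn_geometric_increments (u : nat -> R) (c : R) :
  (forall j, `|u j.+1 - u j| <= c * 2^-1 ^+ j) -> cvgn u.
Proof.
move=> h; have cv : cvgn (series (telescope u)).
  apply: normed_cvg; apply: (@series_le_cvg _ _ (geometric c 2^-1)).
  - by move=> n; exact: normr_ge0.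
  - move=> n; apply: le_trans (h n); exact: normr_ge0.
  - exact: h.
  - by apply: is_cvg_geometric_series; rewrite ger0_norm; lra.
have -> : u = (fun n => u 0%N + series (telescope u) n).
  by apply/funext => n; rewrite -eq_sum_telescope.
by apply: is_cvgD => //; exact: is_cvg_cst.
Qed.

Lemma limn_einf_le_cst (u : nat -> \bar R) l :
  (forall n, u n <= l)%E -> (limn_einf u <= l)%E.
Proof.
move=> h; rewrite limn_einf_lim; apply: lime_le; first exact: is_cvg_einfs.
apply: nearW => n; apply: le_trans (h n); apply: ereal_inf_lbound => /=.
by exists n => /=.
Qed.

(** Along a subsequence the consecutive distances decay geometrically, so that
    it converges almost everywhere; Fatou's lemma then bounds the distance of the
    limit to every member of the sequence. *)
Lemma riesz_fischer_real (f : nat -> T -> R) (eps : nat -> R) :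
  (forall n, measurable_fun D (f n)) ->
  eps @ \oo --> (0 : R) ->
  (forall m n, (m <= n)%N ->
    \int[mu]_(t in D) ((f n t - f m t) ^+ 2)%:E <= (eps m)%:E)%E ->
  exists2 g : T -> R, measurable_fun D g &
    forall n, (\int[mu]_(t in D) ((g t - f n t) ^+ 2)%:E <= (eps n)%:E)%E.
Proof.
move=> mf eps0 hf.
have mf2 m n : measurable_fun D (fun t => ((f n t - f m t) ^+ 2)%:E).
  by apply/measurable_EFinP; apply: measurable_funX; exact: measurable_funB.
have /choice[N hN] (j : nat) : exists N, forall n, (N <= n)%N ->
    eps n <= 8^-1 ^+ j.
  have e8 : 0 < 8^-1 ^+ j :> R by apply: exprn_gt0; rewrite invr_gt0.
  have /cvgrPdist_lt /(_ _ e8)[N _ hN] := eps0.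
  exists N => n /hN /=; rewrite sub0r normrN => /ltW; apply: le_trans.
  exact: ler_norm.
pose k j := (j + \sum_(i < j.+1) N i)%N.
have kS j : (k j <= k j.+1)%N.
  rewrite /k [X in (_ <= _ + X)%N]big_ord_recr/=.
  by apply: leq_add; rewrite ?leqnSn// leq_addr.
have keps j : eps (k j) <= 8^-1 ^+ j.
  by apply: hN; rewrite /k big_ord_recr/= addnA leq_addl.
pose w j t := (4 ^+ j * (f (k j.+1) t - f (k j) t) ^+ 2)%:E : \bar R.
have mw j : measurable_fun D (w j).
  apply/measurable_EFinP; apply: measurable_funM => //.
  by apply: measurable_funX; exact: measurable_funB.
have w0 j t : (0 <= w j t)%E.
  by rewrite lee_fin mulr_ge0 ?sqr_ge0// exprn_ge0.
have mS : measurable_fun D (fun t => \sum_(j <oo) w j t)%E.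
  by apply: ge0_emeasurable_sum => // j t _ _; exact: w0.
have intS : (\int[mu]_(t in D) (\sum_(j <oo) w j t) < +oo)%E.
  (* The weights 4^j and the bounds 8^-j leave a geometric series of ratio 1/2. *)
  rewrite integral_nneseries//.
  apply: (@le_lt_trans _ _ (\sum_(j <oo) (geometric 1 2^-1 j)%:E)%E).
    apply: lee_nneseries => [j *|j _]; first by apply: integral_ge0.
    rewrite /w; under eq_integral do rewrite EFinM.
    rewrite ge0_integralZl_EFin//; last by move=> t _; rewrite lee_fin sqr_ge0.
    apply: (@le_trans _ _ ((4 ^+ j)%:E * (8^-1 ^+ j)%:E)%E).
      apply: lee_wpmul2l; first by rewrite lee_fin exprn_ge0.
      by apply: le_trans (hf _ _ (kS j)) _; rewrite lee_fin.
    rewrite -EFinM lee_fin -exprMn /= mul1r (_ : 4 / 8 = 2^-1 :> R)//.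
    by field.
  have := @is_cvg_geometric_series R 1 2^-1.
  rewrite ger0_norm; last by lra.
  move=> cv; have {cv}/cvg_ex[l cv] := cv ltac:(lra).
  rewrite (@cvg_lim _ _ _ _ _ _ l%:E)//; first exact: ltry.
  rewrite (_ : (fun n => _) = EFin \o series (geometric 1 2^-1)).
    by apply: cvg_EFin => //; exact: nearW.
  by apply/funext => n /=; rewrite sumEFin.
have Sfin : {ae mu, forall t, D t -> (\sum_(j <oo) w j t)%E \is a fin_num}.
  apply: integrable_ae => //; apply/integrableP; split => //.
  under eq_integral => t _ do
    (rewrite gee0_abs; last by apply: nneseries_ge0 => // *; exact: w0).
  exact: intS.
have cvk : {ae mu, forall t, D t -> cvgn (fun j => f (k j) t)}.
  apply: filterS Sfin => t h /h {}h; set S := (\sum_(j <oo) w j t)%E in h.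
  have S0 : (0 <= S)%E by apply: nneseries_ge0.
  apply: (@cvgn_geometric_increments _ (Num.sqrt (fine S))) => j.
  have : (w j t <= S)%E.
    apply: le_trans (@nneseries_lim_ge _ (fun j => w j t) xpredT 0%N j.+1 _).
      by rewrite big_nat_recr//= leeDr// sume_ge0.
    by [].
  have fS0 : 0 <= fine S by exact: fine_ge0.
  rewrite -(fineK h) lee_fin => wS.
  rewrite -ler_sqr ?nnegrE ?mulr_ge0 ?exprn_ge0 ?sqrtr_ge0//.
  rewrite real_normK ?num_real// exprMn sqr_sqrtr//.
  rewrite exprAC -(ler_pM2l (_ : 0 < 4 ^+ j)) ?exprn_gt0//.
  apply: le_trans wS _; rewrite mulrCA -exprMn.
  rewrite (_ : 4 * _ = 1 :> R); last by field.
  by rewrite expr1n mulr1.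
pose g t := fine (limn_esup (fun j => (f (k j) t)%:E)).
have mg : measurable_fun D g.
  apply: measurableT_comp => //; apply: measurable_fun_limn_esup => n.
  exact/measurable_EFinP.
apply: (ex_intro2 _ _ g mg) => n.
have gE : ae_eq mu D (fun t => ((g t - f n t) ^+ 2)%:E)
    (fun t => limn_einf (fun j => ((f (k (j + n)%N) t - f n t) ^+ 2)%:E)).
  apply: filterS cvk => t h Dt; have /cvg_ex[l cvl] := h Dt.
  have -> : g t = l.
    rewrite /g; have /cvg_limn_einf_sup[_ ->]// :
      (fun j => (f (k j) t)%:E) @ \oo --> l%:E.
    by apply: cvg_EFin => //; exact: nearW.
  apply/esym; apply: (cvg_limn_einf_sup _).1.
  apply: cvg_EFin; first exact: nearW.
  apply: (@cvg_comp _ _ _ (fun j => f (k (j + n)%N) t) (fun x => (x - f n t) ^+ 2)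
    _ (nbhs l)).
    by rewrite (cvg_shiftn n (fun j => f (k j) t)).
  have : continuous (fun x : R => (x - f n t) ^+ 2).
    move=> x; apply: (@cvg_comp _ _ _ (fun x : R => x - f n t)
      (fun y => y ^+ 2)); last exact: exprn_continuous.
    by apply: cvgB; [exact: cvg_id|exact: cvg_cst].
  exact.
have mm j : measurable_fun D (fun t => ((f (k (j + n)%N) t - f n t) ^+ 2)%:E).
  exact: mf2.
rewrite (ge0_ae_eq_integral _ _ _ _ _ gE)//; last 4 first.
- apply/measurable_EFinP; apply: measurable_funX; exact: measurable_funB.
- rewrite (_ : (fun t => _) = (fun t => - limn_esup (fun j =>
    - ((f (k (j + n)%N) t - f n t) ^+ 2)%:E))%E)//.
  apply: measurableT_comp => //; apply: measurable_fun_limn_esup => j.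
  exact: measurableT_comp.
- by move=> t _; rewrite lee_fin sqr_ge0.
- move=> t _; rewrite limn_einf_lim; apply: lime_ge; first exact: is_cvg_einfs.
  apply: nearW => j; apply: le_ereal_inf_tmp => _ [i _ <-].
  by rewrite lee_fin sqr_ge0.
apply: le_trans (fatou _ _ _ _) _ => //.
  by move=> j t _; rewrite lee_fin sqr_ge0.
apply: limn_einf_le_cst => j; apply: hf.
by apply: leq_trans (leq_addl j n) _; rewrite /k leq_addr.
Qed.

End RieszFischer.

Section RieszFischerComplex.
Variable R : realType.
Local Notation C := R[i].
Local Notation nc := (@Normc.normc R).
Local Notation cj := (@conjc R).
Local Notation Re := (@complex.Re R).
Local Notation Im := (@complex.Im R).
Local Notation leb := (@lebesgue_measure R).
Local Open Scope complex_scope.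
Variable D : set R.
Hypothesis mD : measurable (D : set (measurableTypeR R)).
Implicit Types (f g : R -> C).

Lemma N2_EFin f : sq D f -> (\int[leb]_(t in D) (nc (f t) ^+ 2)%:E = (N2 D f)%:E)%E.
Proof.
by move=> [_ h]; rewrite /N2 /Rintegral fineK//; exact: integrable_fin_num.
Qed.

Lemma rintble_ge0 (u : R -> R) c : measurable_fun D u -> (forall t, 0 <= u t) ->
  (\int[leb]_(t in D) (u t)%:E <= c%:E)%E ->
  rintble D u /\ \int[leb]_(t in D) u t <= c.
Proof.
move=> mu u0 h.
have hu : rintble D u.
  apply/integrableP; split; first exact/measurable_EFinP.
  under eq_integral do rewrite gee0_abs ?lee_fin ?u0//.
  exact: le_lt_trans h (ltry _).
split=> //; rewrite -lee_fin /Rintegral fineK//; exact: integrable_fin_num.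
Qed.

(** The real and imaginary parts converge separately, hence the factor 2. *)
Lemma riesz_fischer (f : nat -> R -> C) (eps : nat -> R) :
  (forall n, sq D (f n)) -> eps @ \oo --> (0 : R) ->
  (forall m n, (m <= n)%N -> N2 D (fun t => f n t - f m t) <= eps m) ->
  exists2 g : R -> C, sq D g &
    forall n, N2 D (fun t => g t - f n t) <= 2 * eps n.
Proof.
move=> hf eps0 h.
have hfe m n : (m <= n)%N ->
    (\int[leb]_(t in D) (nc (f n t - f m t) ^+ 2)%:E <= (eps m)%:E)%E.
  by move=> mn; rewrite (N2_EFin (sqB mD (hf n) (hf m))) lee_fin h.
have mre n : measurable_fun D (fun t => Re (f n t)) by have [[]] := hf n.
have mim n : measurable_fun D (fun t => Im (f n t)) by have [[]] := hf n.
have [|gr mgr hgr] := @riesz_fischer_real _ _ R leb D mD _ eps mre eps0.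
  move=> m n mn; apply: le_trans (hfe _ _ mn); apply: ge0_le_integral => //.
  - by move=> t _; rewrite lee_fin sqr_ge0.
  - apply/measurable_EFinP; apply: measurable_funX.
    exact: measurable_funB (mre n) (mre m).
  - by apply/measurable_EFinP; have [m1 _] := sqB mD (hf n) (hf m); exact: cmeas_nc2.
  - by move=> t _; rewrite lee_fin normc2E cReB lerDl sqr_ge0.
have [|gi mgi hgi] := @riesz_fischer_real _ _ R leb D mD _ eps mim eps0.
  move=> m n mn; apply: le_trans (hfe _ _ mn); apply: ge0_le_integral => //.
  - by move=> t _; rewrite lee_fin sqr_ge0.
  - apply/measurable_EFinP; apply: measurable_funX.
    exact: measurable_funB (mim n) (mim m).
  - by apply/measurable_EFinP; have [m1 _] := sqB mD (hf n) (hf m); exact: cmeas_nc2.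
  - by move=> t _; rewrite lee_fin normc2E cImB lerDr sqr_ge0.
pose g t := gr t +i* gi t.
have mg : cmeas D g by [].
have key n : rintble D (fun t => nc (g t - f n t) ^+ 2) /\
    N2 D (fun t => g t - f n t) <= 2 * eps n.
  have [mfn _] := hf n.
  apply: rintble_ge0; [exact: cmeas_nc2 (cmeasB mg mfn)|by move=> t; exact: sqr_ge0|].
  under eq_integral do rewrite normc2E cReB cImB EFinD.
  rewrite ge0_integralD//; last 4 first.
  - by move=> t _; rewrite lee_fin sqr_ge0.
  - apply/measurable_EFinP; apply: measurable_funX.
    exact: measurable_funB mgr (mre n).
  - by move=> t _; rewrite lee_fin sqr_ge0.
  - apply/measurable_EFinP; apply: measurable_funX.
    exact: measurable_funB mgi (mim n).
  rewrite mulr_natl mulr2n EFinD; apply: leeD; [exact: hgr|exact: hgi].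
have sg : sq D g.
  have [mf0 _] := hf 0%N.
  have : sq D (fun t => (g t - f 0%N t) + f 0%N t).
    apply: sqD => //; split; first exact: cmeasB.
    by have [] := key 0%N.
  by under eq_fun do rewrite subrK.
by exists g => // n; have [] := key n.
Qed.

Section Orthogonal.
Variables (e : nat -> R -> C) (k : R).
Hypothesis k0 : 0 < k.
Hypothesis sqe : forall n, sq D (e n).
Hypothesis orth :
  forall m n, ip D (e m) (e n) = if m == n then k%:C else 0.

Lemma le_cvg0 (u v : nat -> R) : (forall n, 0 <= u n <= v n) ->
  v @ \oo --> (0 : R) -> u @ \oo --> (0 : R).
Proof.
move=> uv v0; apply: (squeeze_cvgr _ (cvg_cst 0) v0).
by apply: nearW => n; exact: uv.
Qed.

Lemma ip_limit g (f : nat -> R -> C) h :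
  sq D g -> (forall n, sq D (f n)) -> sq D h ->
  (fun n => N2 D (fun t => g t - f n t)) @ \oo --> (0 : R) ->
  (fun n => nc (ip D g h - ip D (f n) h)) @ \oo --> (0 : R).
Proof.
move=> hg hf hh cv.
apply: (@le_cvg0 _ (fun n => Num.sqrt (N2 D (fun t => g t - f n t) * N2 D h))).
  move=> n; apply/andP; split; first exact: nc_ge0.
  rewrite -ipBl// -(ger0_norm (nc_ge0 _)) -sqrtr_sqr.
  by apply: ler_wsqrtr; apply: cauchy_schwarz => //; exact: sqB.
rewrite -[X in _ --> X]sqrtr0 -(mul0r (N2 D h)).
apply: (@cvg_comp _ _ _ _ (@Num.sqrt R) _ (nbhs (0 * N2 D h))).
  by apply: cvgM => //; exact: cvg_cst.
exact: sqrt_continuous.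
Qed.

Lemma riesz_fischer_coef (a : nat -> C) : l2 a ->
  exists g : R -> C, [/\ sq D g,
    (fun N => N2 D (fun t => g t - osum e a 0 N t)) @ \oo --> (0 : R) &
    forall n, ip D g (e n) = k%:C * a n].
Proof.
move=> /l2_tail[eps [eps0 eps_ge0 heps]].
have ke0 : (fun n => k * eps n) @ \oo --> (0 : R).
  by rewrite -(mulr0 k); apply: cvgM => //; exact: cvg_cst.
have sqs N := sq_osum mD sqe a 0 N.
have [|g sg hg] := @riesz_fischer (osum e a 0) _ sqs ke0.
  move=> m n mn; rewrite (_ : (fun t => _) = osum e a m n).
    by rewrite (parseval mD sqe orth) ler_pM2l.
  apply/funext => t; rewrite /osum (big_cat_nat (leq0n _) mn)/=.
  by rewrite addrAC subrr add0r.
have cv : (fun N => N2 D (fun t => g t - osum e a 0 N t)) @ \oo --> (0 : R).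
  apply: le_cvg0; first by move=> n; rewrite N2_ge0; exact: hg.
  by rewrite -(mulr0 2); apply: cvgM => //; exact: cvg_cst.
exists g; split => // n; apply/eqP; rewrite -subr_eq0 -nc_eq0.
have cst0 : (fun N => nc (ip D g (e n) - ip D (osum e a 0 N) (e n))) @ \oo -->
    nc (ip D g (e n) - k%:C * a n).
  apply: cvg_near_cst; exists n.+1 => // N nN.
  by rewrite (ip_osum mD sqe orth) (nN : (n < N)%N).
have := ip_limit sg sqs (sqe n) cv.
by move=> /(cvg_unique _ cst0) ->.
Qed.

End Orthogonal.
End RieszFischerComplex.

(** * Power series in the unit disk *)

Section PowerSeries.
Variable R : realType.
Local Notation C := R[i].
Local Notation nc := (@Normc.normc R).
Local Notation Re := (@complex.Re R).
Local Notation Im := (@complex.Im R).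
Local Open Scope complex_scope.
Implicit Types (a b : nat -> C) (z w : C).

Definition psum a z N : C := \sum_(n < N) a n * z ^+ n.

Definition ps a z : C := limn (psum a z).

Definition bounded_by (K : R) a := forall n, nc (a n) <= K.

Lemma bounded_by_ge0 K a : bounded_by K a -> 0 <= K.
Proof. by move=> h; exact: le_trans (nc_ge0 (a 0%N)) (h 0%N). Qed.

Lemma chausdorff : hausdorff_space C.
Proof. exact: norm_hausdorff. Qed.

Lemma ccvg_unique (F : set_system nat) {FF : ProperFilter F} (u : nat -> C) (l l' : C) :
  u @ F --> l -> u @ F --> l' -> l = l'.
Proof. exact: (cvg_unique chausdorff). Qed.

Lemma psum_tail K a z N M : bounded_by K a -> nc z < 1 -> (N <= M)%N ->
  nc (psum a z M - psum a z N) <= K * nc z ^+ N / (1 - nc z).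
Proof.
move=> aK z1 NM; rewrite /psum -!(big_mkord xpredT (fun n => a n * z ^+ n)).
rewrite (big_cat_nat (leq0n _) NM)/= addrAC subrr add0r.
have K0 := bounded_by_ge0 aK.
have r0 := nc_ge0 z.
apply: le_trans (nc_sum _ _) _.
apply: (@le_trans _ _ (\sum_(N <= n < M) K * nc z ^+ n)).
  by apply: ler_sum => n _; rewrite ncM ncX ler_wpM2r// exprn_ge0.
rewrite -mulr_sumr -mulrA ler_wpM2l//.
rewrite -{1}(subnKC NM) geometric_partial_tail geometric_seriesE ?lt_eqF//=.
apply: ler_wpM2r; first by rewrite invr_ge0 subr_ge0 ltW.
by rewrite ler_piMr ?exprn_ge0// lerBlDr lerDl exprn_ge0.
Qed.

Lemma geometric_cvg0 K z : nc z < 1 ->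
  (fun N => K * nc z ^+ N / (1 - nc z)) @ \oo --> (0 : R).
Proof.
move=> z1; have := @cvg_geometric R (K / (1 - nc z)) (nc z).
rewrite ger0_norm ?nc_ge0// => /(_ z1); rewrite /geometric /=.
by under eq_fun do rewrite mulrAC.
Qed.

Lemma cvgC0 (u : nat -> C) (l : C) (v : nat -> R) :
  (forall n, nc (l - u n) <= v n) -> v @ \oo --> (0 : R) -> u @ \oo --> l.
Proof.
move=> uv /cvgrPdist_lt v0; apply/cvgC => e e0.
apply: filterS (v0 e e0) => n /=; rewrite sub0r normrN; apply: le_lt_trans.
exact: le_trans (uv n) (ler_norm _).
Qed.

Lemma cvgC_nc (u : nat -> C) (l : C) :
  u @ \oo --> l -> (fun n => nc (l - u n)) @ \oo --> (0 : R).
Proof.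
move=> /cvgC h; apply/cvgrPdist_lt => e e0; apply: filterS (h e e0) => n /=.
by rewrite sub0r normrN ger0_norm// nc_ge0.
Qed.

Lemma cvgC_ReIm T (F : set_system T) {FF : Filter F} (u : T -> C) x y :
  (fun n => Re (u n)) @ F --> (x : R) -> (fun n => Im (u n)) @ F --> (y : R) ->
  u @ F --> x +i* y.
Proof.
move=> /cvgrPdist_lt hx /cvgrPdist_lt hy; apply/cvgC => e e0.
have e2 : 0 < e / 2 by rewrite divr_gt0.
apply: filterS2 (hx _ e2) (hy _ e2) => n nx ny.
apply: le_lt_trans (nc_le_ReIm _) _; rewrite cReB cImB /= (splitr e).
exact: ltrD.
Qed.

Lemma cvgC_cauchy (u : nat -> C) (v : nat -> R) :
  (forall m n, (m <= n)%N -> nc (u n - u m) <= v m) ->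
  v @ \oo --> (0 : R) -> cvgn u.
Proof.
move=> uv /cvgrPdist_lt v0.
suff h (f : C -> R) : (forall z w, `|f z - f w| <= nc (z - w)) ->
    cvgn (fun n => f (u n)).
  have /cvg_ex[x hx] := h Re (fun z w => ltac:(rewrite -cReB; exact: Re_le_nc)).
  have /cvg_ex[y hy] := h Im (fun z w => ltac:(rewrite -cImB; exact: Im_le_nc)).
  by apply/cvg_ex; exists (x +i* y); exact: cvgC_ReIm.
move=> hf; apply/cauchy_cvgP/cauchy_ballP => e e0.
have e2 : 0 < e / 2 by rewrite divr_gt0.
have [N _ hN] := v0 _ e2.
have key n : (N <= n)%N -> `|f (u N) - f (u n)| < e / 2.
  move=> Nn; apply: le_lt_trans (hf _ _) _; rewrite nc_distC.
  apply: le_lt_trans (uv _ _ Nn) _; have := hN N (leqnn N).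
  by rewrite /= sub0r normrN; apply: le_lt_trans; exact: ler_norm.
exists ([set x | exists2 n, (N <= n)%N & x = f (u n)],
        [set x | exists2 n, (N <= n)%N & x = f (u n)]).
  by split; exists N => // n /= Nn; exists n.
move=> [_ _] /= [[n Nn ->] [m Nm ->]]; rewrite /ball/= (splitr e).
rewrite (_ : f (u n) - f (u m) =
    (f (u N) - f (u m)) - (f (u N) - f (u n))); last by ring.
by apply: le_lt_trans (ler_normB _ _) _; apply: ltrD; exact: key.
Qed.

Lemma ps_cvg K a z : bounded_by K a -> nc z < 1 -> psum a z @ \oo --> ps a z.
Proof.
move=> aK z1; apply: (cvgC_cauchy _ (geometric_cvg0 K z1)) => m n.
exact: psum_tail.
Qed.

Lemma ps_eq a z (l : C) : psum a z @ \oo --> l -> ps a z = l.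
Proof. exact: (cvg_lim chausdorff). Qed.

Lemma nc_lim_le (u : nat -> C) (l : C) c (N : nat) : u @ \oo --> l ->
  (forall n, (N <= n)%N -> nc (u n) <= c) -> nc l <= c.
Proof.
move=> /cvgC h uc; apply/ler_addgt0Pr => e e0.
have [M _ hM] := h _ e0.
have := hM (maxn N M) (leq_maxr _ _) => /= /ltW h1.
rewrite -(subrK (u (maxn N M)) l) addrC.
by apply: le_trans (ncD _ _) _; apply: lerD => //; apply: uc; exact: leq_maxl.
Qed.

Lemma ps_tail K a z N : bounded_by K a -> nc z < 1 ->
  nc (ps a z - psum a z N) <= K * nc z ^+ N / (1 - nc z).
Proof.
move=> aK z1.
apply: (@nc_lim_le (fun M => psum a z M - psum a z N) _ _ N).
  by apply: cvgB; [exact: ps_cvg aK z1|exact: cvg_cst].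
by move=> M; exact: psum_tail.
Qed.

Lemma nc_ps_le K a z : bounded_by K a -> nc z < 1 ->
  nc (ps a z) <= K / (1 - nc z).
Proof.
by move=> aK z1; have := ps_tail 0 aK z1; rewrite /psum big_ord0 subr0 expr0 mulr1.
Qed.

Lemma psD K L a b z : bounded_by K a -> bounded_by L b -> nc z < 1 ->
  ps (fun n => a n + b n) z = ps a z + ps b z.
Proof.
move=> aK bL z1; apply: ps_eq.
rewrite (_ : psum _ z = psum a z \+ psum b z).
  by apply: cvgD; [exact: ps_cvg aK z1|exact: ps_cvg bL z1].
apply/funext => N; rewrite /psum /= -big_split.
by apply: eq_bigr => i _; rewrite mulrDl.
Qed.

Lemma psZ K c a z : bounded_by K a -> nc z < 1 ->
  ps (fun n => c * a n) z = c * ps a z.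
Proof.
move=> aK z1; apply: ps_eq.
apply: (@cvgC0 _ _ (fun N => nc c * nc (ps a z - psum a z N))).
  move=> N; rewrite -ncM /psum mulrBr mulr_sumr.
  by under eq_bigr do rewrite -mulrA.
rewrite -(mulr0 (nc c)); apply: cvgM; first exact: cvg_cst.
exact/cvgC_nc/(ps_cvg aK z1).
Qed.

Lemma ps_finite N a z : (forall n, (N <= n)%N -> a n = 0) -> ps a z = psum a z N.
Proof.
move=> a0; apply: ps_eq; apply: cvg_near_cst; exists N => // M NM.
rewrite /psum -!(big_mkord xpredT (fun n => a n * z ^+ n)).
rewrite (big_cat_nat (leq0n _) NM)/=.
rewrite [X in _ + X](_ : _ = 0) ?addr0// big_nat_cond big1//.
by move=> i /andP[/andP[Ni _] _]; rewrite a0// mul0r.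
Qed.

Definition mulz a n : C := if n is m.+1 then a m else 0.

Lemma ps_shift K a z : bounded_by K a -> nc z < 1 ->
  ps a z = a 0%N + z * ps (fun n => a n.+1) z.
Proof.
move=> aK z1; have aK' : bounded_by K (fun n => a n.+1) by move=> n.
apply/esym/(@ccvg_unique \oo _ (fun N => psum a z N.+1)); last first.
  by have := ps_cvg aK z1; rewrite -cvg_shiftS.
apply: (@cvgC0 _ _ (fun N => nc z * nc (ps (fun n => a n.+1) z
    - psum (fun n => a n.+1) z N))).
  move=> N; rewrite -ncM (_ : psum a z N.+1 =
      a 0%N + z * psum (fun n => a n.+1) z N).
    by rewrite opprD addrACA subrr add0r mulrBr.
  rewrite /psum big_ord_recl expr0 mulr1 mulr_sumr; congr (_ + _).
  by apply: eq_bigr => i _; rewrite exprS mulrCA.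
rewrite -(mulr0 (nc z)); apply: cvgM; first exact: cvg_cst.
exact/cvgC_nc/(ps_cvg aK' z1).
Qed.

Lemma bounded_mulz K a : bounded_by K a -> bounded_by K (mulz a).
Proof. by move=> aK [|n]; [rewrite /mulz nc0 (bounded_by_ge0 aK)|exact: aK]. Qed.

Lemma ps_mulz K a z : bounded_by K a -> nc z < 1 -> ps (mulz a) z = z * ps a z.
Proof.
by move=> aK z1; rewrite (ps_shift (bounded_mulz aK) z1) add0r.
Qed.

(** The coefficients of the quotient of a power series minus its value at [w]
    by the linear factor vanishing at [w]. *)
Definition dquot a w n : C := ps (fun k => a (n.+1 + k)%N) w.

Lemma dquot_rec K a w n : bounded_by K a -> nc w < 1 ->
  dquot a w n = a n.+1 + w * dquot a w n.+1.
Proof.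
move=> aK w1; rewrite /dquot (@ps_shift K) ?addn0//.
by congr (_ + _ * ps _ _); apply/funext => k; rewrite addnS.
Qed.

Lemma dquot0 K a w : bounded_by K a -> nc w < 1 ->
  ps a w = a 0%N + w * dquot a w 0.
Proof. by move=> aK w1; rewrite (ps_shift aK w1). Qed.

Lemma bounded_dquot K a w : bounded_by K a -> nc w < 1 ->
  bounded_by (K / (1 - nc w)) (dquot a w).
Proof. by move=> aK w1 n; apply: nc_ps_le. Qed.

Lemma ps_dquot K a w z : bounded_by K a -> nc w < 1 -> nc z < 1 ->
  ps a z - ps a w = (z - w) * ps (dquot a w) z.
Proof.
move=> aK w1 z1; have gK := bounded_dquot aK w1.
have gS : bounded_by (K / (1 - nc w)) (fun n => dquot a w n.+1) by move=> n.
rewrite (ps_shift aK z1) (dquot0 aK w1) opprD addrACA subrr add0r.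
rewrite (_ : (fun n => a n.+1) =
    fun n => dquot a w n + (- w) * dquot a w n.+1); last first.
  by apply/funext => n; rewrite (dquot_rec n aK w1) mulNr addrK.
have wgS : bounded_by (nc w * (K / (1 - nc w))) (fun n => - w * dquot a w n.+1).
  by move=> n; rewrite ncM ncN ler_wpM2l ?nc_ge0.
rewrite (psD gK wgS z1) (psZ _ gS z1) mulrDr mulrBl.
rewrite -addrA; congr (_ + _).
rewrite [in RHS](ps_shift gK z1); ring.
Qed.

(** The coefficients satisfy g_n = a_{n+1} + w g_{n+1}; by convexity of the square
    |g_n|^2 <= |a_{n+1}|^2 / (1 - |w|) + |w| |g_{n+1}|^2, and summation over n
    absorbs the last term into the left-hand side. *)
Lemma l2_dquot a w : l2 a -> nc w < 1 -> l2 (dquot a w).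
Proof.
move=> al2 w1; have [K K0 aK] := l2_bnd al2; have [M aM] := al2.
have gL := bounded_dquot aK w1; set L := K / _ in gL.
set g := dquot a w in gL *; set r := nc w in w1 gL *.
have r0 : 0 <= r by exact: nc_ge0.
exists ((M / (1 - r) + r * L ^+ 2) / (1 - r)) => N.
rewrite ler_pdivlMr ?subr_gt0// mulrBr mulr1 lerBlDr.
have step n : nc (g n) ^+ 2 <= nc (a n.+1) ^+ 2 / (1 - r) + r * nc (g n.+1) ^+ 2.
  have h : nc (g n) <= nc (a n.+1) + r * nc (g n.+1).
    by rewrite /g (dquot_rec n aK w1) -ncM ncD.
  have h2 : nc (g n) ^+ 2 <= (nc (a n.+1) + r * nc (g n.+1)) ^+ 2.
    by rewrite ler_sqr ?nnegrE ?addr_ge0 ?mulr_ge0 ?nc_ge0.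
  apply: le_trans h2 _; rewrite -subr_ge0.
  have -> : nc (a n.+1) ^+ 2 / (1 - r) + r * nc (g n.+1) ^+ 2 -
     (nc (a n.+1) + r * nc (g n.+1)) ^+ 2 =
     r / (1 - r) * (nc (a n.+1) - (1 - r) * nc (g n.+1)) ^+ 2.
    by field; rewrite subr_eq0 eq_sym lt_eqF.
  by rewrite mulr_ge0 ?sqr_ge0// divr_ge0// subr_ge0 ltW.
apply: (@le_trans _ _ (\sum_(n < N)
    (nc (a n.+1) ^+ 2 / (1 - r) + r * nc (g n.+1) ^+ 2))).
  by apply: ler_sum => n _; exact: step.
rewrite big_split/= -mulr_suml -mulr_sumr -!addrA; apply: lerD.
  rewrite ler_pM2r ?invr_gt0 ?subr_gt0//; apply: le_trans (aM N.+1).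
  by rewrite big_ord_recl lerDr sqr_ge0.
rewrite [X in _ + X]mulrC -mulrDr ler_wpM2l// [leRHS]addrC.
apply: (@le_trans _ _ (\sum_(n < N.+1) nc (g n) ^+ 2)).
  by rewrite [leRHS]big_ord_recl lerDr sqr_ge0.
by rewrite big_ord_recr/= lerD2l ler_sqr ?nnegrE ?nc_ge0// (le_trans (nc_ge0 (g 0%N))).
Qed.

End PowerSeries.

(** * Zeros of Hardy functions *)

Section IdentityTheorem.
Variable R : realType.
Local Notation C := R[i].
Local Notation nc := (@Normc.normc R).
Local Notation cj := (@conjc R).
Local Notation Re := (@complex.Re R).
Local Notation Im := (@complex.Im R).
Local Open Scope complex_scope.
Implicit Types (a b : nat -> C) (z w : C).

Lemma le_of_cvg0 (x y : R) (eps : nat -> R) N : eps @ \oo --> (0 : R) ->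
  (forall n, (N <= n)%N -> x <= y + eps n) -> x <= y.
Proof.
move=> /cvgrPdist_lt e0 h; apply/ler_addgt0Pr => e he.
have [M _ hM] := e0 _ he.
have := hM (maxn N M) (leq_maxr _ _); rewrite /= sub0r normrN => h1.
apply: le_trans (h _ (leq_maxl N M)) _; rewrite lerD2l ltW//.
exact: le_lt_trans (ler_norm _) h1.
Qed.

(** Dividing out a zero by a Blaschke factor rather than by a linear factor
    does not increase the norm; this is what makes repeated division of use. *)
Lemma blaschke_division a w M : l2 a -> (forall N, \sum_(n < N) nc (a n) ^+ 2 <= M) ->
  nc w < 1 -> ps a w = 0 ->
  exists h : nat -> C, [/\ l2 h, forall N, \sum_(n < N) nc (h n) ^+ 2 <= M,
    a 0%N = - w * h 0%N &
    forall z, nc z < 1 -> z != w -> ps a z = 0 -> ps h z = 0].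
Proof.
move=> la aM w1 aw0; have [K K0 aK] := l2_bnd la.
have lg := l2_dquot la w1; have gL := bounded_dquot aK w1.
set L := K / _ in gL; set g := dquot a w in lg gL.
have a0 : a 0%N = - w * g 0%N.
  have := dquot0 aK w1; rewrite aw0 -/g => /eqP; rewrite eq_sym addr_eq0.
  by rewrite mulNr => /eqP.
have aS n : a n.+1 = g n - w * g n.+1 by rewrite /g (dquot_rec n aK w1) addrK.
(* Coefficients of (1 - conj w z) g, where a = (z - w) g. *)
pose h n := g n - cj w * mulz g n.
have h0 : h 0%N = g 0%N by rewrite /h mulr0 subr0.
have norm N : \sum_(n < N.+1) nc (h n) ^+ 2 =
    \sum_(n < N.+1) nc (a n) ^+ 2 + (1 - nc w ^+ 2) * nc (g N) ^+ 2.
  elim: N => [|N IH].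
    by rewrite !big_ord1 h0 a0 ncM ncN; ring.
  rewrite big_ord_recr/= IH [in RHS]big_ord_recr/= aS /h /mulz.
  rewrite !normc2E !cReB !cImB !cReM !cImM cReJ cImJ; ring.
have [eps [eps0 eps_ge0 heps]] := l2_tail lg.
have hM N : \sum_(n < N) nc (h n) ^+ 2 <= M.
  apply: (@le_of_cvg0 _ _ eps N eps0) => n Nn.
  apply: le_trans (l2_sumW h (leqW Nn)) _; rewrite norm; apply: lerD; first exact: aM.
  have := heps n n.+1; rewrite big_nat1; apply: le_trans.
  by rewrite ler_piMl ?sqr_ge0// lerBlDr lerDl sqr_ge0.
exists h; split; [by exists M|exact: hM|by rewrite h0|].
move=> z z1 zw az0.
have gz0 : ps g z = 0.
  have := ps_dquot aK w1 z1; rewrite az0 aw0 subr0 => /esym/eqP.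
  by rewrite mulf_eq0 subr_eq0 (negbTE zw) => /eqP.
have mL : bounded_by L (mulz g) by exact: bounded_mulz.
have mL' : bounded_by (nc (- cj w) * L) (fun n => - cj w * mulz g n).
  by move=> n; rewrite ncM ler_wpM2l ?nc_ge0.
have -> : h = fun n => g n + (- cj w) * mulz g n.
  by apply/funext => n; rewrite mulNr.
by rewrite (psD gL mL' z1) (psZ _ mL z1) (ps_mulz gL z1) gz0 !mulr0 addr0.
Qed.

(** Every zero of modulus at most [rho] that is divided out gains a factor [rho]
    at the origin and costs nothing in norm. *)
Lemma blaschke_bound (s : seq C) a M rho :
  l2 a -> (forall N, \sum_(n < N) nc (a n) ^+ 2 <= M) -> rho < 1 -> uniq s ->
  {in s, forall z, nc z <= rho /\ ps a z = 0} ->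
  nc (a 0%N) ^+ 2 <= (rho ^+ 2) ^+ size s * M.
Proof.
move=> la aM rho1; elim: s a la aM => [|w s IH] a la aM.
  by move=> _ _; rewrite mul1r; have := aM 1%N; rewrite big_ord1.
move=> /= /andP[ws us] hs; have [wrho aw] := hs w (mem_head _ _).
have [h [lh hM a0 hz]] := blaschke_division la aM (le_lt_trans wrho rho1) aw.
rewrite a0 ncM ncN exprMn [(_ ^+ 2) ^+ _]exprS -mulrA; apply: ler_pM; rewrite ?sqr_ge0//.
  by rewrite ler_sqr ?nnegrE ?nc_ge0// (le_trans (nc_ge0 w)).
apply: IH => // z zs; have [|zrho az] := hs z; first by rewrite inE zs orbT.
split=> //; apply: hz => //; first exact: le_lt_trans zrho rho1.
by apply: contraNneq ws => <-.
Qed.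

(** Infinitely many zeros in a compact part of the disk, expressed by finite
    duplicate-free lists. *)
Definition many_zeros rho a := forall N, exists s : seq C,
  [/\ uniq s, (N <= size s)%N & {in s, forall z, nc z <= rho /\ ps a z = 0}].

Lemma many_zeros_coef0 rho a : l2 a -> rho < 1 -> many_zeros rho a -> a 0%N = 0.
Proof.
move=> la rho1 hz.
have [M aM] := la.
have rho0 : 0 <= rho.
  have [[|z s] [_ // _ /(_ z)]] := hz 1%N; rewrite mem_head => /(_ isT)[h _].
  exact: le_trans (nc_ge0 z) h.
have M0 : 0 <= M by have := aM 0%N; rewrite big_ord0.
apply/eqP; rewrite -nc_eq0 -sqrf_eq0 eq_le sqr_ge0 andbT.
have r1 : rho ^+ 2 < 1 by rewrite expr_lt1.
apply: (@le_of_cvg0 _ _ (fun n => (rho ^+ 2) ^+ n * M) 0%N).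
  rewrite -[X in _ --> X](mul0r M); apply: cvgM; last exact: cvg_cst.
  have := @cvg_geometric R 1 (rho ^+ 2).
  rewrite ger0_norm ?sqr_ge0// => /(_ r1); rewrite /geometric /=.
  by under eq_fun do rewrite mul1r.
move=> m _; rewrite add0r; have [s [us ns hs]] := hz m.
apply: le_trans (blaschke_bound la aM rho1 us hs) _; rewrite ler_wpM2r//.
by rewrite ler_wiXn2l// ?sqr_ge0// ltW.
Qed.

(** When the value at 0 vanishes, division by z keeps all zeros but the one at 0,
    so the argument for the constant coefficient repeats. *)
Lemma ps_identity rho a : l2 a -> rho < 1 -> many_zeros rho a ->
  forall n, a n = 0.
Proof.
move=> + rho1 + n; elim: n a => [|n IH] a la hz.
  exact: many_zeros_coef0 hz.
have a0 := many_zeros_coef0 la rho1 hz.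
have [K K0 aK] := l2_bnd la.
apply: (IH (fun n => a n.+1)).
  have [M aM] := la; exists M => N; apply: le_trans (aM N.+1).
  by rewrite big_ord_recl lerDr sqr_ge0.
move=> N; have [s [us Ns hs]] := hz N.+1.
exists (rem 0 s); split; first exact: rem_uniq.
  have [s0|s0] := boolP (0 \in s); last by rewrite rem_id// ltnW.
  by rewrite size_rem// -ltnS prednK// (leq_ltn_trans _ Ns).
move=> z; rewrite mem_rem_uniq// inE => /andP[zn0 zs]; have [zr az] := hs z zs.
split=> //; have := ps_shift aK (le_lt_trans zr rho1).
rewrite az a0 add0r => /esym/eqP; rewrite mulf_eq0 (negbTE zn0) => /eqP.
exact.
Qed.

End IdentityTheorem.

(** * The complex exponential and the fundamental theorem of calculus *)

Section ComplexExponential.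
Variable R : realType.
Local Notation C := R[i].
Local Notation nc := (@Normc.normc R).
Local Notation cj := (@conjc R).
Local Notation Re := (@complex.Re R).
Local Notation Im := (@complex.Im R).
Local Notation leb := (@lebesgue_measure R).
Local Open Scope complex_scope.
Implicit Types (t x y : R) (z w s : C).

Lemma cis0 : cis 0 = 1 :> C.
Proof. by rewrite /cis cos0 sin0. Qed.

Lemma cisD x y : cis (x + y) = cis x * cis y.
Proof.
by apply: Ceq; rewrite ?cReM ?cImM /= ?cosD ?sinD//; ring.
Qed.

Lemma nc_cis x : nc (cis x) = 1.
Proof. by rewrite /= cos2Dsin2 sqrtr1. Qed.

Lemma cexpD z w : cexp (z + w) = cexp z * cexp w.
Proof.
by rewrite /cexp cReD cImD expRD cisD rmorphM/=; ring.
Qed.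

Lemma cexp0 : cexp 0 = 1 :> C.
Proof. by rewrite /cexp /= expR0 cis0 mulr1. Qed.

Lemma nc_cexp z : nc (cexp z) = expR (Re z).
Proof. by rewrite ncM ncR nc_cis mulr1 ger0_norm// expR_ge0. Qed.

Lemma cexp_neq0 z : cexp z != 0.
Proof. by rewrite -nc_eq0 nc_cexp gt_eqF// expR_gt0. Qed.

Lemma cexpN z : cexp (- z) = (cexp z)^-1.
Proof.
by apply: (mulfI (cexp_neq0 z)); rewrite -cexpD subrr cexp0 mulfV// cexp_neq0.
Qed.

Lemma cexp_i x : cexp ('i * x%:C) = cis x.
Proof.
rewrite (_ : 'i * x%:C = 0 +i* x); first by rewrite /cexp /= expR0 mul1r.
by apply: Ceq; rewrite ?cReM ?cImM /=; ring.
Qed.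

Lemma cexp_real x : cexp x%:C = (expR x)%:C.
Proof. by rewrite /cexp /= cis0 mulr1. Qed.

Definition cderiv (F : R -> C) (t : R) (d : C) :=
  is_derive t 1 (fun t => Re (F t)) (Re d) /\
  is_derive t 1 (fun t => Im (F t)) (Im d).

Lemma rderivM (u v : R -> R) t du dv :
  is_derive t (1 : R) u du -> is_derive t (1 : R) v dv ->
  is_derive t (1 : R) (fun t => u t * v t) (du * v t + u t * dv).
Proof.
move=> hu hv; have h := is_deriveM hu hv.
apply: (@is_derive_eq _ _ _ _ _ _ _ _ h).
by rewrite /GRing.scale/= mulrC [v t * _]mulrC addrC mulrC.
Qed.

Lemma cderivM (F G : R -> C) t dF dG :
  cderiv F t dF -> cderiv G t dG ->
  cderiv (fun t => F t * G t) t (dF * G t + F t * dG).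
Proof.
move=> [F1 F2] [G1 G2]; split.
  have -> : (fun t => Re (F t * G t)) =
      (fun t => Re (F t) * Re (G t)) - (fun t => Im (F t) * Im (G t)).
    by apply/funext => u; rewrite cReM.
  apply: is_derive_eq (is_deriveB (rderivM F1 G1) (rderivM F2 G2)) _.
  by rewrite cReD !cReM; ring.
have -> : (fun t => Im (F t * G t)) =
    (fun t => Re (F t) * Im (G t)) + (fun t => Im (F t) * Re (G t)).
  by apply/funext => u; rewrite cImM.
apply: is_derive_eq (is_deriveD (rderivM F1 G2) (rderivM F2 G1)) _.
by rewrite cImD !cImM; ring.
Qed.

Lemma cderiv_cst c t : cderiv (fun=> c) t 0.
Proof. by split; exact: is_derive_cst. Qed.

Lemma cderivD (F G : R -> C) t dF dG :
  cderiv F t dF -> cderiv G t dG -> cderiv (fun t => F t + G t) t (dF + dG).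
Proof.
move=> [F1 F2] [G1 G2]; split.
  have -> : (fun t => Re (F t + G t)) = (fun t => Re (F t)) + (fun t => Re (G t)).
    by apply/funext => u; rewrite cReD.
  by rewrite cReD; exact: is_deriveD.
have -> : (fun t => Im (F t + G t)) = (fun t => Im (F t)) + (fun t => Im (G t)).
  by apply/funext => u; rewrite cImD.
by rewrite cImD; exact: is_deriveD.
Qed.

Lemma cderiv_real (u : R -> R) t d : is_derive t (1 : R) u d ->
  cderiv (fun t => (u t)%:C) t d%:C.
Proof. by split => //=; exact: is_derive_cst. Qed.

Lemma rderiv_lin (k : R) (u : R -> R) t d :
  is_derive (k * t) (1 : R) u d -> is_derive t (1 : R) (fun t => u (k * t)) (d * k).
Proof.
move=> h; apply: (@is_derive1_comp R u (fun t => k * t)) => //.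
apply: is_derive_eq (rderivM (is_derive_cst k t 1) (is_derive_id t 1)) _.
by rewrite mul0r add0r mulr1.
Qed.

Lemma cderiv_cexp s t :
  cderiv (fun t => cexp (t%:C * s)) t (s * cexp (t%:C * s)).
Proof.
have e : is_derive t (1 : R) (fun t => expR (Re s * t)) (expR (Re s * t) * Re s).
  by apply: rderiv_lin; exact: is_derive_expR.
have c : is_derive t (1 : R) (fun t => cos (Im s * t)) (- sin (Im s * t) * Im s).
  by apply: rderiv_lin; exact: is_derive_cos.
have d : is_derive t (1 : R) (fun t => sin (Im s * t)) (cos (Im s * t) * Im s).
  by apply: rderiv_lin; exact: is_derive_sin.
have h : cderiv (fun t => cis (Im s * t)) t
    ((- sin (Im s * t) * Im s) +i* (cos (Im s * t) * Im s)) by [].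
have := cderivM (cderiv_real e) h.
have -> : (fun t => (expR (Re s * t))%:C * cis (Im s * t)) =
    (fun t => cexp (t%:C * s)).
  by apply/funext => u; rewrite /cexp cReZ cImZ ![u * _]mulrC.
congr cderiv; rewrite /cexp cReZ cImZ ![t * _]mulrC.
by apply: Ceq; rewrite ?cReD ?cImD !(cReM,cImM) /=; ring.
Qed.

(** Coordinatewise from the real fundamental theorem. *)
Lemma cftc (a b : R) (F f : R -> C) : a < b ->
  (forall t, cderiv F t (f t)) ->
  continuous (fun t => Re (f t)) -> continuous (fun t => Im (f t)) ->
  cintegral `[a, b] f = F b - F a.
Proof.
move=> ab dF cRe cIm.
have key (G g : R -> R) : (forall t, is_derive t (1 : R) G (g t)) -> continuous g ->
    \int[leb]_(t in `[a, b]) g t = G b - G a.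
  move=> dG cg; have cG t : {for t, continuous G}.
    by apply/differentiable_continuous/derivable1_diffP; exact: ex_derive.
  rewrite /Rintegral (@continuous_FTC2 _ g G)//.
  - exact: continuous_subspaceT.
  - split.
    + by move=> t _; exact: ex_derive.
    + by apply: cvg_at_right_filter; exact: cG.
    + by apply: cvg_at_left_filter; exact: cG.
  - by move=> t _; rewrite derive1E; exact: derive_val.
apply: Ceq; rewrite ?cReB ?cImB /=.
  exact: (key _ _ (fun t => (dF t).1) cRe).
exact: (key _ _ (fun t => (dF t).2) cIm).
Qed.

Definition ccont (f : R -> C) :=
  continuous (fun t => Re (f t)) /\ continuous (fun t => Im (f t)).

Lemma cderiv_cont (F f : R -> C) : (forall t, cderiv F t (f t)) -> ccont F.
Proof.
by move=> h; split => t; have [d1 d2] := h t;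
  apply/differentiable_continuous/derivable1_diffP; exact: ex_derive.
Qed.

Lemma ccontM (f g : R -> C) : ccont f -> ccont g -> ccont (fun t => f t * g t).
Proof.
move=> [f1 f2] [g1 g2]; split => t.
  under eq_fun do rewrite cReM.
  exact: (cvgB (cvgM (f1 t) (g1 t)) (cvgM (f2 t) (g2 t))).
under eq_fun do rewrite cImM.
exact: (cvgD (cvgM (f1 t) (g2 t)) (cvgM (f2 t) (g1 t))).
Qed.

Lemma ccont_cst c : ccont (fun=> c).
Proof. by split => t; exact: cvg_cst. Qed.

Lemma ccontD (f g : R -> C) : ccont f -> ccont g -> ccont (fun t => f t + g t).
Proof.
move=> [f1 f2] [g1 g2]; split => t.
  by under eq_fun do rewrite cReD; exact: (cvgD (f1 t) (g1 t)).
by under eq_fun do rewrite cImD; exact: (cvgD (f2 t) (g2 t)).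
Qed.

Lemma ccont_cexp s : ccont (fun t => cexp (t%:C * s)).
Proof. exact: cderiv_cont (cderiv_cexp s). Qed.

Lemma ccont_real (u : R -> R) : continuous u -> ccont (fun t => (u t)%:C).
Proof. by split => // t; exact: cvg_cst. Qed.

Lemma ccont_meas (D : set R) f : ccont f -> cmeas D f.
Proof.
by move=> [h1 h2]; split; apply: measurable_funTS; exact: continuous_measurable_fun.
Qed.

End ComplexExponential.

(** * Fourier monomials and the Herglotz kernel *)

Section Circle.
Variable R : realType.
Local Notation C := R[i].
Local Notation nc := (@Normc.normc R).
Local Notation cj := (@conjc R).
Local Notation Re := (@complex.Re R).
Local Notation Im := (@complex.Im R).
Local Notation leb := (@lebesgue_measure R).
Local Open Scope complex_scope.
Implicit Types (t x y : R) (z w : C) (u v : R -> R).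

Lemma cisX x n : cis x ^+ n = cis (n%:R * x).
Proof.
elim: n => [|n IH]; first by rewrite mul0r cis0.
by rewrite exprS IH -cisD -natr1 mulrDl mul1r addrC.
Qed.

Lemma cis2pi : cis (2 * pi) = 1 :> C.
Proof. by rewrite mulr_natl /cis cos2pi sin2pi. Qed.

Lemma cmeasX (D : set R) (f : R -> C) n : cmeas D f -> cmeas D (fun t => f t ^+ n).
Proof.
move=> mf; elim: n => [|n IH]; first exact: cmeas_cst.
by under eq_fun do rewrite exprS; exact: cmeasM.
Qed.

Definition circ : set R := `[0, 2 * pi].

Lemma twopi_gt0 : 0 < 2 * pi :> R. Proof. by rewrite mulr_gt0// pi_gt0. Qed.

Lemma mcirc : measurable (circ : set (measurableTypeR R)).
Proof. exact: measurable_itv. Qed.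

Lemma rintble_cst (c : R) : rintble circ (fun=> c).
Proof.
have fin : (leb circ < +oo)%E.
  by rewrite /circ lebesgue_measure_itv/= lte_fin twopi_gt0 -EFinB ltry.
apply: measurable_bounded_integrable; first exact: mcirc.
- exact: fin.
- exact: measurable_cst.
- by exists `|c|; split; [rewrite num_real|move=> y cy t _ /=; exact: ltW].
Qed.

Lemma rintble_bounded (u : R -> R) K : measurable_fun circ u ->
  (forall t, circ t -> `|u t| <= K) -> rintble circ u.
Proof. by move=> mu h; apply: (rintble_le mcirc mu h); exact: rintble_cst. Qed.

Lemma cintble_bounded (f : R -> C) K : cmeas circ f ->
  (forall t, circ t -> nc (f t) <= K) -> cintble circ f.
Proof. by move=> mf h; apply: (cintble_le mcirc mf _ h); exact: rintble_cst. Qed.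

Lemma Rint_circ_cst (c : R) : \int[leb]_(t in circ) c = 2 * pi * c.
Proof.
have h : leb circ = (2 * pi)%:E.
  by rewrite /circ lebesgue_measure_itv/= lte_fin twopi_gt0 -EFinB subr0.
transitivity (c * fine (leb circ)); first exact: (Rintegral_cst _ mcirc).
by rewrite h mulrC.
Qed.

Lemma cint_circ_cst (c : C) : cintegral circ (fun=> c) = (2 * pi)%:C * c.
Proof. by apply: Ceq; rewrite ?cReZ ?cImZ /= Rint_circ_cst. Qed.

Definition expo n t : C := cis t ^+ n.

Lemma nc_expo n t : nc (expo n t) = 1.
Proof. by rewrite ncX nc_cis expr1n. Qed.

Lemma expoE n t : expo n t = cexp (t%:C * ('i * n%:R%:C)).
Proof. by rewrite /expo cisX -cexp_i; congr cexp; rewrite rmorphM/=; ring. Qed.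

Lemma cmeas_expo D n : cmeas D (expo n).
Proof.
rewrite (_ : expo n = fun t => cexp (t%:C * ('i * n%:R%:C))).
  by apply: ccont_meas; exact: ccont_cexp.
by apply/funext => t; exact: expoE.
Qed.

Lemma cmeas_cis D : cmeas D (@cis R).
Proof. by have := cmeas_expo D 1; rewrite /expo; under eq_fun do rewrite expr1. Qed.

Lemma sq_expo n : sq circ (expo n).
Proof.
split; first exact: cmeas_expo.
apply: (@rintble_bounded _ 1); first exact: cmeas_nc2 (cmeas_expo _ n).
by move=> t _; rewrite nc_expo expr1n normr1.
Qed.

Lemma cintble_expo n : cintble circ (expo n).
Proof.
by apply: (@cintble_bounded _ 1); [exact: cmeas_expo|move=> t _; rewrite nc_expo].
Qed.

Lemma cint_expo n : cintegral circ (expo n) = if n == 0%N then (2 * pi)%:C else 0.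
Proof.
case: eqVneq => [->|n0].
  by rewrite -[RHS]mulr1 -cint_circ_cst; apply: eq_cint.
pose s : C := 'i * n%:R%:C; have s0 : s != 0.
  rewrite -nc_eq0 ncM ncR normr_nat mulf_neq0 ?pnatr_eq0//.
  by rewrite /= expr0n expr1n add0r sqrtr1 oner_eq0.
have dF t : cderiv (fun t => s^-1 * cexp (t%:C * s)) t (expo n t).
  have := cderivM (cderiv_cst s^-1 t) (cderiv_cexp s t).
  by rewrite mul0r add0r mulKf// -expoE.
have [c1 c2] : ccont (expo n).
  rewrite (_ : expo n = fun t => cexp (t%:C * s)); first exact: ccont_cexp.
  by apply/funext => t; exact: expoE.
rewrite /circ (cftc twopi_gt0 dF)// -!expoE /expo cis2pi expr1n.
by rewrite cis0 expr1n subrr.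
Qed.

Lemma expo_mulV m n t : expo n t * cj (expo (n + m) t) = cj (expo m t).
Proof.
have h : cj (expo (n + m) t) = cj (expo n t) * cj (expo m t).
  by rewrite -cJM -exprD.
by rewrite h mulrA mulCJ nc_expo expr1n mul1r.
Qed.

Lemma cint_cj_expo n :
  cintegral circ (fun t => cj (expo n t)) = if n == 0%N then (2 * pi)%:C else 0.
Proof.
rewrite (cintJ mcirc (cintble_expo n)) cint_expo.
by case: ifP => _; rewrite ?cJR// rmorph0.
Qed.

Lemma orth_expo m n :
  ip circ (expo m) (expo n) = if m == n then (2 * pi)%:C else 0.
Proof.
wlog mn : m n / (m <= n)%N.
  move=> h; have [/h//|/ltnW/h e] := leqP m n.
  rewrite (ipC mcirc (sq_expo n) (sq_expo m)) e eq_sym.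
  by case: ifP => _; rewrite ?cJR// rmorph0.
rewrite /ip -(subnKC mn); under eq_cint do rewrite expo_mulV.
rewrite cint_cj_expo; congr (if _ then _ else _).
by rewrite subnKC// subn_eq0 eqn_leq mn.
Qed.

Definition hk z t : C := (cis t + z) / (cis t - z).

Lemma nc_cis_sub z t : 1 - nc z <= nc (cis t - z).
Proof. by rewrite -{1}(nc_cis t) ler_nc_dist. Qed.

Lemma cis_sub_neq0 z t : nc z < 1 -> cis t - z != 0.
Proof.
by move=> z1; rewrite -nc_gt0 (lt_le_trans _ (nc_cis_sub z t))// subr_gt0.
Qed.

Lemma cmeas_hk z D : nc z < 1 -> cmeas D (hk z).
Proof.
move=> z1; apply: cmeasM; first by apply: cmeasD; [exact: cmeas_cis|exact: cmeas_cst].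
apply: cmeas_inv; first by move=> t _; exact: cis_sub_neq0.
by apply: cmeasB; [exact: cmeas_cis|exact: cmeas_cst].
Qed.

Lemma nc_hk z t : nc z < 1 -> nc (hk z t) <= 2 / (1 - nc z).
Proof.
move=> z1; have z0 : 0 < 1 - nc z by rewrite subr_gt0.
rewrite ncM ncV; apply: ler_pM; rewrite ?nc_ge0 ?invr_ge0 ?nc_ge0//.
  by rewrite (le_trans (ncD _ _))// nc_cis (_ : 2 = 1 + 1)// lerD2l ltW.
by rewrite lef_pV2 ?posrE ?nc_cis_sub// (lt_le_trans z0)// nc_cis_sub.
Qed.

Lemma cintble_hkM z (f : R -> C) K : nc z < 1 -> cmeas circ f ->
  (forall t, nc (f t) <= K) -> cintble circ (fun t => hk z t * f t).
Proof.
move=> z1 mf fK; apply: (@cintble_bounded _ (2 / (1 - nc z) * K)).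
  by apply: cmeasM => //; exact: cmeas_hk.
by move=> t _; rewrite ncM; apply: ler_pM; rewrite ?nc_ge0// nc_hk.
Qed.

Lemma hk_mul z t : nc z < 1 -> hk z t * cis t = z * hk z t + (cis t + z).
Proof.
move=> z1; rewrite /hk; field; exact: cis_sub_neq0.
Qed.

Lemma cintble_hk_expo z n : nc z < 1 -> cintble circ (fun t => hk z t * expo n t).
Proof.
move=> z1; apply: (@cintble_hkM _ _ 1) => //; first exact: cmeas_expo.
by move=> t; rewrite nc_expo.
Qed.

Lemma cintble_hk_cj z n : nc z < 1 -> cintble circ (fun t => hk z t * cj (expo n t)).
Proof.
move=> z1; apply: (@cintble_hkM _ _ 1) => //; first exact/cmeasJ/cmeas_expo.
by move=> t; rewrite nc_conj nc_expo.
Qed.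

(** Obtained from the identity (cis t) hk = z hk + (cis t + z). *)
Lemma hk_cj_rec z n : nc z < 1 ->
  cintegral circ (fun t => hk z t * cj (expo n t)) =
  z * cintegral circ (fun t => hk z t * cj (expo n.+1 t)) +
  (if n == 0%N then (2 * pi)%:C else 0).
Proof.
move=> z1; have bc m : cintble circ (fun t => cj (expo m t)).
  by apply: cintbleJ; [exact: mcirc|exact: cintble_expo].
rewrite -cint_cj_expo -cintZ; [|exact: mcirc|exact: cintble_hk_cj].
rewrite -[RHS]addr0 -[X in _ = _ + X](mulr0 z).
have <- : cintegral circ (fun t => cj (expo n.+1 t)) = 0 by rewrite cint_cj_expo.
rewrite -cintZ//; last exact: mcirc.
have h1 : cintble circ (fun t => z * (hk z t * cj (expo n.+1 t))).
  by apply: cintbleZ; [exact: mcirc|exact: cintble_hk_cj].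
have h2 : cintble circ (fun t => z * cj (expo n.+1 t)).
  by apply: cintbleZ; [exact: mcirc|exact: bc].
rewrite -cintD//; last exact: mcirc.
have h3 : cintble circ (fun t => z * (hk z t * cj (expo n.+1 t)) + cj (expo n t)).
  by apply: cintbleD; [exact: mcirc|exact: h1|exact: bc].
rewrite -cintD//; last exact: mcirc.
apply: eq_cint => t _; have := expo_mulV n 1 t; rewrite add1n /expo expr1 -/(expo _ _) => <-.
by rewrite mulrA hk_mul// -/(expo n.+1 t); ring.
Qed.

(** The recursion multiplies a bounded sequence of integrals by arbitrarily high
    powers of z. *)
Lemma hk_cj z n : nc z < 1 -> (0 < n)%N ->
  cintegral circ (fun t => hk z t * cj (expo n t)) = 0.
Proof.
move=> z1 n0; set K := fun n => cintegral circ (fun t => hk z t * cj (expo n t)).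
pose B := 2 * (2 * pi * (2 / (1 - nc z))).
have KB m : nc (K m) <= B.
  rewrite /B -Rint_circ_cst; apply: nc_cint_le; first exact: mcirc.
  - by have /cintble_meas := cintble_hk_cj m z1; apply.
  - exact: rintble_cst.
  - by move=> t _; rewrite ncM nc_conj nc_expo mulr1 nc_hk.
have iter m : K n = z ^+ m * K (n + m)%N.
  elim: m => [|m IH]; first by rewrite mul1r addn0.
  rewrite IH {1}/K hk_cj_rec// addnS exprSr -mulrA.
  by rewrite addn_eq0 gtn_eqF//= addr0.
apply/eqP; rewrite -nc_eq0 eq_le nc_ge0 andbT -/(K n).
have cv : (fun m => nc z ^+ m * B) @ \oo --> (0 : R).
  rewrite -(mul0r B); apply: cvgM; last exact: cvg_cst.
  by apply: cvg_expr; rewrite ger0_norm ?nc_ge0.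
apply: (ler_cvg_to (cvg_cst (nc (K n))) cv); apply: nearW => m.
by rewrite {1}(iter m) ncM ncX ler_wpM2l// exprn_ge0// nc_ge0.
Qed.

Lemma hk_expo0 z : nc z < 1 -> cintegral circ (hk z) = (2 * pi)%:C.
Proof.
move=> z1; have := @hk_cj_rec z 0%N z1; rewrite (@hk_cj z 1%N)// mulr0 add0r => <-.
by apply: eq_cint => t _; rewrite /expo expr0 rmorph1 mulr1.
Qed.

Lemma hk_expo z n : nc z < 1 -> (0 < n)%N ->
  cintegral circ (fun t => hk z t * expo n t) = 2 * (2 * pi)%:C * z ^+ n.
Proof.
move=> z1; case: n => // n _.
have rec m : cintegral circ (fun t => hk z t * expo m.+1 t) =
    z * cintegral circ (fun t => hk z t * expo m t) +
    z * (if m == 0%N then (2 * pi)%:C else 0).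
  rewrite -cint_expo -[RHS]addr0.
  have <- : cintegral circ (expo m.+1) = 0 by rewrite cint_expo.
  rewrite -cintZ; [|exact: mcirc|exact: cintble_hk_expo].
  rewrite -cintZ; [|exact: mcirc|exact: cintble_expo].
  have h1 : cintble circ (fun t => z * (hk z t * expo m t)).
    by apply: cintbleZ; [exact: mcirc|exact: cintble_hk_expo].
  have h2 : cintble circ (fun t => z * expo m t).
    by apply: cintbleZ; [exact: mcirc|exact: cintble_expo].
  rewrite -cintD//; last exact: mcirc.
  have h3 : cintble circ (fun t => z * (hk z t * expo m t) + z * expo m t).
    by apply: cintbleD; [exact: mcirc|exact: h1|exact: h2].
  rewrite -cintD; [|exact: mcirc|exact: h3|exact: cintble_expo].
  apply: eq_cint => t _; rewrite /expo exprS mulrA hk_mul//; ring.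
elim: n => [|n IH].
  rewrite rec/= (_ : cintegral _ _ = (2 * pi)%:C); last first.
    by rewrite -(hk_expo0 z1); apply: eq_cint => t _; rewrite /expo mulr1.
  by rewrite expr1; ring.
by rewrite rec IH/= mulr0 addr0 [in RHS]exprS; ring.
Qed.

(** The Herglotz integral of a real function on the circle, not divided by 2 pi. *)
Definition herg z u : C := cintegral circ (fun t => hk z t * (u t)%:C).

Lemma cintble_herg z u : nc z < 1 -> rintble circ u ->
  cintble circ (fun t => hk z t * (u t)%:C).
Proof.
move=> z1 hu; apply: (@cintble_le _ _ mcirc _ (fun t => 2 / (1 - nc z) * `|u t|)).
- apply: cmeasM; first exact: cmeas_hk.
  exact: cmeas_real (rintble_meas hu).
- by apply: rintbleZ; [exact: mcirc|exact: rintble_norm].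
- move=> t _; rewrite ncM ncR ler_wpM2r// nc_hk//.
Qed.

Lemma hergD z u v : nc z < 1 -> rintble circ u -> rintble circ v ->
  herg z (fun t => u t + v t) = herg z u + herg z v.
Proof.
move=> z1 hu hv; rewrite /herg -cintD;
  [|exact: mcirc|exact: cintble_herg|exact: cintble_herg].
by apply: eq_cint => t _; rewrite rmorphD/= mulrDr.
Qed.

Lemma herg_dist z u v : nc z < 1 -> rintble circ u -> rintble circ v ->
  nc (herg z u - herg z v) <=
  4 / (1 - nc z) * \int[leb]_(t in circ) `|u t - v t|.
Proof.
move=> z1 hu hv; have huv := rintbleB mcirc hu hv.
have hn := rintble_norm huv.
rewrite /herg -cintB; [|exact: mcirc|exact: cintble_herg|exact: cintble_herg].
rewrite (_ : 4 / (1 - nc z) = 2 * (2 / (1 - nc z))); last by ring.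
rewrite -mulrA -(RintZ mcirc)//; apply: nc_cint_le; first exact: mcirc.
- apply: cintble_meas; apply: cintbleB; [exact: mcirc|exact: cintble_herg|].
  exact: cintble_herg.
- by apply: rintbleZ; [exact: mcirc|].
- move=> t _; rewrite -mulrBr -rmorphB ncM ncR ler_wpM2r// nc_hk//.
Qed.

(** The Schwarz formula, for polynomials. *)
Lemma herg_psum (a : nat -> C) N z : nc z < 1 ->
  herg z (fun t => Re (psum a (cis t) N.+1)) =
  (2 * pi)%:C * (psum a z N.+1 - 'i * (Im (a 0%N))%:C).
Proof.
move=> z1; have half : 2^-1 = (2^-1)%:C :> C by rewrite fmorphV rmorph_nat.
pose f n t := 2^-1 * a n * (hk z t * expo n t)
  + 2^-1 * cj (a n) * (hk z t * cj (expo n t)).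
have h1 n : cintble circ (fun t => 2^-1 * a n * (hk z t * expo n t)).
  by apply: cintbleZ; [exact: mcirc|exact: cintble_hk_expo].
have h2 n : cintble circ (fun t => 2^-1 * cj (a n) * (hk z t * cj (expo n t))).
  by apply: cintbleZ; [exact: mcirc|exact: cintble_hk_cj].
have hf n : cintble circ (f n) by apply: cintbleD => //; exact: mcirc.
transitivity (cintegral circ (fun t => \sum_(n < N.+1) f n t)).
  apply: eq_cint => t _; rewrite Re_sum RtoC_sum mulr_sumr.
  apply: eq_bigr => n _; rewrite /f.
  have -> : (Re (a n * cis t ^+ n))%:C =
      2^-1 * (a n * expo n t) + 2^-1 * (cj (a n) * cj (expo n t)).
    rewrite -cJM -mulrDr half /expo.
    apply: Ceq; rewrite ?cReZ ?cImZ ?cReD ?cImD ?cReJ ?cImJ; last first.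
      by rewrite subrr mulr0.
    by rewrite [LHS]/=; field.
  by ring.
transitivity (\sum_(n < N.+1) cintegral circ (f n)).
  by rewrite -(cint_sum mcirc)// => i; exact: hf.
have e0 : cintegral circ (f 0%N) = (2 * pi)%:C * (Re (a 0%N))%:C.
  rewrite cintD//; last exact: mcirc.
  rewrite !cintZ; [|exact: mcirc|exact: cintble_hk_cj|exact: mcirc|exact: cintble_hk_expo].
  have -> : cintegral circ (fun t => hk z t * expo 0%N t) = (2 * pi)%:C.
    by rewrite -(hk_expo0 z1); apply: eq_cint => t _; rewrite /expo mulr1.
  have -> : cintegral circ (fun t => hk z t * cj (expo 0%N t)) = (2 * pi)%:C.
    rewrite -(hk_expo0 z1); apply: eq_cint => t _.
    by rewrite /expo expr0 rmorph1 mulr1.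
  rewrite -mulrDl -mulrDr mulrC; congr (_ * _).
  rewrite half.
  by apply: Ceq; rewrite ?cReZ ?cImZ ?cReD ?cImD ?cReJ ?cImJ /=; field.
have eS n : cintegral circ (f n.+1) = (2 * pi)%:C * (a n.+1 * z ^+ n.+1).
  rewrite cintD//; last exact: mcirc.
  rewrite !cintZ; [|exact: mcirc|exact: cintble_hk_cj|exact: mcirc|exact: cintble_hk_expo].
  by rewrite hk_expo// hk_cj// mulr0 addr0; field.
have -> : psum a z N.+1 = a 0%N + \sum_(n < N) a n.+1 * z ^+ n.+1.
  by rewrite /psum big_ord_recl expr0 mulr1.
rewrite big_ord_recl e0; under eq_bigr => i _ do rewrite eS.
rewrite -mulr_sumr -mulrDr; congr (_ * _).
by rewrite addrAC {2}(complexE (a 0%N)) addrK.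
Qed.

End Circle.

(** * Functions given by the Schwarz formula *)

Section Schwarz.
Variable R : realType.
Local Notation C := R[i].
Local Notation nc := (@Normc.normc R).
Local Notation cj := (@conjc R).
Local Notation Re := (@complex.Re R).
Local Notation Im := (@complex.Im R).
Local Notation leb := (@lebesgue_measure R).
Local Notation circ := (@circ R).
Local Open Scope complex_scope.
Implicit Types (t x y : R) (z w : C) (u v : R -> R) (G H : C -> C).

Lemma cvgC_Re T (F : set_system T) {FF : Filter F} (f : T -> C) w :
  f @ F --> w -> (fun n => Re (f n)) @ F --> (Re w : R).
Proof.
move=> /cvgC h; apply/cvgrPdist_lt => e e0; apply: filterS (h e e0) => n.
by rewrite -cReB; apply: le_lt_trans; exact: Re_le_nc.
Qed.

Lemma cvgC_Im T (F : set_system T) {FF : Filter F} (f : T -> C) w :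
  f @ F --> w -> (fun n => Im (f n)) @ F --> (Im w : R).
Proof.
move=> /cvgC h; apply/cvgrPdist_lt => e e0; apply: filterS (h e e0) => n.
by rewrite -cImB; apply: le_lt_trans; exact: Im_le_nc.
Qed.

Lemma cvgCM T (F : set_system T) {FF : Filter F} (f g : T -> C) (w z : C) :
  f @ F --> w -> g @ F --> z -> (fun n => f n * g n) @ F --> w * z.
Proof.
move=> hf hg; have [f1 f2 g1 g2] := And4 (cvgC_Re hf) (cvgC_Im hf) (cvgC_Re hg) (cvgC_Im hg).
have -> : w * z = (Re w * Re z - Im w * Im z) +i* (Re w * Im z + Im w * Re z).
  by apply: Ceq; rewrite ?cReM ?cImM.
apply: cvgC_ReIm.
  under eq_fun do rewrite cReM; exact: (cvgB (cvgM f1 g1) (cvgM f2 g2)).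
under eq_fun do rewrite cImM; exact: (cvgD (cvgM f1 g2) (cvgM f2 g1)).
Qed.

Lemma cvgC_cexp (f : nat -> C) (w : C) :
  f @ \oo --> w -> (fun n => cexp (f n)) @ \oo --> cexp w.
Proof.
move=> hf; have [f1 f2] := conj (cvgC_Re hf) (cvgC_Im hf).
have E z : cexp z =
    (expR (Re z) * cos (Im z)) +i* (expR (Re z) * sin (Im z)).
  by rewrite /cexp; apply: Ceq; rewrite ?cReZ ?cImZ.
have e1 : (fun n => expR (Re (f n))) @ \oo --> (expR (Re w) : R).
  by apply: (@cvg_comp _ _ _ _ (@expR R) _ _ _ f1); exact: continuous_expR.
have c1 : (fun n => cos (Im (f n))) @ \oo --> (cos (Im w) : R).
  by apply: (@cvg_comp _ _ _ _ (@cos R) _ _ _ f2); exact: continuous_cos.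
have s1 : (fun n => sin (Im (f n))) @ \oo --> (sin (Im w) : R).
  by apply: (@cvg_comp _ _ _ _ (@sin R) _ _ _ f2); exact: continuous_sin.
rewrite E; apply: cvgC_ReIm.
  under eq_fun do rewrite E; exact: cvgM.
under eq_fun do rewrite E; exact: cvgM.
Qed.

Lemma cvgC_lim_nc (f : nat -> C) (w : C) : f @ \oo --> w ->
  (fun n => nc (f n)) @ \oo --> (nc w : R).
Proof.
move=> /cvgC h; apply/cvgrPdist_lt => e e0; apply: filterS (h e e0) => n.
by apply: le_lt_trans; exact: ler_dist_nc.
Qed.

(** [G] is determined, up to a unimodular constant, by [u] as an outer function
    is by the logarithm of its boundary modulus. *)
Definition schwarz G u := rintble circ u /\ exists2 lambda : C, nc lambda = 1 &
  forall z, nc z < 1 -> G z = lambda * cexp (((2 * pi)^-1)%:C * herg z u).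

Lemma schwarz_neq0 G u z : schwarz G u -> nc z < 1 -> G z != 0.
Proof.
move=> [_ [l l1 h]] z1; rewrite h// mulf_neq0 ?cexp_neq0//.
by rewrite -nc_eq0 l1 oner_eq0.
Qed.

Lemma schwarz_mul G H u v : schwarz G u -> schwarz H v ->
  schwarz (fun z => G z * H z) (fun t => u t + v t).
Proof.
move=> [hu [l l1 hG]] [hv [m m1 hH]]; split; first exact: (rintbleD (@mcirc R)).
exists (l * m); first by rewrite ncM l1 m1 mulr1.
move=> z z1; rewrite hG// hH// hergD//.
rewrite (mulrDr _ (herg z u)) cexpD; ring.
Qed.

Lemma schwarz_unimodular G u (c : C) : nc c = 1 -> schwarz G u ->
  schwarz (fun z => c * G z) u.
Proof.
move=> c1 [hu [l l1 h]]; split=> //; exists (c * l); first by rewrite ncM c1 l1 mulr1.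
by move=> z z1; rewrite h// mulrA.
Qed.

Lemma schwarz_ext G H u v : (forall z, nc z < 1 -> G z = H z) ->
  u = v -> schwarz G u -> schwarz H v.
Proof.
move=> GH <- [hu [l l1 h]]; split=> //; exists l => // z z1.
by rewrite -GH// h.
Qed.

(** The Herglotz integral at a fixed point depends continuously on its density in
    mean; the unimodular constants converge because they are determined by the values at 0. *)
Lemma schwarz_lim (Gn : nat -> C -> C) (un : nat -> R -> R) G u :
  (forall n, schwarz (Gn n) (un n)) -> rintble circ u ->
  (forall z, nc z < 1 -> (fun n => Gn n z) @ \oo --> G z) ->
  (fun n => \int[leb]_(t in circ) `|u t - un n t|) @ \oo --> (0 : R) ->
  schwarz G u.
Proof.
move=> hn hu cvG cvu; split=> //.
have /choice[l hl] n : exists l : C, nc l = 1 /\ forall z, nc z < 1 ->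
    Gn n z = l * cexp (((2 * pi)^-1)%:C * herg z (un n)).
  by have [_ [l l1 hl]] := hn n; exists l.
pose E v z := cexp (((2 * pi)^-1)%:C * herg z v).
have cvE z : nc z < 1 -> (fun n => E (un n) z) @ \oo --> E u z.
  move=> z1; apply: cvgC_cexp; apply: cvgCM; first exact: cvg_cst.
  apply: (cvgC0 (v := fun n =>
      4 / (1 - nc z) * \int[leb]_(t in circ) `|u t - un n t|)).
    by move=> n; apply: herg_dist => //; have [] := hn n.
  by rewrite -(mulr0 (4 / (1 - nc z))); apply: cvgM; [exact: cvg_cst|].
have z0 : nc 0 < 1 by rewrite nc0.
pose lam : C := G 0 * (E u 0)^-1.
have cvl : l @ \oo --> lam.
  rewrite (_ : l = fun n => Gn n 0 * cexp (- (((2 * pi)^-1)%:C * herg 0 (un n)))).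
    apply: cvgCM; first exact: cvG.
    rewrite /E -cexpN; apply: cvgC_cexp.
    have -> : - (((2 * pi)^-1)%:C * herg 0 u) = (-1) * (((2 * pi)^-1)%:C * herg 0 u).
      by rewrite mulN1r.
    under eq_fun do rewrite -mulN1r.
    apply: cvgCM; first exact: cvg_cst.
    apply: cvgCM; first exact: cvg_cst.
    apply: (cvgC0 (v := fun n =>
        4 / (1 - nc 0) * \int[leb]_(t in circ) `|u t - un n t|)).
      by move=> n; apply: herg_dist => //; have [] := hn n.
    by rewrite -(mulr0 (4 / (1 - nc 0))); apply: cvgM; [exact: cvg_cst|].
  apply/funext => n; have [_ ->//] := hl n.
  by rewrite -mulrA -cexpD subrr cexp0 mulr1.
exists lam.
  have cv1 : (fun n => nc (l n)) @ \oo --> (1 : R).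
    by apply: cvg_near_cst; apply: nearW => n; have [] := hl n.
  by have := cvgC_lim_nc cvl => /(cvg_unique _)/(_ cv1); exact.
move=> z z1; apply: (@ccvg_unique R \oo _ (fun n => Gn n z)); first exact: cvG.
rewrite (_ : (fun n => Gn n z) = fun n => l n * E (un n) z).
  by apply: cvgCM; [exact: cvl|exact: cvE].
by apply/funext => n; have [_ ->] := hl n.
Qed.

Lemma schwarz_exp_psum (a : nat -> C) N :
  schwarz (fun z => cexp (psum a z N.+1)) (fun t => Re (psum a (cis t) N.+1)).
Proof.
split.
  apply: (@rintble_bounded _ _ (\sum_(n < N.+1) nc (a n))).
    have : cmeas circ (fun t => psum a (cis t) N.+1).
      apply: cmeas_sum => i; apply: cmeasM; first exact: cmeas_cst.
      exact/cmeasX/cmeas_cis.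
    by case.
  move=> t _; apply: le_trans (Re_le_nc _) _; apply: le_trans (nc_sum _ _) _.
  by apply: ler_sum => i _; rewrite ncM ncX nc_cis expr1n mulr1.
exists (cexp ('i * (Im (a 0%N))%:C)).
  by rewrite cexp_i nc_cis.
move=> z z1; rewrite herg_psum// mulrA -rmorphM/= mulVf ?mul1r; last first.
  by rewrite gt_eqF// twopi_gt0.
by rewrite -cexpD addrC subrK.
Qed.

Lemma schwarz_cst (c : C) : c != 0 -> schwarz (fun=> c) (fun=> ln (nc c)).
Proof.
move=> c0; have c_gt0 : 0 < nc c by rewrite nc_gt0.
have h := schwarz_exp_psum (fun n => (ln (nc c))%:C) 0.
have u1 : nc (c / (nc c)%:C) = 1.
  by rewrite ncM ncV ncR ger0_norm ?nc_ge0// mulfV// gt_eqF.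
apply: schwarz_ext (schwarz_unimodular u1 h) => [z z1|].
  rewrite /psum big_ord1 expr0 mulr1 cexp_real lnK ?posrE// divfK//.
  by rewrite (inj_eq (@complexI R)) gt_eqF.
by apply/funext => t; rewrite /psum big_ord1 expr0 mulr1.
Qed.

End Schwarz.

(** * The Poisson integral *)

Section Poisson.
Variable R : realType.
Local Notation C := R[i].
Local Notation nc := (@Normc.normc R).
Local Notation cj := (@conjc R).
Local Notation Re := (@complex.Re R).
Local Notation Im := (@complex.Im R).
Local Notation leb := (@lebesgue_measure R).
Local Notation circ := (@circ R).
Local Open Scope complex_scope.
Implicit Types (t x y : R) (z w : C) (u v : R -> R).

Definition poisson z t : R := Re (hk z t).

Lemma poissonE z t : nc z < 1 ->
  poisson z t = (1 - nc z ^+ 2) / nc (cis t - z) ^+ 2.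
Proof.
move=> z1; have n0 := cis_sub_neq0 t z1.
have E : hk z t = (cis t + z) * cj (cis t - z) * ((nc (cis t - z) ^+ 2)^-1)%:C.
  rewrite /hk -!mulrA; congr (_ * _); apply: (mulfI n0).
  rewrite mulfV// mulrA mulCJ -rmorphM/= mulfV// expf_neq0// nc_eq0//.
rewrite /poisson E mulrC cReZ mulrC; congr (_ / _).
have := nc_cis t; rewrite -[1 - _]/(1 - _) => c1.
have {c1} : nc (cis t) ^+ 2 = 1 by rewrite c1 expr1n.
rewrite !normc2E cReM cReD cImD cReJ cImJ cReB cImB; move=> <-; ring.
Qed.

Lemma poisson_ge0 z t : nc z < 1 -> 0 <= poisson z t.
Proof.
move=> z1; rewrite poissonE// divr_ge0 ?sqr_ge0// subr_ge0.
by rewrite expr_le1// ?nc_ge0// ltW.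
Qed.

Lemma cmeas_poisson z D : nc z < 1 -> measurable_fun D (poisson z).
Proof. by move=> z1; have [] := cmeas_hk D z1. Qed.

Lemma poisson_le z t : nc z < 1 -> `|poisson z t| <= 2 / (1 - nc z).
Proof. by move=> z1; rewrite (le_trans (Re_le_nc _))// nc_hk. Qed.

Lemma sq_poisson z : nc z < 1 -> sq circ (fun t => (poisson z t)%:C).
Proof.
move=> z1; have mp := cmeas_real (@cmeas_poisson z circ z1); split=> //.
apply: (@rintble_bounded _ _ ((2 / (1 - nc z)) ^+ 2)); first exact: cmeas_nc2.
move=> t _; rewrite ger0_norm ?sqr_ge0// ncR ler_sqr ?nnegrE//.
  exact: poisson_le.
by rewrite divr_ge0// subr_ge0 ltW.
Qed.

Lemma ip_poisson z n : nc z < 1 ->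
  ip circ (@expo R n) (fun t => (poisson z t)%:C) = (2 * pi)%:C * z ^+ n.
Proof.
move=> z1; have half : 2^-1 = (2^-1)%:C :> C by rewrite fmorphV rmorph_nat.
have h1 := cintble_hk_expo n z1.
have h2 : cintble circ (fun t => cj (hk z t * cj (expo n t))).
  by apply: cintbleJ; [exact: mcirc|exact: cintble_hk_cj].
transitivity (cintegral circ (fun t =>
    2^-1 * (hk z t * expo n t + cj (hk z t * cj (expo n t))))).
  apply: eq_cint => t _; rewrite cJM cJK -mulrDl cJR half.
  rewrite [LHS]mulrC mulrA; congr (_ * _).
  by apply: Ceq; rewrite ?cReZ ?cImZ ?cReD ?cImD ?cReJ ?cImJ /poisson /=; field.
rewrite cintZ; [|exact: mcirc|by apply: cintbleD; [exact: mcirc|exact: h1|exact: h2]].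
rewrite cintD; [|exact: mcirc|exact: h1|exact: h2].
rewrite cintJ; [|exact: mcirc|exact: cintble_hk_cj].
case: n h1 h2 => [|n] h1 h2.
  have -> : cintegral circ (fun t => hk z t * expo 0%N t) = (2 * pi)%:C.
    by rewrite -(hk_expo0 z1); apply: eq_cint => t _; rewrite /expo mulr1.
  have -> : cintegral circ (fun t => hk z t * cj (expo 0%N t)) = (2 * pi)%:C.
    rewrite -(hk_expo0 z1); apply: eq_cint => t _.
    by rewrite /expo expr0 rmorph1 mulr1.
  by rewrite cJR expr0; field.
by rewrite hk_expo// hk_cj// rmorph0 addr0; field.
Qed.

Section PoissonIntegral.
Variables (a : nat -> C) (g : R -> C).
Hypothesis al2 : l2 a.
Hypothesis sg : sq circ g.
Hypothesis cvg_g :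
  (fun N => N2 circ (fun t => g t - osum (@expo R) a 0 N t)) @ \oo --> (0 : R).

Lemma osum_expo N t : osum (@expo R) a 0 N t = psum a (cis t) N.
Proof. by rewrite /osum big_mkord. Qed.

Lemma ip_osum_poisson b N z : nc z < 1 ->
  ip circ (osum (@expo R) b 0 N) (fun t => (poisson z t)%:C) =
  (2 * pi)%:C * psum b z N.
Proof.
move=> z1; rewrite /osum ip_suml; [|exact: mcirc|..]; last 2 first.
- by move=> i; apply: sqZ; [exact: mcirc|exact: sq_expo].
- exact: sq_poisson.
rewrite /psum mulr_sumr big_mkord; apply: eq_bigr => n _.
rewrite ipZl; [|exact: mcirc|exact: sq_expo|exact: sq_poisson].
by rewrite ip_poisson// mulrCA.
Qed.

(** True for trigonometric polynomials, and both sides are continuous in mean square. *)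
Lemma poisson_integral z : nc z < 1 ->
  ip circ g (fun t => (poisson z t)%:C) = (2 * pi)%:C * ps a z.
Proof.
move=> z1; have [K K0 aK] := l2_bnd al2.
have sqs N := sq_osum (@mcirc R) (@sq_expo R) a 0 N.
have := ip_limit (@mcirc R) sg sqs (sq_poisson z1) cvg_g => cv.
apply: (@ccvg_unique R \oo _ (fun N => (2 * pi)%:C * psum a z N)); last first.
  by apply: cvgCM; [exact: cvg_cst|exact: ps_cvg aK z1].
apply: (cvgC0 _ cv) => N; rewrite le_eqVlt; apply/orP; left; apply/eqP.
by rewrite ip_osum_poisson.
Qed.

Lemma sq_cst (c : C) : sq circ (fun=> c).
Proof. by split; [exact: cmeas_cst|exact: rintble_cst]. Qed.

(** The Poisson kernel is nonnegative and has mean 1. *)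
Lemma ps_sub_le z c : nc z < 1 ->
  2 * pi * nc (ps a z - c) <=
  2 * \int[leb]_(t in circ) (poisson z t * nc (g t - c)).
Proof.
move=> z1; have sP := sq_poisson z1; have sc := sq_cst c.
have sgc := sqB (@mcirc R) sg sc.
have E : (2 * pi)%:C * (ps a z - c) =
    ip circ (fun t => g t - c) (fun t => (poisson z t)%:C).
  rewrite (ipBl (@mcirc R))// poisson_integral// mulrBr; congr (_ - _).
  have -> : ip circ (fun=> c) (fun t => (poisson z t)%:C) =
      c * ip circ (@expo R 0%N) (fun t => (poisson z t)%:C).
    rewrite -ipZl; [|exact: mcirc|exact: sq_expo|exact: sP].
    by apply: eq_cint => t _; rewrite /expo expr0 mulr1.
  by rewrite ip_poisson// mulr1 mulrC.
have <- : nc ((2 * pi)%:C * (ps a z - c)) = 2 * pi * nc (ps a z - c).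
  by rewrite ncM ncR ger0_norm// ltW// twopi_gt0.
have hc := ip_cintble (@mcirc R) sgc sP.
rewrite E; apply: le_trans (nc_cint (@mcirc R) hc) _; rewrite ler_pM2l//.
rewrite le_eqVlt; apply/orP; left; apply/eqP; apply: eq_Rint => t _.
by rewrite ncM nc_conj ncR ger0_norm ?poisson_ge0// mulrC.
Qed.

End PoissonIntegral.

Lemma nc_cis_sub_sq (r th t : R) :
  nc (cis t - r%:C * cis th) ^+ 2 = (1 - r) ^+ 2 + 2 * r * (1 - cos (t - th)).
Proof.
rewrite normc2E cReB cImB cReZ cImZ /= cosB.
have := cos2Dsin2 t; have := cos2Dsin2 th.
move: (cos t) (sin t) (cos th) (sin th) => a b c d h1 h2.
rewrite (_ : (a - r * c) ^+ 2 + (b - r * d) ^+ 2 =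
  (a ^+ 2 + b ^+ 2) + r ^+ 2 * (c ^+ 2 + d ^+ 2) - 2 * r * (a * c + b * d));
  last by ring.
by rewrite h1 h2; ring.
Qed.

Lemma cos_quadratic : exists2 c0 : R, 0 < c0 <= 1 &
  forall x, `|x| <= 1 -> c0 * x ^+ 2 <= 1 - cos x.
Proof.
have c1 : 0 < cos (1 : R) by exact: cos1_gt0.
exists (cos 1 ^+ 2 / 2).
  rewrite divr_gt0 ?exprn_gt0//=.
  have := cos_le1 (1 : R); nra.
suff key x : 0 <= x <= 1 -> cos 1 ^+ 2 / 2 * x ^+ 2 <= 1 - cos x.
  move=> x x1; have := key `|x|; rewrite normr_ge0 x1 cos_norm => /(_ isT).
  by rewrite real_normK// num_real.
move=> /andP[x0 x1].
have sx : cos 1 * (x / 2) <= sin (x / 2).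
  have h0 : 0 <= x / 2 by rewrite divr_ge0.
  have [|c] := @MVT_segment R sin cos 0 (x / 2) h0.
    by apply: continuous_subspaceT => u; exact: continuous_sin.
  rewrite in_itv/= sin0 !subr0 => /andP[c0 cx] ->.
    rewrite ler_wpM2r//.
    have cle1 : c <= 1 by lra.
    have pi2 := @pi_ge2 R.
    move: cle1; rewrite le_eqVlt => /predU1P[->//|c1'].
    by rewrite ltW// ltr_cos// in_itv/=; apply/andP; split; lra.
have : cos x = 1 - 2 * sin (x / 2) ^+ 2.
  rewrite {1}(_ : x = x / 2 *+ 2); last by rewrite mulr2n; field.
  by rewrite cos_mulr2n cos2sin2 mulr2n; move: (sin _) => s; ring.
move=> ->; rewrite opprB addrCA subrr addr0.
have s0 : 0 <= cos 1 * (x / 2) by rewrite mulr_ge0 ?divr_ge0// ltW.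
move: sx s0; move: (sin (x / 2)) (cos 1) => s m sx s0; nra.
Qed.

Lemma cos_far (d x : R) : 0 < d -> d <= `|x| <= 2 * pi - d -> cos x <= cos d.
Proof.
move=> d0; rewrite -cos_norm; move: `|x| => {x}x /andP[dx xd].
have key y : d <= y <= pi -> cos y <= cos d.
  move=> /andP[dy yp]; move: dy; rewrite le_eqVlt => /predU1P[->//|dy].
  by rewrite ltW// ltr_cos// in_itv/=; apply/andP; split; lra.
have [xp|px] := leP x pi; first by rewrite key// dx xp.
have -> : cos x = cos (2 * pi - x).
  by rewrite -[RHS]cosN opprB -[RHS]cosD2pi -[pi *+ 2]mulr_natl subrK.
by rewrite key//; apply/andP; split; lra.
Qed.

Lemma cos_lt1 (d : R) : 0 < d <= 1 -> cos d < 1.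
Proof.
move=> /andP[d0 d1]; rewrite -[ltRHS]cos0 ltr_cos// in_itv/=;
  have := @pi_ge2 R => h; apply/andP; split; lra.
Qed.

End Poisson.

(** * Convergence of Poisson integrals at a point *)

Section Fatou.
Variable R : realType.
Local Notation C := R[i].
Local Notation nc := (@Normc.normc R).
Local Notation cj := (@conjc R).
Local Notation Re := (@complex.Re R).
Local Notation Im := (@complex.Im R).
Local Notation leb := (@lebesgue_measure R).
Local Notation circ := (@circ R).
Local Open Scope complex_scope.
Implicit Types (t x y : R) (z w : C) (u v : R -> R).

Definition ibump (th rho t : R) : R := \1_(ball th rho) t.

Lemma ibumpE th rho t : ibump th rho t = ((`|t - th| < rho)%R : bool)%:R.
Proof.
rewrite /ibump indicE; congr (_%:R); congr nat_of_bool.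
by apply/idP/idP; rewrite inE /ball /= distrC.
Qed.

Lemma ibump_ge0 th rho t : 0 <= ibump th rho t.
Proof. by rewrite ibumpE ler0n. Qed.

Lemma rintble_ibumpM th rho h : rintble circ h ->
  rintble circ (fun t => ibump th rho t * h t).
Proof.
move=> hh; apply: (rintble_le (@mcirc R) _ _ (rintble_norm hh)).
  apply: measurable_funM; last exact: rintble_meas hh.
  by apply: measurable_indic; exact: measurable_ball.
move=> t _; rewrite normrM ibumpE; case: (_ < _) => /=.
  by rewrite normr1 mul1r.
by rewrite normr0 mul0r.
Qed.

(** On the part of the line where |t - th| lies between 2^(k-1) eta and 2^k eta the
    left-hand side is at most 4^(1-k) / eta, which is the coefficient of the k-th
    indicator. *)
Lemma dyadic_kernel (eta th t : R) K : 0 < eta -> `|t - th| < 2 ^+ K * eta ->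
  eta / (eta ^+ 2 + (t - th) ^+ 2) <=
  \sum_(k < K.+1) 4 * 4^-1 ^+ k / eta * ibump th (2 ^+ k * eta) t.
Proof.
move=> e0; set x := t - th; set w := eta / _.
have S0 k : 0 <= 4 * 4^-1 ^+ k / eta * ibump th (2 ^+ k * eta) t.
  rewrite mulr_ge0 ?ibump_ge0// divr_ge0 ?ltW// mulr_gt0// exprn_gt0//.
elim: K => [|K IH] hx.
  rewrite big_ord1 ibumpE -/x hx expr0 !mulr1 /w.
  rewrite ler_pdivrMr; last by have := sqr_ge0 x; nra.
  rewrite mulrAC ler_pdivlMr//; have := sqr_ge0 x; nra.
rewrite big_ord_recr/=; have [h|h] := ltP `|x| (2 ^+ K * eta).
  by apply: le_trans (IH h) _; rewrite lerDl.
rewrite -[leLHS]add0r; apply: lerD; first by apply: sumr_ge0 => k _.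
rewrite ibumpE -/x hx mulr1 exprS mulrA mulfV// mul1r.
have p0 : 0 < 2 ^+ K :> R by rewrite exprn_gt0.
have hx2 : (2 ^+ K * eta) ^+ 2 <= x ^+ 2.
  rewrite -[leRHS]real_normK ?num_real// ler_sqr ?nnegrE//.
  by rewrite mulr_ge0// ltW.
have E4 : 4^-1 ^+ K = (2 ^+ K ^+ 2)^-1 :> R.
  by rewrite exprVn -exprM mulnC exprM; congr (_ ^+ K)^-1; ring.
rewrite E4 /w; apply: (@le_trans _ _ (eta / (2 ^+ K * eta) ^+ 2)).
  apply: ler_wpM2l; first exact: ltW.
  have q0 : 0 < (2 ^+ K * eta) ^+ 2 by rewrite exprn_gt0// mulr_gt0.
  have e2 := sqr_ge0 eta.
  by rewrite lef_pV2 ?posrE//; lra.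
by rewrite le_eqVlt; apply/orP; left; apply/eqP; field; rewrite !gt_eqF.
Qed.

Lemma half_sum_le2 K : \sum_(k < K) 2^-1 ^+ k <= 2 :> R.
Proof.
have -> : \sum_(k < K) 2^-1 ^+ k = 2 - 2 * 2^-1 ^+ K :> R.
  elim: K => [|K IH]; first by rewrite big_ord0 expr0; ring.
  by rewrite big_ord_recr/= IH exprS; field.
by rewrite lerBlDr lerDl mulr_ge0// exprn_ge0.
Qed.

Lemma Rint_sum (I : Type) (s : seq I) (F : I -> R -> R) :
  (forall i, rintble circ (F i)) -> rintble circ (fun t => \sum_(i <- s) F i t) /\
  \int[leb]_(t in circ) (\sum_(i <- s) F i t) =
  \sum_(i <- s) \int[leb]_(t in circ) F i t.
Proof.
move=> h; elim: s => [|i s [IH1 IH2]].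
  split.
    under [fun _ => _]eq_fun do rewrite big_nil; exact: rintble0 (@mcirc R).
  rewrite big_nil -[RHS](mulr0 (2 * pi)) -Rint_circ_cst.
  by apply: eq_Rint => t _; rewrite big_nil.
split.
  under [fun _ => _]eq_fun do rewrite big_cons.
  exact: (rintbleD (@mcirc R) (h i) IH1).
rewrite big_cons -IH2 -(RintD (@mcirc R) (h i) IH1).
by apply: eq_Rint => t _; rewrite big_cons.
Qed.

Lemma dyadic_scale (eta d : R) : 0 < eta <= d ->
  exists K, 2 ^+ K * eta <= d < 2 ^+ K.+1 * eta.
Proof.
move=> /andP[e0 ed].
have ex : exists n, d < 2 ^+ n * eta.
  exists (Num.bound (d / eta)); rewrite -ltr_pdivrMr//.
  apply: lt_trans (archi_boundP _) _.
    by rewrite divr_ge0 ?ltW// (lt_le_trans e0).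
  by rewrite -natrX ltr_nat ltn_expl.
have [n dn nmin] := ex_minnP ex.
case: n dn nmin => [|n] dn nmin; first by move: dn; rewrite mul1r ltNge ed.
exists n; rewrite dn andbT leNgt; apply/negP => /nmin.
by rewrite ltnn.
Qed.

(** Fatou's theorem at a point where the averages of [h] over shrinking
    intervals tend to zero: the Poisson kernel is dominated by a geometric
    combination of indicators of dyadic intervals. *)
Lemma poisson_cvg0 (th : R) (h : R -> R) : 0 < th < 2 * pi ->
  rintble circ h -> (forall t, 0 <= h t) ->
  (forall kappa, 0 < kappa -> exists2 delta, 0 < delta & forall rho,
     0 < rho < delta ->
     \int[leb]_(t in circ) (ibump th rho t * h t) <= kappa * rho) ->
  forall e, 0 < e -> exists2 eta0, 0 < eta0 <= 1 & forall eta, 0 < eta < eta0 ->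
    \int[leb]_(t in circ) (poisson ((1 - eta)%:C * cis th) t * h t) <= e.
Proof.
move=> /andP[th0 th2] hh h0 hyp e e0.
have [c0 /andP[c0_gt0 c0_le1] hc0] := @cos_quadratic R.
pose kappa := e * c0 / 64.
have k0 : 0 < kappa by rewrite divr_gt0// mulr_gt0.
have [delta dl0 hdl] := hyp kappa k0.
pose d := Num.min (delta / 2) (Num.min 1 (Num.min th (2 * pi - th))).
have d0 : 0 < d.
  by rewrite !lt_min divr_gt0// ltr01 th0 subr_gt0 th2.
have dmin : [/\ d <= delta / 2, d <= 1, d <= th & d <= 2 * pi - th].
  by rewrite /d !ge_min !lexx ?orbT.
have [dd d1 dth dth2] := dmin.
clearbody d.
pose d' := d / 2.
have d'01 : 0 < d' <= 1 by apply/andP; split; rewrite /d'; lra.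
have cd : 0 < 1 - cos d' by rewrite subr_gt0 cos_lt1.
pose I := \int[leb]_(t in circ) h t.
have I0 : 0 <= I by apply: Rintegral_ge0.
pose eta0 := Num.min (Num.min d 2^-1) (e * (1 - cos d') / (4 * (I + 1))).
have eta0_gt0 : 0 < eta0.
  rewrite !lt_min d0 invr_gt0 ltr0n/= divr_gt0// ?mulr_gt0//.
  by rewrite ltr_wpDl.
exists eta0.
  by rewrite eta0_gt0/= /eta0 !ge_min d1 ?orbT.
move=> eta /andP[eta_gt0]; rewrite !lt_min => /andP[/andP[etad eta2] etaI].
set z := (1 - eta)%:C * cis th.
have ncz : nc z = 1 - eta.
  by rewrite ncM ncR nc_cis mulr1 ger0_norm// subr_ge0; lra.
have z1 : nc z < 1 by rewrite ncz; lra.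
have [K /andP[K1 K2]] := dyadic_scale (introT andP (conj eta_gt0 (ltW etad))).
pose c k := 2 / c0 * (4 * 4^-1 ^+ k / eta).
have ptw t : circ t -> poisson z t * h t <=
    \sum_(k < K.+1) c k * (ibump th (2 ^+ k * eta) t * h t)
    + 2 * eta / (1 - cos d') * h t.
  rewrite /circ/= in_itv/= => /andP[t0 t2].
  have -> : \sum_(k < K.+1) c k * (ibump th (2 ^+ k * eta) t * h t) =
      (2 / c0 * \sum_(k < K.+1) 4 * 4^-1 ^+ k / eta * ibump th (2 ^+ k * eta) t)
      * h t.
    by rewrite mulr_sumr mulr_suml; apply: eq_bigr => k _; rewrite /c; ring.
  rewrite -mulrDl ler_wpM2r//.
  have S0 : 0 <= \sum_(k < K.+1) 4 * 4^-1 ^+ k / eta * ibump th (2 ^+ k * eta) t.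
    apply: sumr_ge0 => k _; rewrite mulr_ge0 ?ibump_ge0// divr_ge0 ?(ltW eta_gt0)//.
  have den : nc (cis t - z) ^+ 2 =
      eta ^+ 2 + 2 * (1 - eta) * (1 - cos (t - th)).
    by rewrite nc_cis_sub_sq; congr (_ ^+ 2 + _); ring.
  have num : 1 - nc z ^+ 2 <= 2 * eta by rewrite ncz; nra.
  have num0 : 0 <= 1 - nc z ^+ 2 by rewrite ncz; nra.
  have cos1 := cos_le1 (t - th).
  have den1 : eta ^+ 2 + (1 - cos (t - th)) <= nc (cis t - z) ^+ 2.
    rewrite den lerD2l; nra.
  rewrite poissonE//.
  have [near|far] := ltP `|t - th| (2 ^+ K * eta).
    rewrite -[leLHS]addr0; apply: lerD; last first.
      by rewrite divr_ge0 ?(ltW cd)// mulr_ge0// ltW.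
    apply: (@le_trans _ _ (2 / c0 * (eta / (eta ^+ 2 + (t - th) ^+ 2)))).
      have q0 : 0 < eta ^+ 2 + (t - th) ^+ 2.
        by rewrite ltr_wpDr ?sqr_ge0// exprn_gt0.
      have x1 : `|t - th| <= 1 by rewrite ltW// (lt_le_trans near)// (le_trans K1).
      have hx := hc0 _ x1.
      have den2 : c0 * (eta ^+ 2 + (t - th) ^+ 2) <= nc (cis t - z) ^+ 2.
        apply: le_trans den1; have := sqr_ge0 eta; nra.
      have -> : 2 / c0 * (eta / (eta ^+ 2 + (t - th) ^+ 2)) =
          2 * eta / (c0 * (eta ^+ 2 + (t - th) ^+ 2)).
        by field; rewrite !gt_eqF.
      apply: ler_pM => //; first by rewrite invr_ge0 sqr_ge0.
      have q1 : 0 < c0 * (eta ^+ 2 + (t - th) ^+ 2) by rewrite mulr_gt0.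
      by rewrite lef_pV2 ?posrE// (lt_le_trans q1 den2).
    rewrite ler_pM2l ?divr_gt0//; exact: dyadic_kernel.
  rewrite -[leLHS]add0r; apply: lerD; first by rewrite mulr_ge0// divr_ge0// ltW.
  have cf : cos (t - th) <= cos d'.
    apply: cos_far; first by case/andP: d'01.
    rewrite (le_trans _ far)/=; last first.
      by move: K2; rewrite exprS /d'; lra.
    by rewrite ler_norml /d'; lra.
  have den3 : 1 - cos d' <= nc (cis t - z) ^+ 2.
    by apply: le_trans den1; have := sqr_ge0 eta; lra.
  apply: ler_pM => //; first by rewrite invr_ge0 sqr_ge0.
  by rewrite lef_pV2 ?posrE// (lt_le_trans cd den3).
have hF k : rintble circ (fun t => c k * (ibump th (2 ^+ k * eta) t * h t)).
  by apply: (rintbleZ (@mcirc R)); exact: rintble_ibumpM.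
have [hS hSE] := Rint_sum (index_enum 'I_K.+1) (fun k : 'I_K.+1 => hF k).
have hL : rintble circ (fun t => 2 * eta / (1 - cos d') * h t).
  exact: (rintbleZ (@mcirc R)).
have hP : rintble circ (fun t => poisson z t * h t).
  apply: (rintble_le (@mcirc R) _ _ (rintbleZ (@mcirc R) (2 / (1 - nc z)) hh)).
    by apply: measurable_funM; [exact: cmeas_poisson|exact: rintble_meas].
  by move=> t _; rewrite normrM (ger0_norm (h0 t)) ler_wpM2r// poisson_le.
apply: le_trans (Rint_le (@mcirc R) hP (rintbleD (@mcirc R) hS hL) ptw) _.
rewrite (RintD (@mcirc R) hS hL) hSE (RintZ (@mcirc R) _ hh) -/I.
rewrite (splitr e); apply: lerD.
  apply: (@le_trans _ _ (\sum_(k < K.+1) 8 * kappa / c0 * 2^-1 ^+ k)).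
    apply: ler_sum => k _.
    rewrite (RintZ (@mcirc R)); last exact: rintble_ibumpM.
    have kK : 2 ^+ k * eta < delta.
      have : 2 ^+ k <= 2 ^+ K :> R.
        by rewrite ler_eXn2l ?ltr1n// -ltnS.
      move: K1 dd d0 eta_gt0; move: (2 ^+ k) (2 ^+ K) => p q; nra.
    have pk : 0 < 2 ^+ k * eta by rewrite mulr_gt0// exprn_gt0.
    apply: (@le_trans _ _ (c k * (kappa * (2 ^+ k * eta)))).
      apply: ler_wpM2l; last by apply: hdl; rewrite pk.
      apply: mulr_ge0; first by rewrite divr_ge0// ltW.
      apply: divr_ge0; last exact: ltW.
      by apply: mulr_ge0 => //; exact: exprn_ge0.
    rewrite le_eqVlt; apply/orP; left; apply/eqP.
    have -> : 2^-1 ^+ k = 4^-1 ^+ k * 2 ^+ k :> R.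
      by rewrite -exprMn; congr (_ ^+ _); field.
    by rewrite /c; field; rewrite !gt_eqF.
  rewrite -mulr_sumr.
  apply: (@le_trans _ _ (8 * kappa / c0 * 2)).
    rewrite ler_pM2l ?half_sum_le2// divr_gt0// mulr_gt0//.
  rewrite /kappa (_ : 8 * _ / c0 * 2 = e / 4); first by lra.
  by field; rewrite gt_eqF.
have Ip : 0 < I + 1 by rewrite ltr_wpDl.
have h1 : 2 * eta / (1 - cos d') <= e / (2 * (I + 1)).
  rewrite ler_pdivrMr//; move: etaI; rewrite ltr_pdivlMr ?mulr_gt0//.
  move=> /ltW h2; rewrite -(ler_pM2r (_ : 0 < 2 * (I + 1))) ?mulr_gt0//.
  have -> : e / (2 * (I + 1)) * (1 - cos d') * (2 * (I + 1)) = e * (1 - cos d').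
    by field; rewrite gt_eqF.
  by apply: le_trans h2; rewrite le_eqVlt; apply/orP; left; apply/eqP; ring.
apply: le_trans (ler_wpM2r I0 h1) _.
rewrite -mulrA ler_wpM2l ?(ltW e0)// invfM -mulrA ler_piMr ?invr_ge0//.
by rewrite mulrC ler_pdivrMr// mul1r lerDl.
Qed.

End Fatou.

(** * Radial limits almost everywhere *)

Section RadialLimits.
Variable R : realType.
Local Notation C := R[i].
Local Notation nc := (@Normc.normc R).
Local Notation cj := (@conjc R).
Local Notation Re := (@complex.Re R).
Local Notation Im := (@complex.Im R).
Local Notation leb := (@lebesgue_measure R).
Local Notation circ := (@circ R).
Local Open Scope complex_scope.
Implicit Types (t x y : R) (z w : C) (u v f : R -> R).

(** The averages in the definition of a Lebesgue point, over the whole line, are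
    turned into integrals over the circle. *)
Lemma lebesgue_pt_ibump f th : 0 < th < 2 * pi -> rintble circ f ->
  lebesgue_pt (f \_ circ) th ->
  forall kappa, 0 < kappa -> exists2 delta, 0 < delta & forall rho,
    0 < rho < delta ->
    \int[leb]_(t in circ) (ibump th rho t * `|f t - f th|) <= kappa * rho.
Proof.
move=> /andP[th0 th2] hf hp kappa k0.
have k2 : 0 < kappa / 2 by rewrite divr_gt0.
have /hp [d /= d0 hd] : nbhs (0%:E : \bar R) [set y | (y < (kappa / 2)%:E)%E].
  exact: (@nbhs_open_ereal_lt R 0 (fun=> kappa / 2)).
pose delta := Num.min d (Num.min th (2 * pi - th)).
exists delta; first by rewrite !lt_min d0 th0 subr_gt0.
move=> rho /andP[r0]; rewrite !lt_min => /andP[rd /andP[rth rth2]].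
have := hd rho; rewrite /= sub0r normrN gtr0_norm// => /(_ rd r0).
rewrite /davg /iavg (lebesgue_measure_ball _ (ltW r0)).
have B_circ : ball th rho `<=` circ.
  move=> t; rewrite /ball/= distrC ltr_norml => /andP[h1 h2].
  by rewrite /circ/= in_itv/=; apply/andP; split; lra.
have th_circ : circ th by rewrite /circ/= in_itv/= !ltW.
have E : (\int[leb]_(y in ball th rho)
      `|((center ((f \_ circ) th) \o f \_ circ) y)%:E| =
    \int[leb]_(t in circ) (ibump th rho t * `|f t - f th|)%:E)%E.
  rewrite integral_mkcond [RHS]integral_mkcond; apply: eq_integral => t _.
  rewrite !patchE /ibump indicE /=.
  case: ifPn => tB.
    have /B_circ tc := set_mem tB.
    by rewrite (mem_set tc) !patchE (mem_set tc) (mem_set th_circ) /= mul1r.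
  by case: ifP => // _; rewrite /= mul0r.
rewrite E.
have hi : rintble circ (fun t => ibump th rho t * `|f t - f th|).
  apply: rintble_ibumpM; apply: rintble_norm; apply: (rintbleB (@mcirc R)) => //.
  exact: rintble_cst.
have -> : (\int[leb]_(t in circ) (ibump th rho t * `|f t - f th|)%:E)%E =
    (\int[leb]_(t in circ) (ibump th rho t * `|f t - f th|))%:E.
  by rewrite /Rintegral fineK//; exact: (integrable_fin_num (@mcirc R) hi).
have rho2 : rho *+ 2 != 0 by rewrite mulrn_eq0/= gt_eqF.
rewrite inver (negbTE rho2) -EFinM lte_fin mulrC ltr_pdivrMr; last by rewrite mulrn_wgt0.
by move=> /ltW; rewrite -[rho *+ 2]mulr_natr => h; apply: le_trans h _; lra.
Qed.

Lemma ae_neq (c : R) : {ae leb, forall t, t != c}.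
Proof.
exists [set c]; split => //=; first exact: lebesgue_measure_set1.
by move=> t /= /negP; rewrite negbK => /eqP.
Qed.

Lemma sq_circ_rintble (g : R -> C) : sq circ g -> cintble circ g.
Proof.
move=> [mg g2].
apply: (@cintble_le _ _ (@mcirc R) _ (fun t => 1 + nc (g t) ^+ 2)) => //.
  by apply: (rintbleD (@mcirc R)) => //; exact: rintble_cst.
move=> t _; have := sqr_ge0 (nc (g t) - 1); nra.
Qed.

Lemma filterS4 T (F : set_system T) (FF : Filter F) (P1 P2 P3 P4 Q : set T) :
  (forall p : T, P1 p -> P2 p -> P3 p -> P4 p -> Q p) ->
  F P1 -> F P2 -> F P3 -> F P4 -> F Q.
Proof.
move=> h F1 F2 F3 F4; apply: filterS2 (filterI F1 F2) (filterI F3 F4).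
by move=> x [? ?] [? ?]; exact: h.
Qed.

(** Square summable coefficients yield a boundary function with these Fourier
    coefficients; almost every point is a Lebesgue point of its real and imaginary
    parts, and there the Poisson integrals converge. *)
Theorem fatou_radial (a : nat -> C) : l2 a -> exists g : R -> C,
  [/\ sq circ g,
      (fun N => N2 circ (fun t => g t - osum (@expo R) a 0 N t)) @ \oo --> (0 : R),
      (forall n, ip circ g (@expo R n) = (2 * pi)%:C * a n) &
      {ae leb, forall th, circ th -> forall e, 0 < e ->
         \forall r \near (1 : R)^'-, nc (g th - ps a (r%:C * cis th)) < e}].
Proof.
move=> al2.
have [g [sg cvg_g coef_g]] :=
  riesz_fischer_coef (@mcirc R) (@twopi_gt0 R) (@sq_expo R) (@orth_expo R) al2.
exists g; split => //.
have [hr hi] := sq_circ_rintble sg.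
have locr := lebesgue_differentiation (integrable_locally (@mcirc R) hr).
have loci := lebesgue_differentiation (integrable_locally (@mcirc R) hi).
have F : Filter (almost_everywhere leb) by exact: ae_filter_ringOfSetsType.
apply: (@filterS4 _ _ F _ _ _ _ _ _ (ae_neq 0) (ae_neq (2 * pi)) locr loci).
move=> th th_n0 th_n2 pr pim cth e e0.
have th02 : 0 < th < 2 * pi.
  move: cth; rewrite /circ/= in_itv/= => /andP[t0 t2].
  by rewrite !lt_neqAle t0 t2 eq_sym th_n0 th_n2.
pose hR t := `|Re (g t) - Re (g th)|; pose hI t := `|Im (g t) - Im (g th)|.
have ihR : rintble circ hR.
  by apply: rintble_norm; apply: (rintbleB (@mcirc R)) => //; exact: rintble_cst.
have ihI : rintble circ hI.
  by apply: rintble_norm; apply: (rintbleB (@mcirc R)) => //; exact: rintble_cst.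
have e4 : 0 < e / 4 by rewrite divr_gt0.
have hR0 t : 0 <= hR t by exact: normr_ge0.
have hI0 t : 0 <= hI t by exact: normr_ge0.
have [d1 /andP[d10 d11] P1] :=
  poisson_cvg0 th02 ihR hR0 (lebesgue_pt_ibump th02 hr pr) e4.
have [d2 /andP[d20 d21] P2] :=
  poisson_cvg0 th02 ihI hI0 (lebesgue_pt_ibump th02 hi pim) e4.
have r1 : \forall r \near (1 : R)^'-, 1 - Num.min d1 d2 < r.
  by apply: nbhs_left_gt; rewrite ltrBlDr ltrDl lt_min d10 d20.
have r2 : \forall r \near (1 : R)^'-, r < 1.
  exact: nbhs_left_lt.
apply: filterS2 r1 r2 => r hr1 hr2.
have eta : 0 < 1 - r < d1 /\ 0 < 1 - r < d2.
  have : 1 - r < Num.min d1 d2 by lra.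
  by rewrite lt_min subr_gt0 hr2 => /andP[-> ->].
have [eta1 eta2] := eta.
have er : 1 - (1 - r) = r by ring.
have := P1 _ eta1; have := P2 _ eta2; rewrite er.
set z := r%:C * cis th => I2 I1.
have r_ge0 : 0 <= r by case/andP: eta1; lra.
have z1 : nc z < 1 by rewrite ncM ncR nc_cis mulr1 ger0_norm.
have ip z' u : nc z' < 1 -> rintble circ u -> rintble circ (fun t => poisson z' t * u t).
  move=> z'1 hu.
  apply: (rintble_le (@mcirc R) _ _ (rintbleZ (@mcirc R) (2 / (1 - nc z'))
    (rintble_norm hu))).
    by apply: measurable_funM; [exact: cmeas_poisson|exact: rintble_meas].
  by move=> t _; rewrite normrM ler_wpM2r// poisson_le.
have := ps_sub_le al2 sg cvg_g (g th) z1; rewrite nc_distC => main.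
have hb : \int[leb]_(t in circ) (poisson z t * nc (g t - g th)) <=
    \int[leb]_(t in circ) (poisson z t * hR t) +
    \int[leb]_(t in circ) (poisson z t * hI t).
  rewrite -RintD; [|exact: mcirc|exact: ip|exact: ip].
  apply: Rint_le; [exact: mcirc|apply: ip => //|..].
  - apply: (cintble_nc (@mcirc R)); apply: (cintbleB (@mcirc R)); first by split.
    exact: (conj (rintble_cst _) (rintble_cst _)).
  - by apply: (rintbleD (@mcirc R)); exact: ip.
  - move=> t _; rewrite -mulrDr; apply: ler_wpM2l; first exact: poisson_ge0.
    by apply: le_trans (nc_le_ReIm _) _; rewrite cReB cImB.
have pi2 := @pi_ge2 R; have n0 := nc_ge0 (g th - ps a z).
move: main hb I1 I2 n0.
move: (nc _) (\int[leb]_(t in circ) (poisson z t * nc (g t - g th))).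
move: (\int[leb]_(t in circ) (poisson z t * hR t)).
move: (\int[leb]_(t in circ) (poisson z t * hI t)) => A B x D; nra.
Qed.

End RadialLimits.

(** * Linear factors *)

Section AlmostEverywhere.
Context d (T : measurableType d) (R : realType)
  (mu : {measure set T -> \bar R}).
Local Open Scope ereal_scope.
Import HBNNSimple.

(** A simple function below f, cut off on the exceptional null set, lies below g and
    keeps its integral. *)
Lemma ge0_integral_ae_le (D : set T) (f g : T -> \bar R) :
  (forall x, 0 <= f x) -> (forall x, 0 <= g x) ->
  {ae mu, forall x, D x -> f x = g x} ->
  \int[mu]_(x in D) f x <= \int[mu]_(x in D) g x.
Proof.
move=> f0 g0 [N [mN N0 hN]].
rewrite [leLHS]ge0_integralE//; apply: ge_ereal_sup => _ [h hf <-].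
have mN' := measurableC mN.
rewrite -integralT_nnsfun (ge0_negligible_integral mN measurableT _ _ N0)//; last 2 first.
- by apply/measurable_EFinP; exact: measurable_funTS.
- by move=> x _; rewrite lee_fin.
rewrite setTD integral_nnsfun// mrestrict.
rewrite [leRHS]ge0_integralE//; apply: ereal_sup_ubound.
exists (proj_nnsfun h mN') => // x; rewrite -mrestrict patchE.
case: ifPn => [/set_mem xN|_]; last by rewrite patchE; case: ifP.
have := hf x; rewrite !patchE; case: ifPn => // /set_mem Dx hx.
suff <- : f x = g x by [].
by apply: contrapT => fg; apply: xN; apply: hN => /(_ Dx).
Qed.

(** Equality almost everywhere suffices for equality of integrals, even without
    measurability of either function. *)
Lemma integral_ae_congr (D : set T) (f g : T -> \bar R) :
  {ae mu, forall x, D x -> f x = g x} ->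
  \int[mu]_(x in D) f x = \int[mu]_(x in D) g x.
Proof.
move=> [N [mN N0 hN]].
have key (p : \bar R -> \bar R) : (forall y, 0 <= p y) ->
    \int[mu]_(x in D) p (f x) = \int[mu]_(x in D) p (g x).
  move=> p0; apply/eqP; rewrite eq_le; apply/andP.
  split; apply: ge0_integral_ae_le => //; exists N; split => // x /= h;
    by apply: hN => /= e; apply: h => /e ->.
rewrite [LHS]integralE [RHS]integralE; congr (_ - _).
  have h := key (fun y => maxe y 0); rewrite unlock; apply: h => y.
  by rewrite le_max lexx orbT.
have h := key (fun y => maxe (- y) 0); rewrite unlock; apply: h => y.
by rewrite le_max lexx orbT.
Qed.
End AlmostEverywhere.

#[global] Instance ae_lebesgue_filter (R : realType) :
  Filter (nbhs (almost_everywhere (@lebesgue_measure R))).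
Proof. exact: ae_filter_ringOfSetsType. Qed.

Section LinearFactor.
Variable R : realType.
Local Notation C := R[i].
Local Notation nc := (@Normc.normc R).
Local Notation cj := (@conjc R).
Local Notation Re := (@complex.Re R).
Local Notation Im := (@complex.Im R).
Local Notation leb := (@lebesgue_measure R).
Local Notation circ := (@circ R).
Local Open Scope complex_scope.
Implicit Types (t x y : R) (z w : C) (u v : R -> R).

Lemma Rint_ae_congr (D : set R) u v : {ae leb, forall t, D t -> u t = v t} ->
  \int[leb]_(t in D) u t = \int[leb]_(t in D) v t.
Proof.
move=> h; congr fine; apply: integral_ae_congr.
by apply: filterS h => t h /h ->.
Qed.

Lemma rintble_ae u v : measurable_fun circ v ->
  {ae leb, forall t, circ t -> u t = v t} -> rintble circ u -> rintble circ v.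
Proof.
move=> mv h /integrableP[mu iu]; apply/integrableP; split.
  exact/measurable_EFinP.
rewrite (_ : (\int[leb]_(x in circ) _)%E = (\int[leb]_(x in circ) `|(u x)%:E|)%E)//.
by apply: integral_ae_congr; apply: filterS h => t h /h ->.
Qed.

Lemma schwarz_ae G u v : measurable_fun circ v ->
  {ae leb, forall t, circ t -> u t = v t} -> schwarz G u -> schwarz G v.
Proof.
move=> mv h hG; have [hu _] := hG.
apply: (schwarz_lim (fun=> hG)); first exact: rintble_ae h hu.
  by move=> z _; exact: cvg_cst.
rewrite (_ : (fun n => _) = fun=> 0); first exact: cvg_cst.
apply/funext => _; rewrite -[RHS](mulr0 (2 * pi)) -Rint_circ_cst.
by apply: Rint_ae_congr; apply: filterS h => t h /h ->; rewrite subrr normr0.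
Qed.

Lemma Rint_nc_le (f : R -> C) : sq circ f ->
  \int[leb]_(t in circ) nc (f t) <= Num.sqrt (N2 circ f * (2 * pi)).
Proof.
move=> sf; have [mf f2] := sf.
have sn : sq circ (fun t => (nc (f t))%:C).
  split; first exact: cmeas_real (cmeas_nc mf).
  by under [fun _ => _]eq_fun do rewrite ncR ger0_norm ?nc_ge0//.
have s1 : sq circ (fun=> 1) := @sq_cst R 1.
have := cauchy_schwarz (@mcirc R) sn s1.
have -> : N2 circ (fun t => (nc (f t))%:C) = N2 circ f.
  by apply: eq_Rint => t _; rewrite ncR ger0_norm// nc_ge0.
have -> : N2 circ (fun=> 1) = 2 * pi.
  rewrite -[RHS]mulr1 -Rint_circ_cst; apply: eq_Rint => t _.
  by rewrite nc1 expr1n.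
have -> : ip circ (fun t => (nc (f t))%:C) (fun=> 1) =
    (\int[leb]_(t in circ) nc (f t))%:C.
  rewrite -cint_real; apply: eq_cint => t _.
  by rewrite rmorph1 mulr1.
have I0 : 0 <= \int[leb]_(t in circ) nc (f t).
  by apply: Rintegral_ge0 => t _; exact: nc_ge0.
by move=> h; rewrite -(ger0_norm I0) -ncR -[leLHS]ger0_norm ?nc_ge0// -sqrtr_sqr ler_wsqrtr.
Qed.

Lemma cvg_Rint_nc (f : nat -> R -> C) : (forall n, sq circ (f n)) ->
  (fun n => N2 circ (f n)) @ \oo --> (0 : R) ->
  (fun n => \int[leb]_(t in circ) nc (f n t)) @ \oo --> (0 : R).
Proof.
move=> sf cv; apply: (@le_cvg0 _ _ (fun n => Num.sqrt (N2 circ (f n) * (2 * pi)))).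
  move=> n; rewrite Rint_nc_le// andbT.
  by apply: Rintegral_ge0 => t _; exact: nc_ge0.
rewrite -[X in _ --> X]sqrtr0 -(mul0r (2 * pi)).
apply: (@cvg_comp _ _ _ _ (@Num.sqrt R) _ (nbhs (0 * (2 * pi)))).
  by apply: cvgM => //; exact: cvg_cst.
exact: sqrt_continuous.
Qed.

Lemma nc_nat n : nc (n%:R : C) = n%:R.
Proof. by rewrite -(rmorph_nat (real_complex R)) ncR ger0_norm ?ler0n. Qed.

Lemma cderiv_cexp_comp (F : R -> C) t d : cderiv F t d ->
  cderiv (fun t => cexp (F t)) t (d * cexp (F t)).
Proof.
move=> [F1 F2].
have e : is_derive t (1 : R) (fun t => expR (Re (F t))) (expR (Re (F t)) * Re d).
  exact: (@is_derive1_comp R (@expR R) (fun t => Re (F t))).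
have c : is_derive t (1 : R) (fun t => cos (Im (F t))) (- sin (Im (F t)) * Im d).
  exact: (@is_derive1_comp R (@cos R) (fun t => Im (F t))).
have s : is_derive t (1 : R) (fun t => sin (Im (F t))) (cos (Im (F t)) * Im d).
  exact: (@is_derive1_comp R (@sin R) (fun t => Im (F t))).
have h : cderiv (fun t => cis (Im (F t))) t
    ((- sin (Im (F t)) * Im d) +i* (cos (Im (F t)) * Im d)) by [].
have := cderivM (cderiv_real e) h; congr cderiv.
by rewrite /cexp; apply: Ceq; rewrite ?cReD ?cImD !(cReM,cImM) /=; ring.
Qed.

Lemma cderiv_monomial (c : C) n t :
  cderiv (fun t => c / n.+1%:R * (t%:C) ^+ n.+1) t (c * t%:C ^+ n).
Proof.
have X m : cderiv (fun t => (t%:C) ^+ m.+1) t (m.+1%:R * t%:C ^+ m).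
  elim: m => [|m IH].
    have := cderiv_real (is_derive_id t (1 : R)).
    by rewrite mulr1; under eq_fun do rewrite -[_%:C]expr1.
  have := cderivM (cderiv_real (is_derive_id t (1 : R))) IH.
  under eq_fun do rewrite -exprS.
  by congr cderiv; rewrite -[m.+2%:R]natr1 [t%:C ^+ m.+1]exprS rmorph1; ring.
have := cderivM (cderiv_cst (c / n.+1%:R) t) (X n); congr cderiv.
by field; rewrite addrC natr1 pnatr_eq0.
Qed.

(** A partial sum of -log (1 - t w), as a function of the real parameter t so that
    exp (logq) (1 - t w) can be compared at t = 0 and t = 1 by integrating its
    derivative. *)
Definition logq w N t : C := \sum_(n < N) w ^+ n.+1 / n.+1%:R * (t%:C) ^+ n.+1.

Lemma cderiv_sum N (F : nat -> R -> C) d t : (forall n, cderiv (F n) t (d n)) ->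
  cderiv (fun t => \sum_(n < N) F n t) t (\sum_(n < N) d n).
Proof.
move=> h; elim: N => [|N IH].
  by under eq_fun do rewrite big_ord0; rewrite big_ord0; exact: cderiv_cst.
under eq_fun do rewrite big_ord_recr/=.
by rewrite big_ord_recr/=; exact: cderivD.
Qed.

Lemma cderiv_logq w N t : cderiv (fun t => cexp (logq w N t) * (1 - t%:C * w)) t
  (- w * (t%:C * w) ^+ N * cexp (logq w N t)).
Proof.
have h1 := cderiv_cexp_comp (cderiv_sum N (fun n => cderiv_monomial (w ^+ n.+1) n t)).
have h2 : cderiv (fun t => 1 + t%:C * (- w)) t (- w).
  have := cderivD (cderiv_cst 1 t)
    (cderivM (cderiv_real (is_derive_id t (1 : R))) (cderiv_cst (- w) t)).
  by congr cderiv; rewrite mulr0 addr0 add0r mul1r.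
have := cderivM h1 h2; under eq_fun do rewrite mulrN.
congr cderiv; rewrite -/(logq w N t).
have geo : (\sum_(n < N) w ^+ n.+1 * t%:C ^+ n) * (1 - t%:C * w) =
    w * (1 - (t%:C * w) ^+ N).
  elim: N {h1} => [|N IH]; first by rewrite big_ord0 mul0r expr0 subrr mulr0.
  by rewrite big_ord_recr/= mulrDl IH !exprMn !exprS; ring.
rewrite mulrN mulrAC geo; ring.
Qed.

(** The Taylor coefficients of log (1 - mu z). *)
Definition logcoef (mu : C) n : C := if n is m.+1 then - (mu ^+ n / n%:R) else 0.

Lemma logqE (mu z : C) N : logq (mu * z) N 1 = - psum (logcoef mu) z N.+1.
Proof.
rewrite /psum big_ord_recl mul0r add0r /logq -sumrN; apply: eq_bigr => n _.
by rewrite /= /bump add1n expr1n mulr1 mulNr opprK exprMn mulrAC.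
Qed.

Lemma logcoef_bounded mu : nc mu <= 1 -> bounded_by 1 (logcoef mu).
Proof.
move=> m1 [|n]; first by rewrite /logcoef nc0.
rewrite /logcoef ncN ncM ncX ncV nc_nat -[leRHS]mulr1; apply: ler_pM.
- by rewrite exprn_ge0// nc_ge0.
- by rewrite invr_ge0 ler0n.
- by rewrite exprn_ile1// nc_ge0.
- by rewrite invf_le1 ?ltr0n// ler1n.
Qed.

Lemma l2_logcoef mu : nc mu <= 1 -> l2 (logcoef mu).
Proof.
move=> m1; exists 2 => N.
have h n : nc (logcoef mu n.+1) <= n.+1%:R^-1.
  rewrite /logcoef ncN ncM ncX ncV nc_nat ler_piMl ?invr_ge0 ?ler0n//.
  by rewrite exprn_ile1// nc_ge0.
apply: le_trans (l2_sumW (logcoef mu) (leq_trans (leqnSn N) (leqnSn _))) _.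
apply: (@le_trans _ _ (2 - N.+1%:R^-1)); last by rewrite gerBl invr_ge0 ler0n.
elim: N => [|N IH].
  rewrite !big_ord_recl big_ord0 [logcoef mu ord0]/= nc0 expr0n/= add0r addr0.
  have := h 0%N; have := nc_ge0 (logcoef mu 1); rewrite invr1 /lift /=.
  by move: (nc _) => x x0 x1; nra.
rewrite big_ord_recr/=; have := h N.+1; have := nc_ge0 (logcoef mu N.+2).
move: (nc (logcoef mu N.+2)) => x x0 hx.
apply: le_trans (lerD IH (lexx _)) _.
rewrite -[N.+2%:R]natr1 in hx *.
have : 0 < N.+1%:R :> R by rewrite ltr0n.
move: (N.+1%:R) hx => p hx p0.
have q0 : 0 < p + 1 by rewrite addr_gt0.
have x2 : x ^+ 2 <= (p + 1)^-1 ^+ 2.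
  by rewrite ler_sqr ?nnegrE// invr_ge0 ltW.
have : (p + 1)^-1 ^+ 2 <= p^-1 - (p + 1)^-1.
  rewrite -subr_ge0 (_ : _ - _ = p^-1 * (p + 1)^-1 ^+ 2); last first.
    by field; rewrite !gt_eqF.
  by rewrite mulr_ge0 ?exprn_ge0// invr_ge0 ltW.
lra.
Qed.

Lemma cexp_logcoef mu z : nc mu <= 1 -> nc z < 1 ->
  cexp (ps (logcoef mu) z) = 1 - mu * z.
Proof.
move=> m1 z1; set w := mu * z; have w1 : nc w < 1.
  by rewrite ncM (le_lt_trans _ z1)// ler_piMl// nc_ge0.
pose E N := cexp (logq w N 1) * (1 - w).
have w_ge0 := nc_ge0 w.
pose B := expR (1 / (1 - nc w)).
have E1 N : nc (1 - E N) <= 2 * B * nc w ^+ N.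
  have c0 : ccont (fun t => - w * (t%:C * w) ^+ N * cexp (logq w N t)).
    apply: ccontM; last first.
      have d t := cderiv_cexp_comp
        (cderiv_sum N (fun n => cderiv_monomial (w ^+ n.+1) n t)).
      exact: cderiv_cont d.
    have -> : (fun t => - w * (t%:C * w) ^+ N) =
        fun t => - w * w ^+ N * (t ^+ N)%:C.
      by apply/funext => t; rewrite exprMn rmorphXn/=; ring.
    apply: ccontM; first exact: ccont_cst.
    by apply: ccont_real; exact: exprn_continuous.
  have [c1 c2] := c0.
  have := cftc (ltr01 : (0 : R) < 1) (cderiv_logq w N) c1 c2.
  have -> : logq w N 0 = 0.
    by rewrite /logq big1// => i _; rewrite expr0n/= mulr0.
  rewrite cexp0 mul0r subr0 mulr1 mul1r -/(E N) => ftc.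
  rewrite nc_distC -ftc.
  pose J : set R := `[0, 1]%classic.
  have m01 : measurable (J : set (measurableTypeR R)).
    exact: measurable_itv.
  have leb1 : leb J = 1%:E.
    by rewrite /J lebesgue_measure_itv/= lte_fin ltr01 -EFinB subr0.
  have icst : rintble J (fun=> B * nc w ^+ N).
    apply: measurable_bounded_integrable; first exact: m01.
    - have h : (leb J < +oo)%E by rewrite leb1 ltry.
      exact: h.
    - exact: measurable_cst.
    - by exists `|B * nc w ^+ N|; split; [rewrite num_real|move=> y cy t _ /=; exact: ltW].
  have -> : 2 * B * nc w ^+ N = 2 * \int[leb]_(t in J) (B * nc w ^+ N).
    rewrite -mulrA; congr (_ * _).
    transitivity (B * nc w ^+ N * fine (leb J)).
      by rewrite leb1 mulr1.
    by apply/esym; exact: (Rintegral_cst _ m01).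
  apply: (nc_cint_le m01 _ icst); first exact: ccont_meas c0.
  move=> t; rewrite /J /= in_itv/= => /andP[t0 t1].
  have tn n : nc (t%:C) ^+ n <= 1 by rewrite ncR ger0_norm// exprn_ile1.
  rewrite ncM nc_cexp ncM ncN ncX ncM exprMn mulrC.
  have q0 : 0 <= nc w * (nc t%:C ^+ N * nc w ^+ N).
    by rewrite !mulr_ge0 ?exprn_ge0 ?nc_ge0.
  apply: ler_pM => //.
  - rewrite ler_expR; apply: le_trans (ler_norm _) _.
    apply: le_trans (Re_le_nc _) _; apply: le_trans (nc_sum _ _) _.
    apply: (@le_trans _ _ (\sum_(n < N) nc w ^+ n)).
      apply: ler_sum => n _; rewrite ncM ncM !ncX ncV nc_nat.
      have i0 : 0 <= n.+1%:R^-1 :> R by rewrite invr_ge0 ler0n.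
      have i1 : n.+1%:R^-1 <= 1 :> R by rewrite invf_le1 ?ltr0n// ler1n.
      have s0 : 0 <= nc t%:C ^+ n.+1 by rewrite exprn_ge0// nc_ge0.
      have X0 : 0 <= nc w ^+ n by rewrite exprn_ge0.
      have -> : nc w ^+ n.+1 / n.+1%:R * nc t%:C ^+ n.+1 =
          nc w ^+ n * (nc w * (n.+1%:R^-1 * nc t%:C ^+ n.+1)).
        by rewrite exprS; ring.
      apply: ler_piMr => //; apply: mulr_ile1 => //.
      - exact: mulr_ge0.
      - exact: ltW.
      - exact: mulr_ile1.
    have := @geometric_le_lim R N 1 (nc w) ler01.
    have [->|wn0] := eqVneq (nc w) 0.
      move=> _; rewrite subr0 divr1; case: (N) => [|m].
        by rewrite big_ord0.
      by rewrite big_ord_recl big1 ?expr0 ?addr0// => i _; rewrite expr0n.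
    rewrite lt_def wn0 w_ge0 (ger0_norm w_ge0) => /(_ isT w1).
    rewrite /series/= big_mkord -div1r; apply: le_trans.
    by rewrite le_eqVlt; apply/orP; left; apply/eqP; apply: eq_bigr => i _; rewrite mul1r.
  - rewrite mulrA; apply: ler_piMl; first by rewrite exprn_ge0.
    by apply: mulr_ile1 => //; rewrite ?exprn_ge0 ?nc_ge0// ltW.
have [K pK] : exists K : R, bounded_by K (logcoef mu).
  by exists 1; exact: logcoef_bounded.
have cvE : E @ \oo --> cexp (- ps (logcoef mu) z) * (1 - w).
  apply: cvgCM; last exact: cvg_cst.
  apply: cvgC_cexp; rewrite (_ : (fun n => logq w n 1) =
    fun n => (- 1) * psum (logcoef mu) z n.+1); last first.
    by apply/funext => n; rewrite /w logqE mulN1r.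
  have -> : - ps (logcoef mu) z = -1 * ps (logcoef mu) z by rewrite mulN1r.
  apply: cvgCM; first exact: cvg_cst.
  by have := ps_cvg pK z1; rewrite -cvg_shiftS.
have cvE1 : E @ \oo --> (1 : C).
  apply: (cvgC0 E1); rewrite -(mulr0 (2 * B)); apply: cvgM; first exact: cvg_cst.
  by apply: cvg_expr; rewrite ger0_norm.
have h1 : (1 : C) = cexp (- ps (logcoef mu) z) * (1 - w).
  exact: (@ccvg_unique R \oo _ E _ _ cvE1 cvE).
have := congr1 (fun v : C => cexp (ps (logcoef mu) z) * v) h1.
by rewrite cexpN mulr1 mulrA mulfV ?mul1r// cexp_neq0.
Qed.

(** The logarithm of the linear factor has square summable coefficients even when
    the factor has its zero on the circle. Its radial limits identify the real part
    of the boundary function, and the Schwarz formula for its partial sums passes to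
    the limit in mean. *)
Lemma schwarz_linear mu : nc mu <= 1 ->
  schwarz (fun z => 1 - mu * z) (fun t => ln (nc (1 - mu * cis t))) /\
  {ae leb, forall t, circ t -> 1 - mu * cis t != 0}.
Proof.
move=> m1; have ll := l2_logcoef m1.
have [g [sg cvg_g _ rad]] := fatou_radial ll.
have key : {ae leb, forall t, circ t -> expR (Re (g t)) = nc (1 - mu * cis t)}.
  apply: filterS rad => th h cth; have {}h := h cth.
  have cvR : Re (ps (logcoef mu) (r%:C * cis th)) @[r --> (1 : R)^'-] --> (Re (g th) : R).
    apply/cvgrPdist_lt => e e0; apply: filterS (h e e0) => r.
    by rewrite -cReB; apply: le_lt_trans; exact: Re_le_nc.
  have cvE : expR (Re (ps (logcoef mu) (r%:C * cis th))) @[r --> (1 : R)^'-]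
      --> (expR (Re (g th)) : R).
    by apply: (cvg_comp _ _ cvR); exact: continuous_expR.
  have cvN : expR (Re (ps (logcoef mu) (r%:C * cis th))) @[r --> (1 : R)^'-]
      --> (nc (1 - mu * cis th) : R).
    apply/cvgrPdist_lt => e e0.
    have r0 : \forall r \near (1 : R)^'-, 0 < r by apply: nbhs_left_gt.
    have r1 : \forall r \near (1 : R)^'-, r < 1 by exact: nbhs_left_lt.
    have r2 : \forall r \near (1 : R)^'-, 1 - e < r.
      by apply: nbhs_left_gt; rewrite ltrBlDr ltrDl.
    apply: filterS3 r0 r1 r2 => r r0 r1 r2.
    have ncr : nc (r%:C * cis th) = r by rewrite ncM ncR nc_cis mulr1 gtr0_norm.
    rewrite -nc_cexp cexp_logcoef ?ncr//.
    apply: le_lt_trans (ler_dist_nc _ _) _.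
    have -> : 1 - mu * cis th - (1 - mu * (r%:C * cis th)) =
        - (mu * (1 - r)%:C * cis th) by rewrite rmorphB/= rmorph1; ring.
    rewrite ncN ncM ncM nc_cis mulr1 ncR ger0_norm; last by rewrite subr_ge0 ltW.
    apply: (@le_lt_trans _ _ (1 - r)); last by lra.
    by rewrite ler_piMl// subr_ge0 ltW.
  exact: (cvg_unique _ cvE cvN).
split; last first.
  apply: filterS key => t h ct; rewrite -nc_gt0 -(h ct); exact: expR_gt0.
have mln : measurable_fun circ (fun t => ln (nc (1 - mu * cis t))).
  apply: measurableT_comp; first exact: measurable_ln.
  apply: cmeas_nc; apply: cmeasB; first exact: cmeas_cst.
  by apply: cmeasM; [exact: cmeas_cst|exact: cmeas_cis].
apply: (@schwarz_ae _ (fun t => Re (g t))) => //.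
  by apply: filterS key => t h /h <-; rewrite expRK.
have [hr _] := sq_circ_rintble sg.
apply: (schwarz_lim (fun N => schwarz_exp_psum (logcoef mu) N)) => //.
  move=> z z1; rewrite -cexp_logcoef//; apply: cvgC_cexp.
  by have := ps_cvg (logcoef_bounded m1) z1; rewrite -cvg_shiftS.
have sqs N : sq circ (fun t => g t - osum (@expo R) (logcoef mu) 0 N.+1 t).
  apply: (sqB (@mcirc R)) => //; apply: (sq_osum (@mcirc R)); exact: sq_expo.
have cv : (fun N => N2 circ (fun t => g t - osum (@expo R) (logcoef mu) 0 N.+1 t))
    @ \oo --> (0 : R).
  by move: cvg_g; rewrite -cvg_shiftS.
apply: le_cvg0 (cvg_Rint_nc sqs cv) => N; apply/andP; split.
  by apply: Rintegral_ge0 => t _; exact: normr_ge0.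
have [hN _] := schwarz_exp_psum (logcoef mu) N.
apply: Rint_le; first exact: mcirc.
- by apply: rintble_norm; apply: (rintbleB (@mcirc R)).
- by apply: (cintble_nc (@mcirc R)); exact: sq_circ_rintble.
- by move=> t _; rewrite osum_expo -cReB; exact: Re_le_nc.
Qed.

End LinearFactor.

(** * Zero-free polynomials and Cesaro means *)

Section OuterFunctions.
Variable R : realType.
Local Notation C := R[i].
Local Notation nc := (@Normc.normc R).
Local Notation cj := (@conjc R).
Local Notation Re := (@complex.Re R).
Local Notation Im := (@complex.Im R).
Local Notation leb := (@lebesgue_measure R).
Local Notation circ := (@circ R).
Local Open Scope complex_scope.
Implicit Types (t x y : R) (z w : C) (u v : R -> R) (a b : nat -> C).

(** A product of linear factors with zeros outside the closed disk. *)
Lemma schwarz_poly (p : {poly C}) : (forall z, nc z <= 1 -> p.[z] != 0) ->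
  schwarz (fun z => p.[z]) (fun t => ln (nc p.[cis t])).
Proof.
move=> p0; have [r pE] := closed_field_poly_normal p.
have c0 : lead_coef p != 0.
  rewrite lead_coef_eq0; apply/eqP => p_eq0.
  have /p0 : nc 0 <= 1 by rewrite nc0.
  by rewrite p_eq0 horner0 eqxx.
have r1 z : z \in r -> 1 < nc z.
  move=> zr; rewrite ltNge; apply/negP => /p0.
  by rewrite pE hornerZ horner_prod (big_rem z)//= hornerXsubC subrr mul0r mulr0 eqxx.
move: (lead_coef p) c0 pE => c c0 -> {p p0}.
elim: r r1 => [|x r IH] r1.
  apply: schwarz_ext (schwarz_cst c0) => [z z1|].
    by rewrite hornerZ big_nil hornerC mulr1.
  by apply/funext => t; rewrite hornerZ big_nil hornerC mulr1.
have {}IH := IH (fun z zr => r1 z (mem_behead (s := x :: r) zr)).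
have x1 : 1 < nc x by apply: r1; rewrite mem_head.
have x0 : x != 0 by rewrite -nc_gt0 (lt_trans _ x1).
have xV : nc x^-1 <= 1 by rewrite ncV invf_le1 ?ltW// (lt_trans _ x1).
have Nx0 : - x != 0 by rewrite oppr_eq0.
have [hl _] := schwarz_linear xV.
have split z : (c *: \prod_(y <- x :: r) ('X - y%:P)).[z] =
    (- x * (1 - x^-1 * z)) * (c *: \prod_(y <- r) ('X - y%:P)).[z].
  rewrite !hornerZ big_cons hornerM hornerXsubC.
  have -> : - x * (1 - x^-1 * z) = z - x by field.
  by rewrite mulrCA.
apply: schwarz_ext (schwarz_mul (schwarz_mul (schwarz_cst Nx0) hl) IH) => [z z1|].
  by rewrite split.
apply/funext => t; rewrite split.
have l0 : 0 < nc (1 - x^-1 * cis t).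
  have : nc (x^-1 * cis t) < 1.
    by rewrite ncM nc_cis mulr1 ncV invf_lt1// (lt_trans _ x1).
  by have := ler_nc_dist 1 (x^-1 * cis t); rewrite nc1; lra.
have q0 : 0 < nc (c *: \prod_(y <- r) ('X - y%:P)).[cis t].
  rewrite nc_gt0 hornerZ horner_prod mulf_neq0// prodf_seq_neq0.
  apply/allP => y yr; rewrite hornerXsubC/= subr_eq0; apply/eqP => e.
  by have := r1 y (mem_behead (s := x :: r) yr); rewrite -e nc_cis ltxx.
have nx0 : 0 < nc (- x) by rewrite nc_gt0.
by rewrite ncM ncM lnM ?posrE ?mulr_gt0// lnM ?posrE.
Qed.

(** Truncated subtraction makes these the coefficients of the Cesaro mean. *)
Definition fejer K b n : C := (K - n)%:R / K%:R * b n.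

(** A bound from below for the real part of the power series; it is imposed on the
    Cesaro means because these are polynomials, for which the bound makes sense on
    the closed disk. *)
Definition fejer_ge (c : R) b := forall K z, nc z <= 1 ->
  c <= Re (psum (fejer K.+1 b) z K.+1).

Lemma cvg_fejer b (g : R -> C) : l2 b -> sq circ g ->
  (fun N => N2 circ (fun t => g t - osum (@expo R) b 0 N t)) @ \oo --> (0 : R) ->
  (fun K => N2 circ (fun t => g t - osum (@expo R) (fejer K.+1 b) 0 K.+1 t))
    @ \oo --> (0 : R).
Proof.
move=> bl sg cvg_g; have [M bM] := bl; have [eps [eps0 eps_ge0 heps]] := l2_tail bl.
have M0 : 0 <= M by have := bM 0%N; rewrite big_ord0.
have sqo a N := sq_osum (@mcirc R) (@sq_expo R) a 0 N.
pose D K := \sum_(n < K.+1) nc (b n - fejer K.+1 b n) ^+ 2.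
have D_le K : N2 circ (fun t => osum (@expo R) b 0 K.+1 t
    - osum (@expo R) (fejer K.+1 b) 0 K.+1 t) = 2 * pi * D K.
  rewrite /D -(big_mkord xpredT (fun n => nc (b n - fejer K.+1 b n) ^+ 2)).
  rewrite -(parseval (@mcirc R) (@sq_expo R) (@orth_expo R) (fun n => b n - fejer K.+1 b n)).
  apply: eq_Rint => t _; congr (nc _ ^+ 2); rewrite /osum -sumrB.
  by apply: eq_bigr => i _; rewrite mulrBl.
have D_term K n : (n < K.+1)%N ->
    nc (b n - fejer K.+1 b n) ^+ 2 = (n%:R / K.+1%:R) ^+ 2 * nc (b n) ^+ 2.
  move=> nK; rewrite -exprMn; congr (_ ^+ 2).
  have -> : b n - fejer K.+1 b n = (n%:R / K.+1%:R) * b n.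
    rewrite /fejer natrB 1?ltnW//; field.
    by rewrite addrC natr1 pnatr_eq0.
  by rewrite ncM ncM ncV !nc_nat.
have cvD : D @ \oo --> (0 : R).
  apply/cvgrPdist_le => e e0.
  have e2 : 0 < e / 2 by rewrite divr_gt0.
  have /cvgrPdist_lt/(_ _ e2)[N _ hN] := eps0.
  have [k hk] : exists k, 2 * N%:R ^+ 2 * M / e < k%:R.
    exists (Num.bound (2 * N%:R ^+ 2 * M / e)); apply: archi_boundP.
    by rewrite divr_ge0 ?(ltW e0)// !mulr_ge0 ?sqr_ge0.
  exists (maxn N k) => // K /=; rewrite geq_max => /andP[NK kK].
  have D0 : 0 <= D K by apply: sumr_ge0 => n _; exact: sqr_ge0.
  rewrite sub0r normrN ger0_norm//.
  have KN : (N <= K.+1)%N by rewrite ltnW.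
  rewrite /D -(big_mkord xpredT (fun n => nc (b n - fejer K.+1 b n) ^+ 2)).
  rewrite (big_cat_nat (leq0n _) KN)/= (splitr e); apply: lerD; last first.
    apply: (@le_trans _ _ (\sum_(N <= n < K.+1) nc (b n) ^+ 2)).
      rewrite big_nat_cond [leRHS]big_nat_cond; apply: ler_sum => n.
      rewrite andbT => /andP[_ nK]; rewrite D_term//.
      rewrite ler_piMl ?sqr_ge0// expr_le1 ?divr_ge0 ?ler0n//.
      by rewrite ler_pdivrMr ?ltr0n// mul1r ler_nat ltnW.
    apply: le_trans (heps _ _) _; have := hN N (leqnn N).
    by rewrite /= sub0r normrN => /ltW; apply: le_trans; exact: ler_norm.
  have p0 : 0 < K.+1%:R :> R by rewrite ltr0n.
  apply: (@le_trans _ _ ((N%:R / K.+1%:R) ^+ 2 * M)).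
    apply: (@le_trans _ _ (\sum_(0 <= n < N) (N%:R / K.+1%:R) ^+ 2 * nc (b n) ^+ 2)).
      rewrite big_nat_cond [leRHS]big_nat_cond; apply: ler_sum => n.
      rewrite andbT => /andP[_ nN]; rewrite D_term; last exact: leq_trans nN KN.
      rewrite ler_wpM2r ?sqr_ge0// ler_sqr ?nnegrE ?divr_ge0 ?ler0n//.
      by rewrite ler_pM2r ?invr_gt0// ler_nat ltnW.
    by rewrite -mulr_sumr ler_wpM2l ?sqr_ge0// big_mkord.
  have kK1 : k%:R <= K.+1%:R :> R by rewrite ler_nat ltnW.
  have K1 : 1 <= K.+1%:R :> R by rewrite ler1n.
  move: hk; rewrite ltr_pdivrMr// exprMn exprVn.
  move: (N%:R ^+ 2) (sqr_ge0 (N%:R : R)) => q q0 hk.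
  rewrite mulrAC ler_pdivrMr ?exprn_gt0//.
  move: kK1 K1 hk p0; move: (K.+1%:R) (k%:R) => P k' kP P1 hk P0.
  have h1 : q * M <= e / 2 * P by nra.
  apply: le_trans h1 _; rewrite ler_pM2l//; nra.
apply: (@le_cvg0 _ _ (fun K => 2 * N2 circ (fun t => g t - osum (@expo R) b 0 K.+1 t)
    + 2 * (2 * pi * D K))).
  move=> K; rewrite N2_ge0/= -D_le.
  have := N2D_le (@mcirc R) (sqB (@mcirc R) sg (sqo b K.+1))
    (sqB (@mcirc R) (sqo b K.+1) (sqo (fejer K.+1 b) K.+1)).
  apply: le_trans; rewrite le_eqVlt; apply/orP; left; apply/eqP.
  by apply: eq_Rint => t _; rewrite addrA subrK.
rewrite -[X in _ --> X](_ : 2 * 0 + 2 * (2 * pi * 0) = 0); last by rewrite !mulr0 addr0.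
apply: cvgD; apply: cvgM; try exact: cvg_cst.
  by move: cvg_g; rewrite -cvg_shiftS.
by apply: cvgM => //; exact: cvg_cst.
Qed.

Lemma ln_dist (x y : R) : 1 <= x -> 1 <= y -> `|ln x - ln y| <= `|x - y|.
Proof.
wlog xy : x y / y <= x.
  move=> h x1 y1; have [/h/(_ x1 y1)//|/ltW/h/(_ y1 x1)] := leP y x.
  by rewrite distrC [`|y - x|]distrC.
move=> x1 y1; have y0 : 0 < y by rewrite (lt_le_trans _ y1).
have x0 : 0 < x by rewrite (lt_le_trans _ x1).
rewrite ger0_norm; last by rewrite subr_ge0 ler_ln.
rewrite ger0_norm; last by rewrite subr_ge0.
rewrite -ln_div ?posrE//.
have -> : x / y = 1 + (x / y - 1) by ring.
have d0 : 0 <= x / y - 1 by rewrite subr_ge0 ler_pdivlMr// mul1r.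
apply: le_trans (le_ln1Dx _) _; first by rewrite (lt_le_trans _ d0)// ltrN10.
have -> : x / y - 1 = (x - y) / y by field; rewrite gt_eqF.
by rewrite ler_pdivrMr// ler_peMr// subr_ge0.
Qed.

(** Multiplication by [lam - z] on the level of coefficients. *)
Definition linmul lam b n : C := lam * b n - mulz b n.

Lemma l2_mulz b : l2 b -> l2 (mulz b).
Proof.
move=> [M bM]; exists M => -[|N]; first by have := bM 0%N; rewrite !big_ord0.
rewrite big_ord_recl [mulz b ord0]/= nc0 expr0n add0r; exact: bM.
Qed.

Lemma l2_linmul lam b : l2 b -> l2 (linmul lam b).
Proof.
move=> bl; apply: l2D; first exact: l2Z.
by have := l2Z (-1) (l2_mulz bl); under eq_fun do rewrite mulN1r.
Qed.

Lemma ps_linmul lam b z : l2 b -> nc z < 1 ->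
  ps (linmul lam b) z = (lam - z) * ps b z.
Proof.
move=> bl z1; have [K K0 bK] := l2_bnd bl.
have mK := bounded_mulz bK.
have h1 : bounded_by (nc lam * K) (fun n => lam * b n).
  by move=> n; rewrite ncM ler_wpM2l// nc_ge0.
have h2 : bounded_by K (fun n => -1 * mulz b n) by move=> n; rewrite mulN1r ncN.
have -> : linmul lam b = fun n => lam * b n + (-1) * mulz b n.
  by apply/funext => n; rewrite mulN1r.
by rewrite (psD h1 h2 z1) (psZ _ bK z1) (psZ _ mK z1) (ps_mulz bK z1); ring.
Qed.

Lemma l2_linmuln lam n b : l2 b -> l2 (iter n (linmul lam) b).
Proof. by move=> bl; elim: n => //= n; exact: l2_linmul. Qed.

Lemma ps_linmuln lam n b z : l2 b -> nc z < 1 ->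
  ps (iter n (linmul lam) b) z = (lam - z) ^+ n * ps b z.
Proof.
move=> bl z1; elim: n => [|n IH]; first by rewrite mul1r.
by rewrite /= (ps_linmul _ (l2_linmuln _ _ bl) z1) IH exprS mulrA.
Qed.

Lemma Hardy2_ps a (G : C -> C) : l2 a -> (forall z, nc z < 1 -> G z = ps a z) ->
  Hardy2 G.
Proof.
move=> al hG; have [M aM] := al; have [K K0 aK] := l2_bnd al; exists a; split.
  apply: (@le_lt_trans _ _ M%:E); last exact: ltry.
  apply: lime_le; first by apply: is_cvg_nneseries => n _ _; rewrite lee_fin sqr_ge0.
  apply: nearW => N; rewrite sumEFin lee_fin big_mkord; exact: aM.
move=> z /diskE z1; rewrite hG//; have := ps_cvg aK z1.
rewrite (_ : psum a z = series (fun n => a n * z ^+ n))//.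
by apply/funext => N; rewrite /series/= big_mkord.
Qed.

End OuterFunctions.

(** * A criterion for outer functions *)

Section OuterCriterion.
Variable R : realType.
Local Notation C := R[i].
Local Notation nc := (@Normc.normc R).
Local Notation cj := (@conjc R).
Local Notation Re := (@complex.Re R).
Local Notation Im := (@complex.Im R).
Local Notation leb := (@lebesgue_measure R).
Local Notation circ := (@circ R).
Local Open Scope complex_scope.
Implicit Types (t x y : R) (z w : C) (u v : R -> R) (a b : nat -> C).

(** The density in the Schwarz formula only matters up to null sets. *)
Lemma outer_schwarz (G : C -> C) u : Hardy2 G -> schwarz G u ->
  {ae leb, forall t, circ t -> ln (nc (boundary G t)) = u t} -> outer G.
Proof.
move=> hG sG hu; split=> //.
  exists 0; first by apply/diskE; rewrite nc0.
  by apply: schwarz_neq0 sG _; rewrite nc0.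
have [_ [l l1 hl]] := sG; exists l; first by rewrite normrC l1.
move=> z /diskE z1; rewrite hl//; congr (_ * cexp (_ * _)).
have E : {ae leb, forall t, circ t -> hk z t * (u t)%:C =
    (cis t + z) / (cis t - z) * (ln (nc (boundary G t)))%:C}.
  by apply: filterS hu => t h /h ->.
rewrite /herg /cintegral; congr Complex; apply: Rint_ae_congr.
  by apply: filterS E => t h /h ->.
by apply: filterS E => t h /h ->.
Qed.

Lemma schwarz_pow (G : C -> C) u n : schwarz G u ->
  schwarz (fun z => G z ^+ n) (fun t => n%:R * u t).
Proof.
move=> sG; elim: n => [|n IH].
  have := schwarz_cst (oner_neq0 C); apply: schwarz_ext => //.
  by apply/funext => t; rewrite nc1 ln1 mul0r.
apply: schwarz_ext (schwarz_mul sG IH) => [z z1|]; first by rewrite exprS.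
by apply/funext => t; rewrite -[n.+1%:R]natr1; ring.
Qed.

Lemma cvg_left_radial (f : C -> C) (l : C) (th : R) :
  (forall e, 0 < e -> \forall r \near (1 : R)^'-, nc (l - f (r%:C * cis th)) < e) ->
  f (r%:C * cis th) @[r --> (1 : R)^'-] --> l.
Proof. by move=> h; apply/cvgC. Qed.

Lemma boundary_eq (f : C -> C) (l : C) (th : R) :
  f (r%:C * cis th) @[r --> (1 : R)^'-] --> l -> boundary f th = l.
Proof. by move=> h; apply: (cvg_lim (@chausdorff R)) h. Qed.

(** The Cesaro means of [b] are zero-free polynomials, for which the Schwarz
    formula holds; it passes to the limit because the logarithm is
    1-Lipschitz where the modulus is at least 1. *)
Theorem outer_fejer b (lam : C) n (G : C -> C) :
  l2 b -> fejer_ge 1 b -> 1 <= nc lam ->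
  (forall z, nc z < 1 -> G z = (lam - z) ^+ n * ps b z) -> outer G.
Proof.
move=> bl b1 l1 hG; have [K K0 bK] := l2_bnd bl.
have [g [sg cvg_g _ rad]] := fatou_radial bl.
have cvF := cvg_fejer bl sg cvg_g.
have sqo a N := sq_osum (@mcirc R) (@sq_expo R) a 0 N.
have cvz z : nc z < 1 -> (fun N => psum (fejer N.+1 b) z N.+1) @ \oo --> ps b z.
  move=> z1.
  have sP := sq_poisson z1.
  have cv := ip_limit (@mcirc R) sg (fun N => sqo (fejer N.+1 b) N.+1) sP cvF.
  have pi0 : (2 * pi)%:C != 0 :> C by rewrite (inj_eq (@complexI R)) gt_eqF// twopi_gt0.
  have cv2 : (fun N => (2 * pi)%:C * psum (fejer N.+1 b) z N.+1) @ \oo -->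
      (2 * pi)%:C * ps b z.
    apply: (cvgC0 _ cv) => N.
    by rewrite (poisson_integral bl sg cvg_g z1) ip_osum_poisson.
  have -> : (fun N => psum (fejer N.+1 b) z N.+1) = fun N =>
      ((2 * pi)%:C)^-1 * ((2 * pi)%:C * psum (fejer N.+1 b) z N.+1).
    by apply/funext => N; rewrite (mulKf pi0).
  rewrite -(mulKf pi0 (ps b z)).
  by apply: cvgCM; [exact: cvg_cst|exact: cv2].
have Re1 z : nc z < 1 -> 1 <= Re (ps b z).
  move=> z1.
  have cv : (fun N => Re (psum (fejer N.+1 b) z N.+1)) @ \oo --> (Re (ps b z) : R).
    by apply: cvgC_Re; exact: cvz.
  apply: (ler_cvg_to (cvg_cst (1 : R)) cv); apply: nearW => N; apply: b1; exact: ltW.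
have nc1' z : nc z < 1 -> 1 <= nc (ps b z).
  by move=> /Re1 h; exact: le_trans h (le_trans (ler_norm _) (Re_le_nc _)).
have g1 : {ae leb, forall t, circ t -> 1 <= nc (g t)}.
  apply: filterS rad => th h cth; have {}h := cvg_left_radial (h cth).
  have cv : nc (ps b (r%:C * cis th)) @[r --> (1 : R)^'-] --> (nc (g th) : R).
    apply/cvgrPdist_lt => e e0; move/cvgC : h => /(_ e e0); apply: filterS => r.
    by apply: le_lt_trans; exact: ler_dist_nc.
  apply: (ler_cvg_to (cvg_cst (1 : R)) cv).
  have r0 : \forall r \near (1 : R)^'-, 0 < r by apply: nbhs_left_gt.
  have r1 : \forall r \near (1 : R)^'-, r < 1 by exact: nbhs_left_lt.
  apply: filterS2 r0 r1 => r r0 r1; apply: nc1'.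
  by rewrite ncM ncR nc_cis mulr1 gtr0_norm.
(* The boundary modulus is at least 1 almost everywhere; truncation makes this
   hold everywhere. *)
pose u t := ln (Num.max 1 (nc (g t))).
have mg : measurable_fun circ (fun t => nc (g t)).
  by apply: cmeas_nc; have [] := sg.
have mu : measurable_fun circ u.
  apply: measurableT_comp; first exact: measurable_ln.
  by apply: measurable_maxr => //; exact: measurable_cst.
have max1 t : 1 <= Num.max 1 (nc (g t)) by rewrite le_max lexx.
have rg : rintble circ (fun t => nc (g t)).
  by apply: (cintble_nc (@mcirc R)); exact: sq_circ_rintble.
have ru : rintble circ u.
  apply: (rintble_le (@mcirc R) mu _ rg) => t _.
  have := ln_dist (max1 t) (lexx 1); rewrite ln1 subr0 => h.
  apply: le_trans h _; rewrite ger0_norm ?subr_ge0//.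
  by rewrite lerBlDr ge_max lerDr nc_ge0 lerDl ler01.
have sps : schwarz (ps b) u.
  have sp N : schwarz (fun z => psum (fejer N.+1 b) z N.+1)
      (fun t => ln (nc (psum (fejer N.+1 b) (cis t) N.+1))).
    have E z : (\poly_(i < N.+1) fejer N.+1 b i).[z] = psum (fejer N.+1 b) z N.+1.
      by rewrite horner_poly.
    apply: schwarz_ext (@schwarz_poly R (\poly_(i < N.+1) fejer N.+1 b i) _) => [z z1||].
    - by rewrite E.
    - by apply/funext => t; rewrite E.
    - move=> z z1; rewrite E; apply/eqP => e; have := b1 N z z1.
      by rewrite e /= ler10.
  apply: (schwarz_lim sp); [exact: ru|exact: cvz|].
  have sqs N : sq circ (fun t => g t - osum (@expo R) (fejer N.+1 b) 0 N.+1 t).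
    exact: (sqB (@mcirc R)).
  apply: le_cvg0 (cvg_Rint_nc sqs cvF) => N; apply/andP; split.
    by apply: Rintegral_ge0 => t _; exact: normr_ge0.
  apply: Rint_le; first exact: mcirc.
  - by apply: rintble_norm; apply: (rintbleB (@mcirc R)) => //; have [] := sp N.
  - by apply: (cintble_nc (@mcirc R)); exact: sq_circ_rintble.
  - move=> t _; rewrite osum_expo.
    have p1 : 1 <= nc (psum (fejer N.+1 b) (cis t) N.+1).
      have h : nc (cis t) <= 1 by rewrite nc_cis.
      exact: le_trans (b1 N _ h) (le_trans (ler_norm _) (Re_le_nc _)).
    apply: le_trans (ln_dist (max1 t) p1) _.
    apply: le_trans (ler_dist_nc _ _).
    rewrite /Num.max; case: ifPn => [//|]; rewrite -leNgt => h.
    by rewrite !ler0_norm ?subr_le0// ?(le_trans h)// lerN2 lerD2r.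
have lam0 : lam != 0 by rewrite -nc_gt0 (lt_le_trans ltr01).
have lamV : nc lam^-1 <= 1 by rewrite ncV invf_le1 ?(lt_le_trans ltr01).
have [sl nz] := schwarz_linear lamV.
pose v t := ln (nc lam) + ln (nc (1 - lam^-1 * cis t)).
have sv : schwarz (fun z => lam - z) v.
  apply: schwarz_ext (schwarz_mul (schwarz_cst lam0) sl) => // z z1.
  by field.
have sG : schwarz G (fun t => n%:R * v t + u t).
  apply: schwarz_ext (schwarz_mul (schwarz_pow n sv) sps) => // z z1.
  by rewrite hG.
apply: (outer_schwarz _ sG).
  apply: (Hardy2_ps (l2_linmuln lam n bl)) => z z1.
  by rewrite ps_linmuln// hG.
apply: filterS3 rad g1 nz => th hr hg hn cth.
have {}hr := cvg_left_radial (hr cth); have {}hg := hg cth; have {}hn := hn cth.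
have hlin : (lam - r%:C * cis th) @[r --> (1 : R)^'-] --> lam - cis th.
  apply/cvgC => e e0.
  have r1 : \forall r \near (1 : R)^'-, r < 1 by exact: nbhs_left_lt.
  have r2 : \forall r \near (1 : R)^'-, 1 - e < r.
    by apply: nbhs_left_gt; rewrite ltrBlDr ltrDl.
  apply: filterS2 r1 r2 => r r1 r2.
  have -> : lam - cis th - (lam - r%:C * cis th) = - ((1 - r)%:C * cis th).
    by rewrite rmorphB/= rmorph1; ring.
  rewrite ncN ncM nc_cis mulr1 ncR ger0_norm; first by lra.
  by rewrite subr_ge0 ltW.
have hpow m : ((lam - r%:C * cis th) ^+ m) @[r --> (1 : R)^'-] --> (lam - cis th) ^+ m.
  elim: m => [|m IH]; first exact: cvg_cst.
  under eq_fun do rewrite exprS; rewrite exprS.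
  by apply: cvgCM; [exact: hlin|exact: IH].
have hGb : G (r%:C * cis th) @[r --> (1 : R)^'-] --> (lam - cis th) ^+ n * g th.
  have hprod : ((lam - r%:C * cis th) ^+ n * ps b (r%:C * cis th))
      @[r --> (1 : R)^'-] --> (lam - cis th) ^+ n * g th.
    by apply: cvgCM; [exact: hpow|exact: hr].
  apply/cvgC => e e0; move/cvgC : hprod => /(_ e e0).
  have r0 : \forall r \near (1 : R)^'-, 0 < r by apply: nbhs_left_gt.
  have r1 : \forall r \near (1 : R)^'-, r < 1 by exact: nbhs_left_lt.
  apply: filterS3 r0 r1 => r r0 r1; rewrite hG//.
  by rewrite ncM ncR nc_cis mulr1 gtr0_norm.
rewrite (boundary_eq hGb) ncM ncX.
have lin : lam - cis th = lam * (1 - lam^-1 * cis th) by field.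
have n1 : 0 < nc lam by rewrite nc_gt0.
have n2 : 0 < nc (1 - lam^-1 * cis th) by rewrite nc_gt0.
have n3 : 0 < nc (g th) by exact: lt_le_trans hg.
rewrite lin ncM lnM ?posrE ?exprn_gt0 ?mulr_gt0// lnXn ?mulr_gt0//.
rewrite lnM ?posrE// /v; congr (_ + _); first by rewrite mulr_natl.
rewrite /u /Num.max; case: ifPn => //; rewrite -leNgt => h.
by congr ln; apply/eqP; rewrite eq_le h hg.
Qed.

End OuterCriterion.

(** * Decomposition by the sign of the real part *)

Section PositiveRealPart.
Variable R : realType.
Local Notation C := R[i].
Local Notation nc := (@Normc.normc R).
Local Notation cj := (@conjc R).
Local Notation Re := (@complex.Re R).
Local Notation Im := (@complex.Im R).
Local Notation leb := (@lebesgue_measure R).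
Local Notation circ := (@circ R).
Local Open Scope complex_scope.
Implicit Types (t x y : R) (z w : C) (u v : R -> R) (a b : nat -> C).

(** The Taylor coefficients of the Herglotz kernel (1 + z) / (1 - z). *)
Definition hcoef n : C := if n == 0%N then 1 else 2.

Definition geom w m : C := \sum_(i < m.+1) w ^+ i.

(** Induction on K turns the Cesaro mean of the Herglotz kernel into a combination
    of squares, which shows that its real part is nonnegative on the closed disk. *)
Lemma fejer_kernel_sum K w :
  Re (\sum_(n < K.+1) (K.+1 - n)%:R * hcoef n * w ^+ n) =
  nc (geom w K) ^+ 2 + (1 - nc w ^+ 2) * \sum_(k < K) nc (geom w k) ^+ 2.
Proof.
have geomS m : geom w m.+1 = 1 + w * geom w m.
  rewrite /geom big_ord_recl expr0 mulr_sumr; congr (_ + _).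
  by apply: eq_bigr => i _; rewrite -exprS.
have hsum m : \sum_(n < m.+1) hcoef n * w ^+ n = 2 * geom w m - 1.
  elim: m => [|m IH]; first by rewrite /geom !big_ord1 /hcoef /= expr0; ring.
  rewrite big_ord_recr/= IH /geom [in RHS]big_ord_recr/= /hcoef/=; ring.
elim: K => [|K IH].
  rewrite big_ord1 big_ord0 mulr0 addr0 /geom big_ord1 !expr0 nc1 expr1n.
  by rewrite mulr1 /hcoef eqxx mulr1 subn0.
have -> : \sum_(n < K.+2) (K.+2 - n)%:R * hcoef n * w ^+ n =
    \sum_(n < K.+1) (K.+1 - n)%:R * hcoef n * w ^+ n +
    \sum_(n < K.+2) hcoef n * w ^+ n.
  rewrite big_ord_recr/= [X in _ = _ + X]big_ord_recr/= addrA -big_split/=.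
  congr (_ + _); last by rewrite subSnn mul1r.
  apply: eq_bigr => i _; rewrite subSn; last by rewrite ltnW.
  by rewrite -natr1; ring.
rewrite cReD IH hsum big_ord_recr/= geomS.
have -> : Re (2 * (1 + w * geom w K) - 1) = 1 + 2 * Re (w * geom w K).
  have -> : 2 * (1 + w * geom w K) - 1 = 1 + 2%:R%:C * (w * geom w K).
    by rewrite rmorph_nat; ring.
  by rewrite cReD cReZ.
have -> : nc (1 + w * geom w K) ^+ 2 =
    1 + 2 * Re (w * geom w K) + nc w ^+ 2 * nc (geom w K) ^+ 2.
  rewrite addrC nc2D rmorph1 mulr1 nc1 ncM exprMn; ring.
ring.
Qed.

Lemma fejer_kernel_ge0 K w : nc w <= 1 ->
  0 <= Re (psum (fejer K.+1 hcoef) w K.+1).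
Proof.
move=> w1; have -> : psum (fejer K.+1 hcoef) w K.+1 =
    (K.+1%:R^-1)%:C * \sum_(n < K.+1) (K.+1 - n)%:R * hcoef n * w ^+ n.
  rewrite /psum mulr_sumr; apply: eq_bigr => n _.
  by rewrite /fejer fmorphV rmorph_nat; ring.
rewrite cReZ fejer_kernel_sum mulr_ge0 ?invr_ge0 ?ler0n//.
rewrite addr_ge0 ?sqr_ge0// mulr_ge0 ?subr_ge0 ?expr_le1 ?nc_ge0//.
by apply: sumr_ge0 => *; exact: sqr_ge0.
Qed.

Section Coefficients.
Variable u : R -> R.
Hypotheses (u0 : forall t, 0 <= u t) (su : sq circ (fun t => (u t)%:C)).

(** The Taylor coefficients of the Herglotz integral of [u], divided by 2 pi. *)
Definition herglotz_coef n : C :=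
  hcoef n * ocoef circ (@expo R) (2 * pi) (fun t => (u t)%:C) n.

Lemma l2_herglotz : l2 herglotz_coef.
Proof.
have := l2Z 2 (bessel (@mcirc R) (@twopi_gt0 R) (@sq_expo R) (@orth_expo R) su).
move=> [M hM]; exists M => N; apply: le_trans (hM N); apply: ler_sum => n _.
rewrite ler_sqr ?nnegrE ?nc_ge0// /herglotz_coef ncM [leRHS]ncM.
apply: ler_wpM2r; first exact: nc_ge0.
by rewrite /hcoef; case: (nat_of_ord n == 0%N); rewrite ?lexx// nc1 (nc_nat R 2) ler1n.
Qed.

(** The Cesaro mean of the series is the integral of [u] against the Cesaro mean of
    the Herglotz kernel. *)
Lemma fejer_ge_herglotz : fejer_ge 0 herglotz_coef.
Proof.
move=> K z z1.
have pi0 : (2 * pi)%:C != 0 :> C by rewrite (inj_eq (@complexI R)) gt_eqF// twopi_gt0.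
pose F t := psum (fejer K.+1 hcoef) (z * cj (cis t)) K.+1.
have E : psum (fejer K.+1 herglotz_coef) z K.+1 =
    ((2 * pi)^-1)%:C * cintegral circ (fun t => (u t)%:C * F t).
  have -> : cintegral circ (fun t => (u t)%:C * F t) =
      cintegral circ (fun t => \sum_(n < K.+1)
        fejer K.+1 hcoef n * z ^+ n * ((u t)%:C * cj (expo n t))).
    apply: eq_cint => t _; rewrite /F /psum mulr_sumr; apply: eq_bigr => n _.
    by rewrite exprMn /expo rmorphXn; ring.
  have hi n : cintble circ (fun t => fejer K.+1 hcoef n * z ^+ n *
      ((u t)%:C * cj (expo n t))).
    apply: (cintbleZ (@mcirc R)); apply: (ip_cintble (@mcirc R)) => //.
    exact: sq_expo.
  rewrite (cint_sum (@mcirc R) _ (fun n : 'I_K.+1 => hi n)) /psum mulr_sumr.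
  apply: eq_bigr => n _; rewrite (cintZ (@mcirc R)).
    by rewrite /fejer /herglotz_coef /ocoef /ip fmorphV; ring.
  by apply: (ip_cintble (@mcirc R)) => //; exact: sq_expo.
rewrite E cReZ mulr_ge0 ?invr_ge0 ?(ltW (@twopi_gt0 R))//.
apply: Rintegral_ge0 => t _; rewrite cReZ mulr_ge0// fejer_kernel_ge0//.
by rewrite ncM nc_conj nc_cis mulr1.
Qed.

End Coefficients.

(** The boundary function has no Fourier coefficients of negative index. *)
Lemma ip_cj_expo a (g : R -> C) n : sq circ g ->
  (fun N => N2 circ (fun t => g t - osum (@expo R) a 0 N t)) @ \oo --> (0 : R) ->
  ip circ g (fun t => cj (expo n t)) = if n == 0%N then (2 * pi)%:C * a 0%N else 0.
Proof.
move=> sg cvg_g; have se := sqJ (@sq_expo R n).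
have sqo N := sq_osum (@mcirc R) (@sq_expo R) a 0 N.
have cv := ip_limit (@mcirc R) sg sqo se cvg_g.
have val N : ip circ (osum (@expo R) a 0 N.+1) (fun t => cj (expo n t)) =
    if n == 0%N then (2 * pi)%:C * a 0%N else 0.
  rewrite /osum ip_suml; [|exact: mcirc| |exact: se]; last first.
    by move=> i; apply: sqZ; [exact: mcirc|exact: sq_expo].
  have term i : ip circ (fun t => a i * expo i t) (fun t => cj (expo n t)) =
      a i * (if (i + n)%N == 0%N then (2 * pi)%:C else 0).
    rewrite ipZl; [|exact: mcirc|exact: sq_expo|exact: se].
    rewrite -cint_expo; congr (_ * _); apply: eq_cint => t _.
    by rewrite cJK /expo exprD.
  rewrite big_nat_recl// term add0n big1 ?addr0; last first.
    by move=> i _; rewrite term addSn/= mulr0.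
  by case: ifP => _; rewrite ?mulr0// mulrC.
have E : (fun N => nc (ip circ g (fun t => cj (expo n t)) -
    ip circ (osum (@expo R) a 0 N.+1) (fun t => cj (expo n t)))) @ \oo --> (0 : R).
  by move: cv; rewrite -cvg_shiftS.
apply/eqP; rewrite -subr_eq0 -nc_eq0; apply/eqP.
apply: (cvg_unique (@Rhausdorff R) _ E).
by apply: cvg_near_cst; apply: nearW => N; rewrite val.
Qed.

(** Every Hardy function is, up to an imaginary constant, a difference of two
    Hardy functions with nonnegative real part: split the real part of the
    boundary function into its positive and negative parts. *)
Theorem hardy_decomposition a : l2 a -> exists p q (c : C),
  [/\ l2 p, l2 q, fejer_ge 0 p, fejer_ge 0 q &
      Re c = 0 /\ forall n, a n = p n - q n + (if n == 0%N then c else 0)].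
Proof.
move=> al; have [g [sg cvg_g coef_g _]] := fatou_radial al.
have pi0 : (2 * pi)%:C != 0 :> C by rewrite (inj_eq (@complexI R)) gt_eqF// twopi_gt0.
have half : 2^-1 = (2^-1)%:C :> C by rewrite fmorphV rmorph_nat.
pose up t := Num.max (Re (g t)) 0; pose un t := Num.max (- Re (g t)) 0.
have mre : measurable_fun circ (fun t => Re (g t)) by have [[]] := sg.
have up0 t : 0 <= up t by rewrite le_max lexx orbT.
have un0 t : 0 <= un t by rewrite le_max lexx orbT.
have up_un t : Re (g t) = up t - un t.
  rewrite /up /un; case: (lerP (Re (g t)) 0) => h.
    by rewrite max_l ?oppr_ge0// sub0r opprK.
  by rewrite max_r ?subr0// oppr_le0 ltW.
have nle (v : R -> R) : measurable_fun circ v -> (forall t, `|v t| <= `|Re (g t)|) ->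
    sq circ (fun t => (v t)%:C).
  move=> mv hv; have [_ g2] := sg; split; first exact: cmeas_real.
  apply: (rintble_ge0_le (@mcirc R) _ _ g2); first exact: cmeas_nc2 (cmeas_real mv).
  move=> t; rewrite sqr_ge0 ncR ler_sqr ?nnegrE ?nc_ge0//.
  exact: le_trans (hv t) (Re_le_nc _).
have sup : sq circ (fun t => (up t)%:C).
  apply: nle; first by apply: measurable_maxr => //; exact: measurable_cst.
  move=> t; rewrite ger0_norm// /up; case: (lerP (Re (g t)) 0) => h //.
  exact: ler_norm.
have sun : sq circ (fun t => (un t)%:C).
  apply: nle.
    by apply: measurable_maxr; [exact: measurable_funN|exact: measurable_cst].
  move=> t; rewrite ger0_norm// /un; case: (lerP (- Re (g t)) 0) => h //.
  by rewrite -normrN ler_norm.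
exists (herglotz_coef up), (herglotz_coef un), ('i * (Im (a 0%N))%:C).
split; [exact: l2_herglotz|exact: l2_herglotz|exact: fejer_ge_herglotz|
  exact: fejer_ge_herglotz|split].
  by rewrite cReM /= mul0r mulr0 subr0.
move=> n; have se := @sq_expo R n; have sgJ := sqJ sg.
have key : ip circ (fun t => (up t)%:C) (expo n) - ip circ (fun t => (un t)%:C) (expo n)
    = (2 * pi)%:C * (2^-1 * (a n + (if n == 0%N then cj (a 0%N) else 0))).
  rewrite -ipBl; [|exact: mcirc|exact: sup|exact: sun|exact: se].
  have -> : ip circ (fun t => (up t)%:C - (un t)%:C) (expo n) =
      ip circ (fun t => 2^-1 * (g t + cj (g t))) (expo n).
    apply: eq_cint => t _; congr (_ * _); rewrite -rmorphB -up_un half.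
    by apply: Ceq; rewrite ?cReZ ?cImZ ?cReD ?cImD ?cReJ ?cImJ /=; field.
  rewrite (ipZl (@mcirc R) 2^-1 (sqD (@mcirc R) sg sgJ) se).
  rewrite (ipDl (@mcirc R) sg sgJ se).
  rewrite coef_g.
  have -> : ip circ (fun t => cj (g t)) (expo n) =
      cj (ip circ g (fun t => cj (expo n t))).
    rewrite -(cintJ (@mcirc R) (ip_cintble (@mcirc R) sg (sqJ se))).
    by apply: eq_cint => t _; rewrite cJM cJK.
  rewrite (ip_cj_expo n sg cvg_g); case: ifP => _; last by rewrite rmorph0; ring.
  by rewrite cJM cJR; ring.
have -> : herglotz_coef up n - herglotz_coef un n =
    hcoef n * (2^-1 * (a n + (if n == 0%N then cj (a 0%N) else 0))).
  rewrite /herglotz_coef -mulrBr /ocoef -mulrBl key; congr (_ * _).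
  by rewrite mulrAC mulfV// mul1r.
rewrite /hcoef; case: eqVneq => [->|n0]; last by rewrite !addr0; field.
by rewrite mul1r half; apply: Ceq; rewrite ?cReD ?cImD ?cReZ ?cImZ ?cReM ?cImM
  ?cReD ?cImD ?cReJ ?cImJ /=; field.
Qed.

End PositiveRealPart.

(** * Integrals over the half line *)

Section HalfLine.
Variable R : realType.
Local Notation C := R[i].
Local Notation nc := (@Normc.normc R).
Local Notation cj := (@conjc R).
Local Notation Re := (@complex.Re R).
Local Notation Im := (@complex.Im R).
Local Notation leb := (@lebesgue_measure R).
Local Notation half := (@Rplus R).
Local Open Scope complex_scope.
Implicit Types (t x y : R) (z w s : C) (u v : R -> R) (a b : nat -> C).

Lemma mhalf : measurable (half : set (measurableTypeR R)).
Proof. exact: measurable_Rplus. Qed.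

Lemma expR_scaled_cvg0 (c k : R) : 0 < c ->
  (fun N : nat => k * expR (- (N%:R * c))) @ \oo --> (0 : R).
Proof.
move=> c0; rewrite -[X in _ --> X](mulr0 k); apply: cvgM; first exact: cvg_cst.
have -> : (fun N : nat => expR (- (N%:R * c))) = fun N => expR (- c) ^+ N.
  by apply/funext => N; rewrite -expRM_natl mulrN.
by apply: cvg_expr; rewrite ger0_norm ?expR_ge0// expR_lt1 oppr_lt0.
Qed.

Lemma rintble_expR (c : R) : 0 < c ->
  rintble half (fun t => expR (- (t * c))) /\
  \int[leb]_(t in half) expR (- (t * c)) = c^-1.
Proof.
move=> c0; have c0' : c != 0 by rewrite gt_eqF.
have dF t : is_derive t (1 : R) (fun t => - c^-1 * expR (- (t * c)))
    (expR (- (t * c))).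
  have h := @rderiv_lin R (- c) expR t _ (is_derive_expR _).
  have -> : (fun t => - c^-1 * expR (- (t * c))) =
      (fun t => - c^-1 * expR (- c * t)).
    by apply/funext => x; congr (_ * expR _); ring.
  have hc : is_derive t (1 : R) (fun=> - c^-1) 0 by exact: is_derive_cst.
  apply: is_derive_eq (rderivM hc h) _.
  rewrite mul0r add0r (_ : - c * t = - (t * c)); last by ring.
  by field.
have cF : continuous (fun t => - c^-1 * expR (- (t * c))).
  by move=> t; apply: differentiable_continuous; apply/derivable1_diffP; case: (dF t).
have cf : continuous (fun t => expR (- (t * c)) : R).
  have -> : (fun t => expR (- (t * c))) = expR \o (fun t => - (t * c)) by [].
  move=> t; apply: continuous_comp; last exact: continuous_expR.
  by apply: continuousN; apply: continuousM; [exact: cvg_id|exact: cvg_cst].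
have lim0 : (fun t => - c^-1 * expR (- (t * c))) t @[t --> +oo%R] --> (0 : R).
  rewrite -[X in _ --> X](mulr0 (- c^-1)); apply: cvgM; first exact: cvg_cst.
  apply: (@cvg_comp _ _ _ (fun t => t * c) (fun x => expR (- x)) _ (+oo%R)).
    by apply: gt0_cvgMly; [exact: c0|exact: cvg_id].
  exact: cvgr_expR.
have E : (\int[leb]_(t in half) (expR (- (t * c)))%:E = (c^-1)%:E)%E.
  rewrite /Rplus (@ge0_continuous_FTC2y R _ (fun t => - c^-1 * expR (- (t * c))) 0 0).
  - by rewrite mul0r oppr0 expR0 mulr1 sub0e -EFinN opprK.
  - by move=> x _; exact: expR_ge0.
  - exact: continuous_subspaceT.
  - exact: lim0.
  - by move=> x _; case: (dF x).
  - by apply: cvg_at_right_filter; exact: cF.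
  - by move=> x _; rewrite derive1E; case: (dF x).
split; last by rewrite /Rintegral E.
apply/integrableP; split.
  apply/measurable_EFinP; apply: measurable_funTS.
  exact: continuous_measurable_fun.
under eq_integral do rewrite abse_EFin (ger0_norm (expR_ge0 _)).
by rewrite E ltry.
Qed.

(** Half of the exponential decay pays for the polynomial factor. *)
Lemma monomial_decay (c : R) k t : 0 < c -> 0 <= t ->
  t ^+ k / k`!%:R * expR (- (t * c)) <= (2 / c) ^+ k * expR (- (t * (c / 2))).
Proof.
move=> c0 t0; have c2 : 0 < c / 2 by rewrite divr_gt0.
have -> : expR (- (t * c)) = expR (- (t * (c / 2))) * expR (- (t * (c / 2))).
  by rewrite -expRD; congr expR; field.
rewrite mulrA ler_wpM2r ?expR_ge0//.
rewrite expRN ler_pdivrMr ?expR_gt0//.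
have -> : t ^+ k / k`!%:R = (2 / c) ^+ k * ((t * (c / 2)) ^+ k / k`!%:R).
  by rewrite [RHS]mulrA -[in RHS]exprMn; congr (_ ^+ _ / _); field; rewrite lt0r_neq0.
apply: ler_wpM2l; first by rewrite exprn_ge0// divr_ge0// ltW.
have tc : 0 <= t * (c / 2) by rewrite mulr_ge0// ltW.
case: k => [|k]; first by rewrite expr0 fact0 divr1 -[X in X <= _]expR0 ler_expR.
by apply: le_trans (expR_ge1Dxn k tc); rewrite lerDr.
Qed.

(** The factor 1 / k! makes products of these functions produce binomial
    coefficients, and differentiation lower the index. *)
Definition monexp k s t : C := (t ^+ k / k`!%:R)%:C * cexp (- (t%:C * s)).

Lemma nc_monexp k s t : 0 <= t ->
  nc (monexp k s t) = t ^+ k / k`!%:R * expR (- (t * Re s)).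
Proof.
move=> t0; rewrite /monexp ncM nc_cexp ncR ger0_norm ?divr_ge0 ?exprn_ge0//.
by rewrite cReN cReZ.
Qed.

Lemma nc_monexp_le k s t : 0 < Re s -> 0 <= t ->
  nc (monexp k s t) <= (2 / Re s) ^+ k * expR (- (t * (Re s / 2))).
Proof. by move=> s0 t0; rewrite nc_monexp// monomial_decay. Qed.

Lemma ccont_monexp k s : ccont (monexp k s).
Proof.
apply: ccontM.
  apply: ccont_real => t; apply: cvgM; last exact: cvg_cst.
  exact: exprn_continuous.
have -> : (fun t => cexp (- (t%:C * s))) = (fun t => cexp (t%:C * - s)).
  by apply/funext => t; rewrite mulrN.
exact: ccont_cexp.
Qed.

Lemma half_ge0 t : half t -> 0 <= t.
Proof. by rewrite /Rplus /= in_itv/= andbT. Qed.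

Lemma cintble_monexp k s : 0 < Re s -> cintble half (monexp k s).
Proof.
move=> s0; have s2 : 0 < Re s / 2 by rewrite divr_gt0.
have [he _] := rintble_expR s2.
apply: (cintble_le mhalf (ccont_meas half (ccont_monexp k s))
  (rintbleZ mhalf ((2 / Re s) ^+ k) he)).
by move=> t /half_ge0 t0; exact: nc_monexp_le.
Qed.

Lemma Rint_dominated (D : set R) (f : nat -> R -> R) u v :
  measurable (D : set (measurableTypeR R)) ->
  (forall n, measurable_fun D (f n)) -> measurable_fun D u ->
  {ae leb, forall t, D t -> f ^~ t @ \oo --> u t} -> rintble D v ->
  (forall n t, D t -> `|f n t| <= v t) ->
  (fun n => \int[leb]_(t in D) f n t) @ \oo --> (\int[leb]_(t in D) u t : R).
Proof.
move=> mD mf mu cv vi fv.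
have [] := @dominated_convergence _ _ R leb D mD
  (fun n t => (f n t)%:E) (fun t => (u t)%:E) (fun t => (v t)%:E).
- by move=> N; apply/measurable_EFinP; exact: mf.
- by apply/measurable_EFinP; exact: mu.
- by apply: filterS cv => t h /h ht; apply: cvg_EFin; [exact: nearW|exact: ht].
- exact: vi.
- by apply: aeW => t N Dt; rewrite abse_EFin lee_fin fv.
move=> ui _ h; apply: fine_cvg; rewrite fineK; last exact: (integrable_fin_num mD ui).
exact: h.
Qed.

(** The fundamental theorem of calculus on [0, N] and dominated convergence as N grows. *)
Lemma cint_halfline (F f : R -> C) (L : C) : cintble half f -> ccont f ->
  (forall t, cderiv F t (f t)) ->
  (fun N : nat => nc (L - F N%:R)) @ \oo --> (0 : R) ->
  cintegral half f = L - F 0.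
Proof.
move=> fi cf dF FL.
pose part (u : R -> R) (N : nat) := \int[leb]_(t in half) (u t * \1_`[0, N%:R]%classic t).
have part_cvg (u : R -> R) : rintble half u ->
    part u @ \oo --> (\int[leb]_(t in half) u t : R).
  move=> ui; have um := rintble_meas ui.
  apply: (Rint_dominated mhalf _ um _ (rintble_norm ui)).
  - by move=> N; apply: measurable_funM => //; exact: measurable_indic.
  - apply: aeW => t /half_ge0 t0; apply: cvg_near_cst.
    exists `|Num.ceil t|%N => // N /= hN; rewrite indicE mem_set ?mulr1//=.
    rewrite in_itv/= t0/=; apply: le_trans (ceil_ge t) _.
    rewrite -(ler_nat R) in hN; apply: le_trans hN.
    by rewrite natr_absz; rewrite ler_int ler_norm.
  - move=> N t _; rewrite normrM indicE.
    by case: (_ \in _); rewrite /= ?normr1 ?mulr1// normr0 mulr0.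
have partE (u : R -> R) N : part u N = \int[leb]_(t in `[0, N%:R]) u t.
  rewrite /part /Rintegral; congr fine.
  rewrite [RHS]integral_mkcond [LHS]integral_mkcond; apply: eq_integral => t _.
  rewrite !patchE indicE /Rplus; case: ifP => h1; case: ifP => h2.
  - by rewrite mulr1.
  - by rewrite mulr0.
  - by exfalso; move: h1 h2; rewrite !mem_setE !in_itv/= andbT; lra.
  - by [].
have [fr fim] := fi.
have cv : (fun N : nat => cintegral `[0, N%:R] f) @ \oo --> cintegral half f.
  apply: cvgC_ReIm.
  - have := part_cvg _ fr; apply: cvg_trans; apply: near_eq_cvg; apply: nearW => N.
    by rewrite partE.
  - have := part_cvg _ fim; apply: cvg_trans; apply: near_eq_cvg; apply: nearW => N.
    by rewrite partE.
rewrite -(cvg_shiftS) in cv.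
have cv2 : (fun N : nat => cintegral `[0, N.+1%:R] f) @ \oo --> L - F 0.
  apply: (@cvgC0 R _ _ (fun N : nat => nc (L - F N.+1%:R))); last first.
    by move: FL; rewrite -cvg_shiftS.
  move=> N; rewrite (@cftc R 0 N.+1%:R F f (ltr0Sn R N) dF cf.1 cf.2).
  by rewrite (_ : _ - _ = L - F N.+1%:R); [exact: lexx|ring].
exact: (@ccvg_unique R \oo _ _ _ _ cv cv2).
Qed.

Lemma cderiv_cexpN s t : cderiv (fun t => cexp (- (t%:C * s))) t
  (- s * cexp (- (t%:C * s))).
Proof.
have := cderiv_cexp (- s) t.
have -> : (fun t : R => cexp (t%:C * - s)) = (fun t => cexp (- (t%:C * s))).
  by apply/funext => x; rewrite mulrN.
by rewrite mulrN.
Qed.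

Lemma cderiv_monexp k s t :
  cderiv (monexp k.+1 s) t (monexp k s t - s * monexp k.+1 s t).
Proof.
have dm : cderiv (fun t => (t ^+ k.+1 / k.+1`!%:R)%:C) t (t ^+ k / k`!%:R)%:C.
  apply: cderiv_real.
  have hc : is_derive t (1 : R) (fun=> (k.+1`!%:R)^-1 : R) 0 by exact: is_derive_cst.
  have hX : is_derive t (1 : R) (fun x => x ^+ k.+1 : R) (k.+1%:R * t ^+ k : R).
    have h := @is_deriveX R R id k.+1 t 1 1 (is_derive_id t 1).
    have -> : (fun x => x ^+ k.+1 : R) = (id : R -> R) ^+ k.+1.
      by apply/funext => x; rewrite exprfctE.
    by apply: is_derive_eq h _; rewrite /= -[RHS]mulr1.
  apply: is_derive_eq (rderivM hX hc) _.
  have x0 : k.+1%:R != 0 :> R by rewrite pnatr_eq0.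
  have y0 : k`!%:R != 0 :> R by rewrite pnatr_eq0 -lt0n fact_gt0.
  rewrite mulr0 addr0 factS natrM; move: (k.+1%:R : R) x0 (k`!%:R : R) y0.
  by move=> x x0 y y0; field; rewrite x0 y0.
have := cderivM dm (cderiv_cexpN s t).
by rewrite /monexp; congr (cderiv _ _ _); ring.
Qed.

Lemma monexp_end k s : 0 < Re s ->
  (fun N : nat => nc (0 - monexp k s N%:R)) @ \oo --> (0 : R).
Proof.
move=> s0; have s2 : 0 < Re s / 2 by rewrite divr_gt0.
apply: (@le_cvg0 R _ _ _ (expR_scaled_cvg0 ((2 / Re s) ^+ k) s2)) => N.
apply/andP; split; first exact: nc_ge0.
by rewrite sub0r ncN; exact: (nc_monexp_le k s0 (ler0n R N)).
Qed.

(** The Laplace transform of t^k / k!. *)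
Lemma cint_monexp k s : 0 < Re s -> cintegral half (monexp k s) = s ^- k.+1.
Proof.
move=> s0; have sn0 : s != 0.
  by apply/eqP => h; move: s0; rewrite h ltxx.
elim: k => [|k IH].
  have h : cintegral half (fun t => - s * monexp 0 s t) = 0 - 1.
    rewrite (@cint_halfline (monexp 0 s) _ 0).
    - by rewrite /monexp expr0 fact0 divr1 mul0r oppr0 cexp0 mulr1.
    - exact (cintbleZ mhalf (- s) (cintble_monexp 0 s0)).
    - exact: ccontM (ccont_cst _) (ccont_monexp 0 s).
    - move=> t; have := cderiv_cexpN s t.
      have E x : monexp 0 s x = cexp (- (x%:C * s)).
        by rewrite /monexp expr0 fact0 divr1 mul1r.
      have -> : (fun t : R => cexp (- (t%:C * s))) = monexp 0 s.
        by apply/funext => x; rewrite E.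
      by rewrite -E.
    - exact: monexp_end.
  move: h; rewrite (cintZ mhalf); last exact: cintble_monexp.
  rewrite sub0r mulNr => /oppr_inj h.
  by apply: (mulfI sn0); rewrite h expr1 mulfV.
have hi := cintble_monexp k s0; have hi1 := cintble_monexp k.+1 s0.
have h : cintegral half (fun t => monexp k s t - s * monexp k.+1 s t) = 0 - 0.
  rewrite (@cint_halfline (monexp k.+1 s) _ 0).
  - by rewrite /monexp expr0n /= !mul0r.
  - exact: (cintbleB mhalf hi (cintbleZ mhalf s hi1)).
  - have -> : (fun t => monexp k s t - s * monexp k.+1 s t) =
       (fun t => monexp k s t + - s * monexp k.+1 s t).
      by apply/funext => t; rewrite mulNr.
    exact: ccontD (ccont_monexp k s) (ccontM (ccont_cst _) (ccont_monexp k.+1 s)).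
  - by move=> t; exact: cderiv_monexp.
  - exact: monexp_end.
move: h; rewrite (cintB mhalf hi (cintbleZ mhalf s hi1)) (cintZ mhalf)// subrr.
move/eqP; rewrite subr_eq0 => /eqP h; apply: (mulfI sn0); rewrite -h IH.
by rewrite [s ^+ k.+2]exprS invfM mulrA mulfV// mul1r.
Qed.

End HalfLine.

(** * Laguerre functions *)

Section Laguerre.
Variable R : realType.
Local Notation C := R[i].
Local Notation nc := (@Normc.normc R).
Local Notation cj := (@conjc R).
Local Notation Re := (@complex.Re R).
Local Notation Im := (@complex.Im R).
Local Notation leb := (@lebesgue_measure R).
Local Notation half := (@Rplus R).
Local Open Scope complex_scope.
Implicit Types (t x y : R) (z w s : C) (u v : R -> R) (a b : nat -> C).

Lemma cj_cexp z : cj (cexp z) = cexp (cj z).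
Proof.
rewrite /cexp cJM cJR cReJ cImJ; congr (_ * _).
by rewrite /cis cosN sinN.
Qed.

Lemma cj_monexp k s t : cj (monexp k s t) = monexp k (cj s) t.
Proof. by rewrite /monexp cJM cJR cj_cexp rmorphN /= cJM cJR. Qed.

Lemma monexpM j k s s' t :
  monexp j s t * monexp k s' t = 'C(j + k, j)%:R * monexp (j + k) (s + s') t.
Proof.
have -> : monexp j s t * monexp k s' t =
    (t ^+ j / j`!%:R * (t ^+ k / k`!%:R))%:C *
    (cexp (- (t%:C * s)) * cexp (- (t%:C * s'))).
  by rewrite /monexp [in RHS]rmorphM /=; ring.
rewrite -cexpD -opprD -mulrDr /monexp [RHS]mulrA; congr (_ * _).
have -> : 'C(j + k, j)%:R = ('C(j + k, j)%:R : R)%:C :> C by rewrite rmorph_nat.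
rewrite -rmorphM /=; congr (_%:C).
have f0 n : n`!%:R != 0 :> R by rewrite pnatr_eq0 -lt0n fact_gt0.
have e : ('C(j + k, j)%:R * (j`!%:R * k`!%:R) = (j + k)`!%:R :> R).
  by rewrite -!natrM -[in RHS](bin_fact (leq_addr k j)) addKn.
rewrite exprD; apply: (mulIf (f0 (j + k)%N)); rewrite -[in LHS]e.
by field; rewrite !f0.
Qed.

Lemma sq_monexp k s : 0 < Re s -> sq half (monexp k s).
Proof.
move=> s0; split; first exact: ccont_meas (ccont_monexp k s).
have [he _] := rintble_expR s0.
have mn := cmeas_nc2 (ccont_meas half (ccont_monexp k s)).
apply: (rintble_le (@mhalf R) mn _ (rintbleZ (@mhalf R) (((2 / Re s) ^+ k) ^+ 2) he)).
move=> t /half_ge0 t0; rewrite ger0_norm ?sqr_ge0//.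
have -> : expR (- (t * Re s)) = expR (- (t * (Re s / 2))) ^+ 2.
  by rewrite -expRM_natl; congr expR; field.
rewrite -exprMn ler_sqr ?nnegrE ?nc_ge0 ?nc_monexp_le//.
by rewrite mulr_ge0 ?expR_ge0// exprn_ge0// divr_ge0// ltW.
Qed.

Lemma sq_monexp1 k : sq half (monexp k 1).
Proof. by apply: sq_monexp; exact: ltr01. Qed.

Lemma ip_monexp j k s s' : 0 < Re s -> 0 < Re s' ->
  ip half (monexp j s) (monexp k s') =
  'C(j + k, j)%:R * (s + cj s') ^- (j + k).+1.
Proof.
move=> s0 s0'; have ss : 0 < Re (s + cj s') by rewrite cReD cReJ addr_gt0.
rewrite -cint_monexp// -(cintZ (@mhalf R)); last exact: cintble_monexp.
by apply: eq_cint => t _; rewrite cj_monexp monexpM.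
Qed.

Lemma sqrt2C : (Num.sqrt 2)%:C * (Num.sqrt 2)%:C = 2 :> C.
Proof. by rewrite -rmorphM /= -expr2 sqr_sqrtr// rmorph_nat. Qed.

(** [laguerre n 0] is the n-th Laguerre function; the second index records a
    power of the shift [monexp k 1 |-> monexp k.+1 1], so that the recursion
    builds (2 shift - 1)^n shift^k. *)
Fixpoint laguerre n k t : C :=
  if n is m.+1 then 2 * laguerre m k.+1 t + -1 * laguerre m k t
  else (Num.sqrt 2)%:C * monexp k 1 t.

Lemma sq_laguerre n k : sq half (laguerre n k).
Proof.
elim: n k => [|n IH] k; first exact: (sqZ (@mhalf R) _ (sq_monexp1 k)).
exact: (sqD (@mhalf R) (sqZ (@mhalf R) 2 (IH k.+1)) (sqZ (@mhalf R) (-1) (IH k))).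
Qed.

Lemma ip_laguerreSl n k g : sq half g -> ip half (laguerre n.+1 k) g =
  2 * ip half (laguerre n k.+1) g - ip half (laguerre n k) g.
Proof.
move=> sg; have m := @mhalf R; have s1 := sq_laguerre n k.+1; have s2 := sq_laguerre n k.
rewrite /= (ipDl m (sqZ m 2 s1) (sqZ m (-1) s2) sg).
by rewrite (ipZl m 2 s1 sg) (ipZl m (-1) s2 sg) mulN1r.
Qed.

Lemma ip_laguerreSr n k g : sq half g -> ip half g (laguerre n.+1 k) =
  2 * ip half g (laguerre n k.+1) - ip half g (laguerre n k).
Proof.
move=> sg; have m := @mhalf R; have s1 := sq_laguerre n k.+1; have s2 := sq_laguerre n k.
rewrite /= (ipDr m sg (sqZ m 2 s1) (sqZ m (-1) s2)).
rewrite (ipZr m 2 sg s1) (ipZr m (-1) sg s2).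
have c2 : cj 2 = 2 by exact: rmorph_nat.
have c1 : cj (-1) = -1 by exact: rmorphN1.
by rewrite c2 c1 mulN1r.
Qed.

Lemma C2_neq0 : 2 != 0 :> C. Proof. by rewrite pnatr_eq0. Qed.

(** Both sides satisfy the recursion that defines [laguerre], by the rule of Pascal;
    the binomial coefficient vanishes for j < n. *)
Lemma ip_laguerre_monomial n k j :
  ip half (laguerre n k) (laguerre 0 j) = 'C(k + j, n + k)%:R / 2 ^+ (k + j).
Proof.
have m := @mhalf R; have s1 i := sq_monexp1 i.
elim: n k => [|n IH] k; last first.
  rewrite ip_laguerreSl; last exact: (sq_laguerre 0 j).
  rewrite !IH addSn addnS binS natrD exprS addSn.
  by field; rewrite expf_neq0 // C2_neq0.
rewrite /= (ipZl m _ (s1 k) (sqZ m _ (s1 j))) (ipZr m _ (s1 k) (s1 j)).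
rewrite mulrA cJR sqrt2C ip_monexp ?ltr01// rmorph1 add0n.
have -> : 1 + 1 = 2 :> C by [].
by rewrite exprS; field; rewrite expf_neq0 // C2_neq0.
Qed.

Lemma ip_laguerre n m k : ip half (laguerre n 0) (laguerre m k) =
  (if (m <= n)%N then 'C(k, n - m)%:R else 0) / 2 ^+ k.
Proof.
elim: m k => [|m IH] k; first by rewrite ip_laguerre_monomial add0n addn0 subn0.
rewrite ip_laguerreSr; last exact: sq_laguerre.
rewrite !IH; case: (ltngtP m n) => [mn|mn|->].
- rewrite -(subnSK mn) binS natrD exprS.
  by field; rewrite expf_neq0 // C2_neq0.
- by rewrite !mul0r mulr0 subr0.
- by rewrite subnn !bin0 exprS; field; rewrite expf_neq0 // C2_neq0.
Qed.

Lemma orth_laguerre n m : ip half (laguerre n 0) (laguerre m 0) =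
  if n == m then 1%:C else 0.
Proof.
rewrite ip_laguerre expr0 divr1 bin0n subn_eq0 eqn_leq.
by case: (leqP m n) => h; case: (leqP n m).
Qed.

(** The transform at z is, up to a factor, the Laplace transform at this point of
    the right half plane. *)
Definition sz z : C := (1 - z) / (1 + z).

Lemma neq0_1D z : nc z < 1 -> 1 + z != 0.
Proof.
move=> z1; apply/eqP => h; have := nc1 R.
have -> : 1 = - z by move/eqP: h; rewrite addr_eq0 => /eqP.
by rewrite ncN => h1; move: z1; rewrite h1 ltxx.
Qed.

Lemma Re_sz z : nc z < 1 -> 0 < Re (sz z).
Proof.
move=> z1; have z0 := neq0_1D z1.
have n0 : 0 < nc (1 + z) by rewrite nc_gt0.
have -> : sz z = ((nc (1 + z) ^+ 2)^-1)%:C * ((1 - z) * cj (1 + z)).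
  have -> : ((nc (1 + z) ^+ 2)^-1)%:C = ((1 + z) * cj (1 + z))^-1.
    by rewrite mulCJ fmorphV.
  rewrite /sz; move: (1 + z) z0 => y y0; field.
  by rewrite y0 -nc_eq0 nc_conj nc_eq0 y0.
rewrite cReZ mulr_gt0 ?invr_gt0 ?exprn_gt0//.
have -> : Re ((1 - z) * cj (1 + z)) = 1 - nc z ^+ 2.
  by rewrite normc2E cReM cReJ cImJ !cReD !cImD cReN cImN /=; ring.
by rewrite subr_gt0 expr_lt1 ?nc_ge0.
Qed.

Lemma cj_sz z : cj (sz z) = sz (cj z).
Proof. by rewrite /sz fmorph_div rmorphB rmorphD rmorph1. Qed.

(** Pairing with [hkernel (cj z)] is evaluation of the transform at z. *)
Definition hkernel z t : C := (Num.sqrt 2)%:C / (1 + z) * monexp 0 (sz z) t.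

Lemma sq_kernel z : nc z < 1 -> sq half (hkernel z).
Proof. by move=> z1; exact: (sqZ (@mhalf R) _ (sq_monexp 0 (Re_sz z1))). Qed.

Lemma cj_const z :
  cj ((Num.sqrt 2)%:C / (1 + z)) = (Num.sqrt 2)%:C / (1 + cj z).
Proof. by rewrite cJM cJR fmorphV rmorphD rmorph1. Qed.

Lemma N2_kernel z : nc z < 1 -> (N2 half (hkernel z))%:C = (1 - z * cj z)^-1.
Proof.
move=> z1; have m := @mhalf R; have sk := sq_monexp 0 (Re_sz z1).
have z0 := neq0_1D z1; have cz1 : nc (cj z) < 1 by rewrite nc_conj.
have cz0 := neq0_1D cz1.
have d0 : 1 - z * cj z != 0.
  rewrite mulCJ subr_eq0 eq_sym -(rmorph1 (real_complex R)) (inj_eq (@complexI R)).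
  by rewrite lt_eqF// expr_lt1 ?nc_ge0.
rewrite -ipE /hkernel (ipZl m _ sk (sqZ m _ sk)) (ipZr m _ sk sk).
rewrite ip_monexp ?Re_sz// bin0 mul1r expr1 cj_sz.
rewrite cj_const.
transitivity (((Num.sqrt 2)%:C * (Num.sqrt 2)%:C) *
   ((1 + z)^-1 * (1 + cj z)^-1 / (sz z + sz (cj z)))); first by ring.
have -> : sz z + sz (cj z) = 2 * (1 - z * cj z) / ((1 + z) * (1 + cj z)).
  by rewrite /sz; field; rewrite z0 cz0.
by rewrite sqrt2C; field; rewrite ?C2_neq0 z0 cz0 d0.
Qed.

(** The transform sends Laguerre functions to powers of z. *)
Lemma ip_laguerre_kernel n k z : nc z < 1 ->
  ip half (laguerre n k) (hkernel (cj z)) = z ^+ n * ((1 + z) / 2) ^+ k.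
Proof.
move=> z1; have m := @mhalf R; have z0 := neq0_1D z1.
have cz1 : nc (cj z) < 1 by rewrite nc_conj.
have s1 i := sq_monexp1 i; have sk := sq_monexp 0 (Re_sz cz1).
elim: n k => [|n IH] k; last first.
  rewrite ip_laguerreSl; last exact: sq_kernel.
  by rewrite !IH !exprS; field; rewrite ?C2_neq0.
rewrite /= /hkernel (ipZl m _ (s1 k) (sqZ m _ sk)) (ipZr m _ (s1 k) sk).
rewrite ip_monexp ?ltr01 ?Re_sz// addn0 binn mul1r cj_sz cJK.
rewrite cj_const cJK.
have -> : 1 + sz z = ((1 + z) / 2)^-1.
  by rewrite /sz; field; rewrite z0 ?C2_neq0.
rewrite -exprVn invrK exprS.
transitivity (((Num.sqrt 2)%:C * (Num.sqrt 2)%:C) *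
   ((1 + z)^-1 * ((1 + z) / 2 * ((1 + z) / 2) ^+ k))); first by ring.
by rewrite sqrt2C expr0; field; rewrite ?C2_neq0 z0.
Qed.

Definition lcoef (f : R -> C) : nat -> C := ocoef half (fun n => laguerre n 0) 1 f.

Lemma l2_lcoef f : sq half f -> l2 (lcoef f).
Proof.
move=> sf; exact: (bessel (@mhalf R) ltr01 (fun n => sq_laguerre n 0) orth_laguerre sf).
Qed.

(** The Laguerre coefficients of the kernel are the powers of z, so the squared norm
    of the rest is |z|^(2N) / (1 - |z|^2) by subtraction of squared norms. *)
Lemma kernel_expansion z : nc z < 1 ->
  (fun N => N2 half (fun t => hkernel z t -
    osum (fun n => laguerre n 0) (lcoef (hkernel z)) 0 N t)) @ \oo --> (0 : R).
Proof.
move=> z1; have m := @mhalf R; have sk := sq_kernel z1.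
have cz1 : nc (cj z) < 1 by rewrite nc_conj.
have r1 : nc z ^+ 2 < 1 by rewrite expr_lt1 ?nc_ge0.
have d0 : 1 - nc z ^+ 2 != 0 by rewrite subr_eq0 eq_sym lt_eqF.
have coefE n : lcoef (hkernel z) n = z ^+ n.
  rewrite /lcoef /ocoef rmorph1 divr1 (ipC m (sq_laguerre n 0) sk).
  by rewrite -[X in hkernel X](cJK z) ip_laguerre_kernel// expr0 mulr1 rmorphXn /= cJK.
have N2k : N2 half (hkernel z) = (1 - nc z ^+ 2)^-1.
  apply: (@complexI R); rewrite N2_kernel// mulCJ -(rmorph1 (real_complex R)).
  by rewrite -rmorphB -fmorphV.
have sumE N : \sum_(n < N) nc (lcoef (hkernel z) n) ^+ 2 =
    (1 - (nc z ^+ 2) ^+ N) / (1 - nc z ^+ 2).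
  under eq_bigr => n _ do rewrite coefE ncX -exprM mulnC exprM.
  move: (nc z ^+ 2) d0 => r r0.
  elim: N => [|N IH]; first by rewrite big_ord0 expr0 subrr mul0r.
  by rewrite big_ord_recr /= IH exprS; field.
apply: (@le_cvg0 R _ (fun N => (1 - nc z ^+ 2)^-1 * (nc z ^+ 2) ^+ N)).
  move=> N; rewrite N2_ge0 /=.
  rewrite (N2_rest m ltr01 (fun n => sq_laguerre n 0) orth_laguerre N sk).
  by rewrite mul1r -/(lcoef (hkernel z)) sumE N2k le_eqVlt; apply/orP; left; apply/eqP; field.
rewrite -[X in _ --> X](mulr0 (1 - nc z ^+ 2)^-1); apply: cvgM; first exact: cvg_cst.
by apply: cvg_expr; rewrite ger0_norm ?sqr_ge0.
Qed.

(** The transform of a function is the power series of its Laguerre coefficients: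
    pair the function with the expansion of the kernel. *)
Lemma psum_lcoef f z : sq half f -> nc z < 1 ->
  psum (lcoef f) z @ \oo --> ip half f (hkernel (cj z)).
Proof.
move=> sf z1; have m := @mhalf R.
have cz1 : nc (cj z) < 1 by rewrite nc_conj.
have sk := sq_kernel cz1; have sl n := sq_laguerre n 0.
have coefE n : lcoef (hkernel (cj z)) n = cj (z ^+ n).
  rewrite /lcoef /ocoef rmorph1 divr1 (ipC m (sq_laguerre n 0) sk).
  by rewrite ip_laguerre_kernel// expr0 mulr1.
have so N := sq_osum m sl (lcoef (hkernel (cj z))) 0 N.
have cv := ip_limit m sk so sf (kernel_expansion cz1).
apply: (cvgC0 _ cv) => N.
have -> : psum (lcoef f) z N = cj (ip half (osum (fun n => laguerre n 0)
    (lcoef (hkernel (cj z))) 0 N) f).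
  rewrite /osum (ip_suml m _ (fun n => sqZ m _ (sl n)) sf) big_mkord cJ_sum.
  apply: eq_bigr => n _; rewrite (ipZl m _ (sl n) sf) cJM coefE cJK.
  by rewrite -(ipC m (sl n) sf) /lcoef /ocoef rmorph1 divr1 mulrC.
by rewrite (ipC m sk sf) -rmorphB nc_conj.
Qed.

End Laguerre.

(** * Uniqueness for the Laplace transform *)

Section Completeness.
Variable R : realType.
Local Notation leb := (@lebesgue_measure R).
Local Notation half := (@Rplus R).
Implicit Types (t x y s T : R) (u v : R -> R).

Lemma rintble_bounded_factor u v : rintble half u -> measurable_fun half v ->
  (forall t, half t -> `|v t| <= 1) -> rintble half (fun t => u t * v t).
Proof.
move=> ui mv v1; have mu := rintble_meas ui.
apply: (rintble_le (@mhalf R) _ _ (rintble_norm ui)); first exact: measurable_funM.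
by move=> t /v1 h; rewrite normrM ler_piMr.
Qed.

(** A cubic with fixed points 0, 1/2 and 1, of which the middle one repels: its
    iterates, evaluated at exp (- t s), are polynomials in this exponential that
    approximate the indicator of an initial interval. *)
Definition smoothstep x := 3 * x ^+ 2 - 2 * x ^+ 3.

Lemma smoothstep_range x : 0 <= x <= 1 -> 0 <= smoothstep x <= 1.
Proof.
move=> /andP[x0 x1]; apply/andP; split.
  have -> : smoothstep x = x ^+ 2 * (3 - 2 * x) by rewrite /smoothstep; ring.
  by rewrite mulr_ge0 ?sqr_ge0//; lra.
rewrite -subr_ge0.
have -> : 1 - smoothstep x = (1 - x) ^+ 2 * (1 + 2 * x) by rewrite /smoothstep; ring.
by rewrite mulr_ge0 ?sqr_ge0//; lra.
Qed.

Lemma iter_smoothstep_range n x : 0 <= x <= 1 -> 0 <= iter n smoothstep x <= 1.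
Proof. by move=> hx; elim: n => //= n IH; exact: smoothstep_range. Qed.

Lemma iter_smoothstep_cvg0 x : 0 <= x < 2^-1 ->
  (fun n => iter n smoothstep x) @ \oo --> (0 : R).
Proof.
move=> /andP[x0 x2]; pose r := x * (3 - 2 * x).
have r0 : 0 <= r by rewrite /r; nra.
have r1 : r < 1 by rewrite /r; nra.
have key n : 0 <= iter n smoothstep x <= r ^+ n * x /\ iter n smoothstep x <= x.
  elim: n => [|n [/andP[h0 h1] h2]]; first by rewrite expr0 mul1r x0 lexx.
  rewrite iterS; move: (iter n smoothstep x) h0 h1 h2 => y y0 y1 yx.
  have hs : smoothstep y <= r * y.
    have -> : smoothstep y = y * (y * (3 - 2 * y)) by rewrite /smoothstep; ring.
    by rewrite mulrC ler_wpM2r// /r; nra.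
  have /andP[s0 _] : 0 <= smoothstep y <= 1 by apply: smoothstep_range; lra.
  split; last by apply: le_trans hs _; nra.
  rewrite s0 /=; apply: le_trans hs _; rewrite exprS -mulrA.
  exact: ler_wpM2l.
apply: (@le_cvg0 R _ (fun n => r ^+ n * x)); first by move=> n; have [] := key n.
rewrite -[X in _ --> X](mul0r x); apply: cvgM; last exact: cvg_cst.
by apply: cvg_expr; rewrite ger0_norm.
Qed.

Lemma iter_smoothstep_cvg1 x : 2^-1 < x <= 1 ->
  (fun n => iter n smoothstep x) @ \oo --> (1 : R).
Proof.
move=> /andP[x2 x1].
have E n : iter n smoothstep x = 1 - iter n smoothstep (1 - x).
  elim: n => [|n IH]; first by rewrite /=; ring.
  by rewrite !iterS IH /smoothstep; ring.
have -> : (fun n => iter n smoothstep x) = (fun n => 1 - iter n smoothstep (1 - x)).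
  by apply/funext => n; rewrite E.
rewrite -[X in _ --> X](subr0 1); apply: cvgB; first exact: cvg_cst.
by apply: iter_smoothstep_cvg0; lra.
Qed.

Fixpoint smoothstep_poly n : {poly R} :=
  if n is m.+1 then let p := smoothstep_poly m in 3%:P * (p * p) - 2%:P * (p * p * p)
  else 'X.

Lemma horner_smoothstep n x : (smoothstep_poly n).[x] = iter n smoothstep x.
Proof.
elim: n => [|n IH]; first by rewrite hornerX.
rewrite iterS /= -IH /smoothstep; move: (smoothstep_poly n) => p.
by rewrite hornerD hornerN !hornerM !hornerC; ring.
Qed.

Section Injectivity.
Variable u : R -> R.
Hypothesis ui : rintble half u.
Hypothesis laplace0 : forall s, 0 <= s ->
  \int[leb]_(t in half) (u t * expR (- (t * s))) = 0.

Lemma expR_half s t : 0 <= s -> half t -> 0 <= expR (- (t * s)) <= 1.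
Proof.
move=> s0 /half_ge0 t0; rewrite expR_ge0 /= -expR0 ler_expR oppr_le0.
exact: mulr_ge0.
Qed.

Lemma meas_expR s : measurable_fun half (fun t => expR (- (t * s)) : R).
Proof.
apply: measurable_funTS; apply: continuous_measurable_fun => t.
apply: (continuous_comp (f := fun t => - (t * s))); last exact: continuous_expR.
by apply: cvgN; apply: cvgM; [exact: cvg_id|exact: cvg_cst].
Qed.

Lemma meas_poly (p : {poly R}) s :
  measurable_fun half (fun t => p.[expR (- (t * s))] : R).
Proof.
elim/poly_ind: p => [|p c IH]; first by under eq_fun do rewrite horner0; exact: measurable_cst.
under eq_fun do rewrite hornerMXaddC.
apply: measurable_funD; last exact: measurable_cst.
by apply: measurable_funM => //; exact: meas_expR.
Qed.

(** The powers of exp (- t s) are again exponentials of the same family. *)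
Lemma laplace_poly0 (p : {poly R}) s : 0 <= s ->
  \int[leb]_(t in half) (u t * p.[expR (- (t * s))]) = 0.
Proof.
move=> s0; have m := @mhalf R.
have iE k : rintble half (fun t => u t * expR (- (t * s)) ^+ k).
  apply: rintble_bounded_factor => //.
    by apply: measurable_funX; exact: meas_expR.
  move=> t ht; have /andP[e0 e1] := expR_half s0 ht.
  by rewrite ger0_norm ?exprn_ge0// exprn_ile1.
have int0 k : \int[leb]_(t in half) (u t * expR (- (t * s)) ^+ k) = 0.
  rewrite -(@laplace0 (k%:R * s)); last by rewrite mulr_ge0.
  apply: eq_Rint => t _; rewrite -expRM_natl; congr (_ * expR _); ring.
suff H : forall k, rintble half (fun t => u t * (p.[expR (- (t * s))] * expR (- (t * s)) ^+ k)) /\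
    \int[leb]_(t in half) (u t * (p.[expR (- (t * s))] * expR (- (t * s)) ^+ k)) = 0.
  have [_ h] := H 0%N; rewrite -[RHS]h.
  by apply: eq_Rint => t _; rewrite expr0 mulr1.
elim/poly_ind: p => [|p c IH] k.
  have -> : (fun t => u t * ((0 : {poly R}).[expR (- (t * s))] *
      expR (- (t * s)) ^+ k)) = (fun t => 0 * u t).
    by apply/funext => t; rewrite horner0 mul0r mulr0 mul0r.
  split; first exact: (rintbleZ m 0 ui).
  by rewrite (RintZ m _ ui) mul0r.
have [i1 z1] := IH k.+1; have i2 := rintbleZ m c (iE k).
have E : (fun t => u t * ((p * 'X + c%:P).[expR (- (t * s))] * expR (- (t * s)) ^+ k)) =
   (fun t => u t * (p.[expR (- (t * s))] * expR (- (t * s)) ^+ k.+1) +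
             c * (u t * expR (- (t * s)) ^+ k)).
  by apply/funext => t; rewrite hornerMXaddC exprS; ring.
rewrite E; split; first exact: rintbleD.
by rewrite (RintD m i1 i2) z1 (RintZ m _ (iE k)) int0 mulr0 addr0.
Qed.

Lemma integral_initial0 T : 0 < T -> \int[leb]_(t in `[0, T]) u t = 0.
Proof.
(* With this s the exponential exp (- t s) crosses 1/2 at t = T. *)
move=> T0; have m := @mhalf R; pose s := ln 2 / T.
have ln2 : 0 < ln 2 :> R by rewrite ln_gt0// ltr1n.
have s0 : 0 <= s by rewrite divr_ge0// ltW.
have mu := rintble_meas ui.
have mi : measurable_fun half (fun t => u t * \1_`[0, T]%classic t : R).
  by apply: measurable_funM => //; exact: measurable_indic.
have cv : (fun n => \int[leb]_(t in half) (u t * (smoothstep_poly n).[expR (- (t * s))]))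
    @ \oo --> (\int[leb]_(t in half) (u t * \1_`[0, T]%classic t) : R).
  apply: (Rint_dominated m _ mi _ (rintble_norm ui)).
  - by move=> n; apply: measurable_funM => //; exact: meas_poly.
  - apply: filterS (ae_neq T) => t tT ht; have /andP[e0 e1] := expR_half s0 ht.
    apply: cvgM; first exact: cvg_cst.
    have -> : (fun n => (smoothstep_poly n).[expR (- (t * s))]) =
        (fun n => iter n smoothstep (expR (- (t * s)))).
      by apply/funext => n; exact: horner_smoothstep.
    have t0 := half_ge0 ht.
    have half_E : 2^-1 = expR (- ln 2) :> R by rewrite expRN lnK// posrE.
    have sT : T * s = ln 2 by rewrite /s; field; rewrite gt_eqF.
    have s1 : 0 < s by rewrite divr_gt0.
    have [lt|gt] : t < T \/ T < t.
      by move: tT; rewrite neq_lt => /orP[]; [left|right].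
    + rewrite indicE mem_set; last by rewrite /= in_itv/= t0 ltW.
      apply: iter_smoothstep_cvg1; rewrite e1 andbT half_E ltr_expR ltrN2 -sT.
      by rewrite ltr_pM2r.
    + rewrite indicE memNset; last by rewrite /= in_itv/= t0 /= leNgt gt.
      apply: iter_smoothstep_cvg0; rewrite e0 /= half_E ltr_expR ltrN2 -sT.
      by rewrite ltr_pM2r.
  - move=> n t ht; rewrite horner_smoothstep normrM.
    have /andP[h0 h1] := iter_smoothstep_range n (expR_half s0 ht).
    by rewrite (ger0_norm h0) ler_piMr.
have z : \int[leb]_(t in half) (u t * \1_`[0, T]%classic t) = 0.
  apply: (cvg_unique (@Rhausdorff R) cv); apply: cvg_near_cst; apply: nearW => n.
  exact: laplace_poly0.
rewrite -[RHS]z /Rintegral; congr fine.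
rewrite [RHS]integral_mkcond [LHS]integral_mkcond; apply: eq_integral => t _.
rewrite !patchE indicE /Rplus; case: ifP => h1; case: ifP => h2.
- by rewrite mulr1.
- by exfalso; move: h1 h2; rewrite !mem_setE !in_itv/= andbT; lra.
- by rewrite mulr0.
- by [].
Qed.

(** A function whose integral over every initial interval vanishes is zero
    almost everywhere, by Lebesgue differentiation. *)
Lemma laplace_injective : {ae leb, forall t, half t -> u t = 0}.
Proof.
have m := @mhalf R.
have loc := integrable_locally_restrict m ui.
have iy y : leb.-integrable [set` Interval (BLeft 0) (BRight y)] (EFin \o (u \_ half)).
  have h : leb.-integrable half (EFin \o (u \_ half)).
    apply: (@eq_integrable _ _ _ leb half m (EFin \o u) _ _ ui) => t ht.
    by rewrite /= patchE ht.
  apply: (integrableS m _ _ h); first exact: measurable_itv.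
  by move=> t; rewrite /Rplus /= !in_itv/= andbT => /andP[].
have := FTC1 iy loc; set F := fun x => _ => ae1.
have F0 x : 0 < x -> F x = 0.
  move=> x0; rewrite /F -[RHS](integral_initial0 x0); apply: eq_Rint => t.
  rewrite /= in_itv/= => /andP[t0 _].
  by rewrite patchE mem_set// /Rplus /= in_itv/= t0.
apply: filterS2 (ae_neq 0) ae1 => t t0 h ht.
have tpos : 0 < t by rewrite lt_neqAle eq_sym t0 (half_ge0 ht).
have [_] : derivable F t 1 /\ F^`()%classic t = (u \_ half) t.
  by apply: h; rewrite /= lte_fin.
rewrite patchE mem_set// => <-; rewrite derive1E.
rewrite (@near_eq_derive _ _ _ F (fun=> 0)) ?derive_cst//.
by near=> x; apply: F0; near: x; exact: lt_nbhsr.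
Unshelve. all: by end_near.
Qed.

End Injectivity.
End Completeness.

(** * The Hardy transform *)

Section Transform.
Variable R : realType.
Local Notation C := R[i].
Local Notation nc := (@Normc.normc R).
Local Notation cj := (@conjc R).
Local Notation Re := (@complex.Re R).
Local Notation Im := (@complex.Im R).
Local Notation leb := (@lebesgue_measure R).
Local Notation half := (@Rplus R).
Local Notation HT := (@HardyTransform R).
Local Open Scope complex_scope.
Local Open Scope quotient_scope.
Implicit Types (t x y s : R) (z w : C) (u v : R -> R) (a b : nat -> C) (f g : L2 R).

Lemma sq_square_integrable (h : R -> C) : sq half h <-> square_integrable h.
Proof.
split=> [[[mr mi] hi]|[mr mi hfin]].
  split=> //; have /integrableP[_] := hi; apply: le_lt_trans.
  rewrite le_eqVlt; apply/orP; left; apply/eqP; apply: eq_integral => t _.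
  by rewrite abse_EFin ger0_norm ?sqr_ge0.
split=> //; apply/integrableP; split; first exact: measurable_normc2.
under eq_integral do rewrite abse_EFin (ger0_norm (sqr_ge0 _)).
exact: hfin.
Qed.

Lemma sq_L2 f : sq half f.
Proof. by apply/sq_square_integrable; exact: L2repr_square_integrable. Qed.

Lemma L2_of_sq (h : R -> C) : sq half h -> exists f, ae_eq leb half f h.
Proof.
move=> /sq_square_integrable hs.
have hp : h \in @L2pred R by apply/asboolP.
by exists (\pi_(L2 R) (MkL2fun hp)); exact: L2_reprP.
Qed.

Lemma ip_ae (h h' k : R -> C) : ae_eq leb half h h' -> ip half h k = ip half h' k.
Proof.
move=> hh; rewrite /ip /cintegral; congr (_ +i* _);
  by apply: Rint_ae_congr; apply: filterS hh => t ht /ht ->.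
Qed.

Lemma cj_hkernel z t :
  cj (hkernel (cj z) t) = (Num.sqrt 2)%:C / (1 + z) * monexp 0 (sz z) t.
Proof. by rewrite /hkernel cJM cj_const cJK cj_monexp cj_sz cJK. Qed.

Lemma monexp0E c t : monexp 0 c t = cexp (- (t%:C * c)) :> C.
Proof. by rewrite /monexp expr0 fact0 divr1 mul1r. Qed.

Lemma HT_ip f z : nc z < 1 -> HT f z = ip half f (hkernel (cj z)).
Proof.
move=> z1; have m := @mhalf R; have z0 := neq0_1D z1.
have sm := sq_monexp 0 (Re_sz z1); have sf := sq_L2 f.
have E t : cexp (t%:C * (z - 1) / (z + 1)) = monexp 0 (sz z) t.
  rewrite /monexp expr0 fact0 divr1 mul1r /sz; congr cexp; field.
  by rewrite ?z0 // addrC z0.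
rewrite /HardyTransform /ip -(cintZ m); last first.
  have -> : (fun t => f t * cexp (t%:C * (z - 1) / (z + 1))) =
      (fun t => f t * monexp 0 (sz z) t) by apply/funext => t; rewrite E.
  exact: (sq_mul m sf sm).
by apply: eq_cint => t _; rewrite E cj_hkernel; ring.
Qed.

Lemma HTD f g z : nc z < 1 -> HT (f + g) z = HT f z + HT g z.
Proof.
move=> z1; have cz : nc (cj z) < 1 by rewrite nc_conj.
rewrite !HT_ip// (ip_ae _ (L2addE f g)).
exact: (ipDl (@mhalf R) (sq_L2 f) (sq_L2 g) (sq_kernel cz)).
Qed.

Lemma HTZ c f z : nc z < 1 -> HT (c *: f) z = c * HT f z.
Proof.
move=> z1; have cz : nc (cj z) < 1 by rewrite nc_conj.
rewrite !HT_ip// (ip_ae _ (L2scaleE c f)).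
exact: (ipZl (@mhalf R) c (sq_L2 f) (sq_kernel cz)).
Qed.

(** The transform only sees a function through its Laguerre coefficients. *)
Lemma HT_ps f z : nc z < 1 -> HT f z = ps (lcoef f) z.
Proof. by move=> z1; rewrite HT_ip// (ps_eq (psum_lcoef (sq_L2 f) z1)). Qed.

Lemma HT_surjective a : l2 a -> exists f, forall z, nc z < 1 -> HT f z = ps a z.
Proof.
move=> al; have [h [sh _ hc]] := riesz_fischer_coef (@mhalf R) ltr01
  (fun n => @sq_laguerre R n 0) (@orth_laguerre R) al.
have [f hf] := L2_of_sq sh; exists f => z z1.
rewrite HT_ps//; congr (ps _ z); apply/funext => n.
by rewrite /lcoef /ocoef (ip_ae _ hf) hc rmorph1 mul1r divr1.
Qed.

(** The values of the transform on the real diameter give the Laplace transform on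
    the positive half line, which determines the function. The weight exp (- t)
    makes the square integrable function integrable. *)
Lemma HT_injective f : (forall z, nc z < 1 -> HT f z = 0) -> f = 0.
Proof.
move=> h0; have m := @mhalf R; have sf := sq_L2 f.
have fs (c : R) : 0 < c -> cintegral half (fun t => f t * monexp 0 c%:C t) = 0.
  move=> c0; have c1 : 1 + c != 0 by rewrite gt_eqF// addr_gt0.
  pose x := (1 - c) / (1 + c); have x1 : nc x%:C < 1.
    rewrite ncR ltr_norml /x; apply/andP; split.
      by rewrite ltr_pdivlMr ?addr_gt0//; lra.
    by rewrite ltr_pdivrMr ?addr_gt0//; lra.
  have cx1 : nc (cj x%:C) < 1 by rewrite nc_conj.
  have szx : sz x%:C = c%:C.
    rewrite /sz -(rmorph1 (real_complex R)) -rmorphB -rmorphD -fmorph_div /=.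
    by congr (_%:C); rewrite /x; field; rewrite c1 /=; lra.
  have z0 := neq0_1D x1.
  have := h0 _ x1; rewrite HT_ip// /ip.
  have -> : cintegral half (fun t => f t * cj (hkernel (cj x%:C) t)) =
     (Num.sqrt 2)%:C / (1 + x%:C) * cintegral half (fun t => f t * monexp 0 c%:C t).
    rewrite -(cintZ m); last by apply: (sq_mul m sf); apply: sq_monexp.
    apply: eq_cint => t _; rewrite cj_hkernel szx.
    by ring.
  move/eqP; rewrite mulf_eq0 => /orP[|/eqP//].
  rewrite mulf_eq0 invr_eq0 (negbTE z0) orbF -(rmorph0 (real_complex R)).
  by rewrite (inj_eq (@complexI R)) sqrtr_eq0 leNgt ltr0n.
have sm1 := @sq_monexp1 R 0; have gi := sq_mul m sf sm1.
pose g t := f t * monexp 0 1 t.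
have gE t : g t = (expR (- t))%:C * f t.
  by rewrite /g /monexp expr0 fact0 divr1 mul1r mulr1 -rmorphN cexp_real mulrC.
have lap (s : R) : 0 <= s -> cintegral half (fun t => (expR (- (t * s)))%:C * g t) = 0.
  move=> s0; have s1 : 0 < 1 + s by rewrite addrC ltr_wpDl.
  rewrite -(fs _ s1); apply: eq_cint => t _.
  rewrite gE /monexp expr0 fact0 divr1 mul1r mulrA -rmorphM -expRD [in RHS]mulrC.
  congr (_ * _); rewrite -rmorphM -rmorphN cexp_real; congr ((expR _)%:C); ring.
have [gr gim] := gi.
have aer : {ae leb, forall t, half t -> Re (g t) = 0}.
  apply: (laplace_injective gr) => s s0.
  have /eqP := lap s s0; rewrite eq_complex /= => /andP[/eqP h _].
  by rewrite -[RHS]h; apply: eq_Rint => t _; rewrite cReZ mulrC.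
have aei : {ae leb, forall t, half t -> Im (g t) = 0}.
  apply: (laplace_injective gim) => s s0.
  have /eqP := lap s s0; rewrite eq_complex /= => /andP[_ /eqP h].
  by rewrite -[RHS]h; apply: eq_Rint => t _; rewrite cImZ mulrC.
apply/L2_eqP.
have z0 : ae_eq leb half (0 : L2 R) (fun=> 0 : C).
  have := L2scaleE 0 f; rewrite scale0r; apply: filterS => t h /h ->.
  by rewrite mul0r.
apply: filterS3 aer aei z0 => t h1 h2 h3 ht.
rewrite (h3 ht); have : g t = 0 by apply: Ceq; [exact: h1|exact: h2].
rewrite gE => /eqP; rewrite mulf_eq0 => /orP[|/eqP//].
rewrite -(rmorph0 (real_complex R)) (inj_eq (@complexI R)).
by rewrite gt_eqF// expR_gt0.
Qed.

Lemma Rint_translation (tau : R) u : 0 <= tau -> measurable_fun half u ->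
  \int[leb]_(t in half) (if tau <= t then u (t - tau) else 0) =
  \int[leb]_(t in half) u t.
Proof.
move=> tau0 mu; have m := @mhalf R; rewrite /Rintegral; congr fine.
pose h : R -> \bar R := (fun t => (u t)%:E) \_ half.
have mh : measurable_fun setT h.
  by apply: (measurable_restrictT _ m).1; apply/measurable_EFinP.
have E : (\int[leb]_t h (t - tau)%R = \int[leb]_t h t)%E.
  rewrite [LHS]integralE [RHS]integralE; congr (_ - _)%E.
    have := (@ge0_integral_translation R tau (h^\+)%E (measurable_funepos mh) (funepos_ge0 h)); rewrite unlock; exact.
  have := (@ge0_integral_translation R tau (h^\-)%E (measurable_funeneg mh) (funeneg_ge0 h)); rewrite unlock; exact.
rewrite [RHS]integral_mkcond -/h -E [LHS]integral_mkcond.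
apply: eq_integral => t _; rewrite /h !patchE /Rplus !mem_setE !in_itv/= !andbT subr_ge0.
case: (lerP tau t) => ht; first by rewrite (le_trans tau0 ht).
by case: ifP.
Qed.

Lemma HT_translate (tau : {nonneg R}) f z : nc z < 1 ->
  HT (translate tau f) z = cexp (- (tau%:num%:C * sz z)) * HT f z.
Proof.
move=> z1; have m := @mhalf R; have cz : nc (cj z) < 1 by rewrite nc_conj.
have sk := sq_kernel cz; have sf := sq_L2 f.
rewrite !HT_ip// (ip_ae _ (translateE tau f)).
pose E := cexp (- (tau%:num%:C * sz z)).
have kE t : E * cj (hkernel (cj z) (t - tau%:num)) = cj (hkernel (cj z) t).
  rewrite !cj_hkernel !monexp0E mulrCA; congr (_ * _); rewrite /E -cexpD; congr cexp.
  by rewrite rmorphB; ring.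
rewrite /ip -(cintZ m); last exact: (ip_cintble m sf sk).
have [ir ii] := cintbleZ m E (ip_cintble m sf sk).
have val t : delay tau%:num f t * cj (hkernel (cj z) t) =
    if tau%:num <= t then E * (f (t - tau%:num) * cj (hkernel (cj z) (t - tau%:num))) else 0.
  by rewrite /delay; case: ifP => _; rewrite ?mul0r// -kE; ring.
have tau0 : 0 <= tau%:num by [].
congr (_ +i* _).
- rewrite -(Rint_translation tau0 (rintble_meas ir)).
  by apply: eq_Rint => t _; rewrite val; case: ifP.
- rewrite -(Rint_translation tau0 (rintble_meas ii)).
  by apply: eq_Rint => t _; rewrite val; case: ifP.
Qed.

Lemma translate0 f : translate 0%:nng f = f.
Proof.
apply/L2_eqP; apply: filterS (translateE 0%:nng f) => t h ht.
by rewrite h// /delay /= subr0 (half_ge0 ht).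
Qed.

End Transform.

(** * Polynomials without zeros in the disk *)

Section RootCounting.
Variable R : realType.
Local Notation C := R[i].
Local Notation nc := (@Normc.normc R).
Local Open Scope complex_scope.
Implicit Types (r : seq C) (m : nat -> C).

Lemma prod_linear_coefs r : let p := \prod_(x <- r) (1 - x *: 'X) : {poly C} in
  [/\ p`_0 = 1, p`_1 = - \sum_(x <- r) x &
      2 * p`_2 = (\sum_(x <- r) x) ^+ 2 - \sum_(x <- r) x ^+ 2].
Proof.
elim: r => [|x r]; first by rewrite /= !big_nil !coef1 /= oppr0; split=> //; ring.
rewrite /= !big_cons; set p := \prod_(j <- r) _ => -[c0 c1 c2].
have E n : ((1 - x *: 'X) * p)`_n.+1 = p`_n.+1 - x * p`_n.
  by rewrite mulrBl mul1r -scalerAl coefB coefZ coefXM.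
have E0 : ((1 - x *: 'X) * p)`_0 = p`_0.
  by rewrite mulrBl mul1r -scalerAl coefB coefZ coefXM mulr0 subr0.
rewrite !E E0 c0 c1; split => //; first by ring.
by rewrite mulrBr c2; ring.
Qed.

Definition gkz_poly m n : {poly C} := \poly_(k < n.+1) ('C(n, k)%:R * (-1) ^+ k * m k).

(** The roots lie outside the closed disk, so that the polynomial can be normalized
    at 0 and written with the reciprocals of its roots. *)
Lemma gkz_poly_factor m n : (forall x, nc x <= 1 -> (gkz_poly m n).[x] != 0) ->
  exists r, [/\ (size r <= n)%N, {in r, forall x, nc x < 1} &
    gkz_poly m n = (m 0%N)%:P * \prod_(x <- r) (1 - x *: 'X)].
Proof.
move=> nz; set Q := gkz_poly m n.
have Q0 : Q.[0] = m 0%N.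
  by rewrite horner_coef0 /Q /gkz_poly coef_poly /= bin0 !mul1r.
have m0 : m 0%N != 0 by rewrite -Q0; apply: nz; rewrite nc0.
have Qn0 : Q != 0 by apply/eqP => h; move: m0; rewrite -Q0 h horner0 eqxx.
have [rs Qrs] := closed_field_poly_normal Q.
have lc0 : lead_coef Q != 0 by rewrite lead_coef_eq0.
have big x : x \in rs -> 1 < nc x.
  move=> xrs; rewrite ltNge; apply/negP => x1; have /negP := nz x x1; apply.
  by rewrite -/Q -rootE Qrs rootZ// root_prod_XsubC.
have x0 x : x \in rs -> x != 0.
  move=> xrs; rewrite -nc_gt0; exact: lt_trans ltr01 (big x xrs).
exists [seq x^-1 | x <- rs]; split.
- rewrite size_map; have : (size Q <= n.+1)%N by exact: size_poly.
  by rewrite Qrs size_scale// size_prod_XsubC ltnS.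
- move=> y /mapP[x xrs ->]; rewrite ncV invf_lt1; first exact: big.
  exact: lt_trans ltr01 (big x xrs).
have fac : \prod_(x <- rs) ('X - x%:P) =
    (\prod_(x <- rs) - x)%:P * \prod_(x <- [seq x^-1 | x <- rs]) (1 - x *: 'X).
  rewrite big_map rmorph_prod -big_split /=; apply: eq_big_seq => x xrs.
  rewrite mulrBr mulr1 -mul_polyC mulrA -polyCM mulNr mulfV ?x0// polyCN polyCN.
  by rewrite polyC1; ring.
have -> : m 0%N = lead_coef Q * \prod_(x <- rs) - x.
  rewrite -Q0 {1}Qrs hornerZ fac hornerM hornerC horner_coef0.
  by have [-> _ _] := prod_linear_coefs [seq x^-1 | x <- rs]; rewrite mulr1.
by rewrite {1}Qrs fac -mul_polyC mulrA -polyCM.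
Qed.

Lemma nc_sum_le (r : seq C) : {in r, forall x, nc x <= 1} ->
  nc (\sum_(x <- r) x) <= (size r)%:R.
Proof.
elim: r => [|x r IH] hr; first by rewrite big_nil nc0.
rewrite big_cons; apply: le_trans (ncD _ _) _.
rewrite -[size _]/((size r).+1) -natr1 addrC; apply: lerD.
  by apply: IH => y yr; apply: hr; rewrite inE yr orbT.
by apply: hr; rewrite inE eqxx.
Qed.

(** If all polynomials sum_k C(n,k) (-1)^k m_k x^k are zero free in the closed
    disk, their reciprocal roots have modulus at most one; comparing the first
    two Newton sums gives |n (mu_1^2 - mu_2) + mu_2| <= 1 with mu_k = m_k/m_0,
    for all n. *)
Lemma gkz_moments m : (forall n x, nc x <= 1 -> (gkz_poly m n).[x] != 0) ->
  m 2%N * m 0%N = m 1%N ^+ 2.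
Proof.
move=> nz.
have m0 : m 0%N != 0.
  have := nz 0%N 0; rewrite nc0 ler01 horner_coef0 /gkz_poly coef_poly /= bin0 !mul1r.
  exact.
pose u1 := m 1%N / m 0%N; pose u2 := m 2%N / m 0%N.
have bnd n : nc (n.+1%:R * (u1 ^+ 2 - u2) + u2) <= 1.
  have [r [szr r1 fac]] := gkz_poly_factor (nz n.+1).
  have [_ c1 c2] := prod_linear_coefs r; set p := \prod_(x <- r) _ in fac c1 c2.
  have e1 : n.+1%:R * m 1%N = m 0%N * \sum_(x <- r) x.
    have := congr1 (fun q : {poly C} => q`_1) fac.
    rewrite mul_polyC coefZ c1 /gkz_poly coef_poly /= bin1 expr1 mulrN1.
    by rewrite mulNr mulrN => /oppr_inj.
  have e2 : (n.+1 * n)%:R * m 2%N =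
      m 0%N * ((\sum_(x <- r) x) ^+ 2 - \sum_(x <- r) x ^+ 2).
    have := congr1 (fun q : {poly C} => 2 * q`_2) fac.
    rewrite mul_polyC coefZ mulrCA c2 => <-; rewrite /gkz_poly coef_poly.
    case: n {nz szr fac e1} => [|n]; first by rewrite muln0 /= !mulr0 mul0r.
    have e : (2 * 'C(n.+2, 2) = n.+2 * n.+1)%N.
      by rewrite mulnC; have := bin_ffact n.+2 2; rewrite !ffactnS ffactn0 muln1.
    by rewrite /= sqrrN expr1n mulr1 mulrA -natrM e.
  have s1 : \sum_(x <- r) x = n.+1%:R * u1.
    by rewrite /u1 mulrA e1 mulrAC mulfV// mul1r.
  have s2 : \sum_(x <- r) x ^+ 2 = n.+1%:R * (n.+1%:R * (u1 ^+ 2 - u2) + u2).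
    have -> : \sum_(x <- r) x ^+ 2 = (\sum_(x <- r) x) ^+ 2 - (n.+1 * n)%:R * u2.
      rewrite /u2 mulrA e2; field; exact: m0.
    rewrite s1 natrM -natr1; ring.
  have : nc (\sum_(x <- r) x ^+ 2) <= n.+1%:R.
    rewrite -(big_map (fun x => x ^+ 2) xpredT (fun x => x)).
    apply: (@le_trans _ _ (size [seq x ^+ 2 | x <- r])%:R).
      apply: nc_sum_le => y /mapP[x xr ->]; rewrite ncX.
      by rewrite exprn_ile1 ?nc_ge0// ltW// r1.
    by rewrite size_map ler_nat.
  rewrite s2 ncM nc_nat -{2}[n.+1%:R]mulr1 ler_pM2l//; exact: ltr0Sn.
have : u1 ^+ 2 - u2 = 0.
  apply/eqP/negP => /negP d0; have dpos : 0 < nc (u1 ^+ 2 - u2) by rewrite nc_gt0.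
  set d := nc (u1 ^+ 2 - u2) in dpos.
  have [n hn] : exists n : nat, (1 + nc u2) / d < n.+1%:R.
    exists `|Num.ceil ((1 + nc u2) / d)|%N; apply: le_lt_trans (ceil_ge _) _.
    rewrite -natr1 natr_absz; apply: le_lt_trans (_ : _ <= `|Num.ceil ((1 + nc u2) / d)|%:~R) _.
      by rewrite ler_int ler_norm.
    by rewrite ltrDl.
  have : n.+1%:R * d <= 1 + nc u2.
    rewrite -(nc_nat R n.+1) -ncM.
    have -> : n.+1%:R * (u1 ^+ 2 - u2) = (n.+1%:R * (u1 ^+ 2 - u2) + u2) - u2 by ring.
    by apply: le_trans (ncB _ _) _; rewrite lerD2r.
  by rewrite leNgt -ltr_pdivrMr// hn.
move/eqP; rewrite subr_eq0 /u1 /u2 => /eqP h.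
have -> : m 2%N = m 0%N * (m 1%N / m 0%N) ^+ 2 by rewrite h; field.
by field.
Qed.

End RootCounting.

(** * Linear functionals that vanish at no outer function *)

Section Multiplicative.
Variable R : realType.
Local Notation C := R[i].
Local Notation nc := (@Normc.normc R).
Local Notation Re := (@complex.Re R).
Local Open Scope complex_scope.
Implicit Types (z w lam c : C) (a b p q : nat -> C).

Definition delta0 n : C := if n == 0%N then 1 else 0.

Lemma l2_delta0 : l2 delta0.
Proof.
exists 1 => N; case: N => [|N]; first by rewrite big_ord0.
rewrite big_ord_recl big1 ?addr0; first by rewrite /delta0 eqxx nc1 expr1n.
by move=> i _; have -> : delta0 (lift ord0 i) = 0 by []; rewrite nc0 expr0n.
Qed.

Lemma psumD a b z N : psum (fun n => a n + b n) z N = psum a z N + psum b z N.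
Proof. by rewrite /psum -big_split; apply: eq_bigr => n _; rewrite mulrDl. Qed.

Lemma psum_fejerD K a b z : psum (fejer K (fun n => a n + b n)) z K =
  psum (fejer K a) z K + psum (fejer K b) z K.
Proof. by rewrite -psumD; apply: eq_bigr => n _; rewrite /fejer mulrDr. Qed.

Lemma fejer_geD x y a b : fejer_ge x a -> fejer_ge y b ->
  fejer_ge (x + y) (fun n => a n + b n).
Proof. by move=> ha hb K z z1; rewrite psum_fejerD cReD lerD ?ha ?hb. Qed.

Lemma fejer_geZ (t : R) a : 0 <= t -> fejer_ge 0 a -> fejer_ge 0 (fun n => t%:C * a n).
Proof.
move=> t0 ha K z z1.
have -> : psum (fejer K.+1 (fun n => t%:C * a n)) z K.+1 =
    t%:C * psum (fejer K.+1 a) z K.+1.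
  by rewrite /psum mulr_sumr; apply: eq_bigr => n _; rewrite /fejer; ring.
by rewrite cReZ mulr_ge0// ha.
Qed.

Lemma fejer_ge_delta0 c : fejer_ge (Re c) (fun n => c * delta0 n).
Proof.
move=> K z _; rewrite /psum big_ord_recl big1 ?addr0.
  by rewrite /fejer /delta0 /= subn0 divff ?pnatr_eq0// mul1r expr0 !mulr1.
by move=> i _; rewrite /fejer /delta0 /= !mulr0 mul0r.
Qed.

Variable psi : (nat -> C) -> C.
Hypothesis psiD : forall a b, l2 a -> l2 b -> psi (fun n => a n + b n) = psi a + psi b.
Hypothesis psiZ : forall c a, l2 a -> psi (fun n => c * a n) = c * psi a.
Hypothesis psi_neq0 : forall b lam n, l2 b -> fejer_ge 1 b -> 1 <= nc lam ->
  psi (iter n (linmul lam) b) != 0.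

Let l2_iter_mulz b k : l2 b -> l2 (iter k (@mulz R) b).
Proof. by move=> bl; elim: k => //= k; exact: l2_mulz. Qed.

Lemma psi_linmul lam b : l2 b -> psi (linmul lam b) = lam * psi b - psi (mulz b).
Proof.
move=> bl; have -> : linmul lam b = fun n => lam * b n + (-1) * mulz b n.
  by apply/funext => n; rewrite /linmul mulN1r.
rewrite psiD; [|exact: l2Z|exact: (l2Z (-1) (l2_mulz bl))].
by rewrite !psiZ ?mulN1r//; exact: l2_mulz.
Qed.

Lemma mulz_linmul lam b : mulz (linmul lam b) = linmul lam (mulz b).
Proof. by apply/funext => -[|n]; rewrite /linmul /= ?mulr0 ?subrr. Qed.

(** The binomial expansion of (lam - z)^n, applied to z^j b. *)
Lemma psi_linmuln b lam n j : l2 b -> psi (iter n (linmul lam) (iter j (@mulz R) b)) =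
  \sum_(k < n.+1) 'C(n, k)%:R * (-1) ^+ k * lam ^+ (n - k) *
     psi (iter (k + j) (@mulz R) b).
Proof.
move=> bl; elim: n j => [|n IH] j.
  by rewrite big_ord1 /= bin0 !expr0 !mul1r.
have lj := l2_iter_mulz j bl.
have comm k a : mulz (iter k (linmul lam) a) = iter k (linmul lam) (mulz a).
  by elim: k => //= k <-; exact: mulz_linmul.
rewrite iterS psi_linmul; last exact: l2_linmuln.
rewrite comm -iterS !IH mulr_sumr.
under [X in _ - X]eq_bigr => k _ do rewrite addnS -addSn.
rewrite [in RHS]big_ord_recl bin0 expr0 subn0 add0n.
rewrite [X in X - _]big_ord_recl [X in _ - X]big_ord_recr /= bin0 subn0 expr0 add0n.
rewrite [in RHS]big_ord_recr /= binn subnn expr0.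
rewrite -!addrA; congr (_ + _); first by rewrite exprS; ring.
rewrite opprD addrA; congr (_ + _); last first.
  by rewrite ?binn ?subnn ?expr0 exprS; ring.
rewrite -sumrN -big_split /=; apply: eq_bigr => k _; rewrite /bump /= !add1n.
rewrite binS natrD exprS subSS.
have -> : (n - k = (n - k.+1).+1)%N by rewrite subnSK.
by rewrite exprS; ring.
Qed.

(** The zero-free polynomials come from the functional evaluated at the outer
    functions (lam - z)^n b with lam outside the open disk. *)
Lemma psi_square b : l2 b -> fejer_ge 1 b ->
  psi (mulz (mulz b)) * psi b = psi (mulz b) ^+ 2.
Proof.
move=> bl b1; pose m k := psi (iter k (@mulz R) b).
apply: (@gkz_moments R m) => n x x1.
have E : (gkz_poly m n).[x] = \sum_(k < n.+1) 'C(n, k)%:R * (-1) ^+ k * m k * x ^+ k.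
  by rewrite /gkz_poly horner_poly.
have [x0|x0] := eqVneq x 0.
  rewrite x0 horner_coef0 /gkz_poly coef_poly /= bin0 !mul1r.
  by apply: (@psi_neq0 b 1 0) => //; rewrite nc1.
have lam1 : 1 <= nc x^-1 by rewrite ncV invf_ge1 ?nc_gt0.
have := psi_neq0 n bl b1 lam1; apply: contraNneq => h.
apply/eqP; rewrite (psi_linmuln _ n 0 bl); apply: (mulfI (expf_neq0 n x0)).
transitivity (gkz_poly m n).[x]; last by rewrite h mulr0.
rewrite E mulr_sumr; apply: eq_bigr => k _; rewrite addn0 /m.
have kn : (k <= n)%N by rewrite -ltnS.
rewrite -{1}(subnK kn) exprD exprVn.
have := expf_neq0 (n - k) x0; move: (x ^+ (n - k)) => y y0; by field.
Qed.

(** Along the segment s_0 + t F, t = 0, 1/2, 1, of functions with real part at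
    least one, the square identity is a quadratic in t. *)
Lemma psi_mulz_eq0 a : l2 a -> psi a = 0 -> psi (mulz a) = 0.
Proof.
move=> al a0; have [p [q [c [pl ql p0 q0 [c0 aE]]]]] := hardy_decomposition al.
pose s0 n := delta0 n + q n.
have s0l : l2 s0 by exact: l2D l2_delta0 ql.
pose st (t : R) n := s0 n + t%:C * a n.
have stl t : l2 (st t) by exact: l2D s0l (l2Z _ al).
have st1 t : 0 <= t <= 1 -> fejer_ge 1 (st t).
  move=> /andP[t0 t1].
  have E : st t = fun n => (1 + t%:C * c) * delta0 n + (t%:C * p n + (1 - t)%:C * q n).
    apply/funext => n; rewrite /st /s0 aE /delta0.
    have -> : (1 - t)%:C = 1 - t%:C by rewrite rmorphB rmorph1.
    by case: (n == 0%N); ring.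
  have r1 : Re (1 + t%:C * c) + (0 + 0) = 1 by rewrite cReD cReZ c0 mulr0 !addr0.
  rewrite E -[X in fejer_ge X _]r1; apply: fejer_geD; first exact: fejer_ge_delta0.
  by apply: fejer_geD; apply: fejer_geZ; rewrite ?subr_ge0.
have stz t : mulz (st t) = fun n => mulz s0 n + t%:C * mulz a n.
  by apply/funext => -[|n]; rewrite /= ?mulr0 ?addr0.
have stzz t : mulz (mulz (st t)) = fun n => mulz (mulz s0) n + t%:C * mulz (mulz a) n.
  by apply/funext => -[|[|n]]; rewrite /= ?mulr0 ?addr0.
have sz := l2_mulz s0l; have szz := l2_mulz sz.
have az := l2_mulz al; have azz := l2_mulz az.
have A t : psi (st t) = psi s0.
  by rewrite psiD ?psiZ ?a0 ?mulr0 ?addr0//; exact: l2Z.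
have B t : psi (mulz (st t)) = psi (mulz s0) + t%:C * psi (mulz a).
  by rewrite stz psiD ?psiZ//; exact: l2Z.
have D t : psi (mulz (mulz (st t))) =
    psi (mulz (mulz s0)) + t%:C * psi (mulz (mulz a)).
  by rewrite stzz psiD ?psiZ//; exact: l2Z.
have key t : 0 <= t <= 1 ->
    (psi (mulz (mulz s0)) + t%:C * psi (mulz (mulz a))) * psi s0 =
    (psi (mulz s0) + t%:C * psi (mulz a)) ^+ 2.
  by move=> t01; have := psi_square (stl t) (st1 t t01); rewrite A B D.
have k0 := key 0; have k1 := key 1; have k2 := key (2^-1).
have {k0} := k0 (ltac:(by rewrite lexx ler01)).
have {k1} := k1 (ltac:(by rewrite lexx ler01)).
have {k2} := k2 (ltac:(lra)).
rewrite fmorphV rmorph_nat rmorph1 rmorph0.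
move: (psi (mulz (mulz s0))) (psi (mulz (mulz a))) (psi s0) (psi (mulz s0)) (psi (mulz a)).
move=> e g A0 b d h2 h1 h0.
have : d ^+ 2 = 0.
  have -> : d ^+ 2 = 2 * ((b + 1 * d) ^+ 2 + (b + 0 * d) ^+ 2) - 4 * (b + 2^-1 * d) ^+ 2.
    by field.
  by rewrite -h2 -h1 -h0; field.
by move/eqP; rewrite expf_eq0 /= => /eqP.
Qed.

Lemma psi_delta0_neq0 : psi delta0 != 0.
Proof.
apply: (@psi_neq0 delta0 1 0 l2_delta0); last by rewrite nc1.
have := @fejer_ge_delta0 1; congr (fejer_ge _ _).
by apply/funext => n; rewrite mul1r.
Qed.

Definition psi_point := psi (mulz delta0) / psi delta0.

(** Subtracting a multiple of the constant function moves any function into the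
    kernel of the functional, which is invariant under multiplication by z. *)
Lemma psi_mulz a : l2 a -> psi (mulz a) = psi_point * psi a.
Proof.
move=> al; have d0 := psi_delta0_neq0; pose c := - (psi a / psi delta0).
have dl := l2_delta0; have cl := l2Z c dl.
have : psi (mulz (fun n => a n + c * delta0 n)) = 0.
  apply: psi_mulz_eq0; first exact: l2D.
  by rewrite psiD// psiZ// /c; field.
have -> : mulz (fun n => a n + c * delta0 n) = fun n => mulz a n + c * mulz delta0 n.
  by apply/funext => -[|n]; rewrite /= ?mulr0 ?addr0.
rewrite psiD ?psiZ; [|exact: l2_mulz|exact: l2_mulz|exact: (l2Z c (l2_mulz dl))].
move/eqP; rewrite addr_eq0 => /eqP ->.
by rewrite /c /psi_point; field.
Qed.

(** Otherwise [psi] would vanish at the outer function w - z, where w is this point. *)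
Lemma psi_point_disk : nc psi_point < 1.
Proof.
rewrite ltNge; apply/negP => w1.
have d1 : fejer_ge 1 delta0.
  have := @fejer_ge_delta0 1; congr (fejer_ge _ _).
  by apply/funext => n; rewrite mul1r.
have /eqP := psi_neq0 1 l2_delta0 d1 w1; apply.
by rewrite /= psi_linmul ?(psi_mulz l2_delta0) ?subrr//; exact: l2_delta0.
Qed.

(** A linear functional that vanishes at no outer function is a multiple of a
    point evaluation. *)
Theorem functional_evaluation a : l2 a -> psi a = ps a psi_point * psi delta0.
Proof.
move=> al; have w1 := psi_point_disk; set w := psi_point in w1 *.
have [K K0 aK] := l2_bnd al; have ql := l2_dquot al w1; set q := dquot a w in ql.
have E : a = fun n => (ps a w * delta0 n + mulz q n) + (- w) * q n.
  apply/funext => -[|n].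
    by rewrite /delta0 /= mulr1 addr0 (dquot0 aK w1) -/q mulNr addrK.
  rewrite /delta0 /= mulr0 add0r mulNr; have := dquot_rec n aK w1; rewrite -/q => ->.
  by rewrite addrK.
have l1 := l2Z (ps a w) l2_delta0; have qz := l2_mulz ql; have l3 := l2Z (- w) ql.
rewrite {1}E psiD; [|exact: l2D|exact: l3].
rewrite (psiD l1 qz) !psiZ ?psi_mulz//; last exact: l2_delta0.
by rewrite -/w mulNr addrK.
Qed.

End Multiplicative.

(** * Weighted composition operators and injectivity *)

Section Operator.
Variable R : realType.
Local Notation C := R[i].
Local Notation nc := (@Normc.normc R).
Local Notation cj := (@conjc R).
Local Notation Re := (@complex.Re R).
Local Notation Im := (@complex.Im R).
Local Notation HT := (@HardyTransform R).
Local Open Scope complex_scope.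
Implicit Types (t x y s : R) (z w c : C) (a b : nat -> C) (f g : L2 R).

Lemma outer_neq0 (G : C -> C) z : outer G -> nc z < 1 -> G z != 0.
Proof.
move=> [_ _ [lam l1 E]] z1; rewrite E; last by apply/diskE.
rewrite mulf_neq0 ?cexp_neq0//; apply/eqP => l0.
by move: l1; rewrite l0 normr0 => /eqP; rewrite eq_sym oner_eq0.
Qed.

Lemma HT_inj f g : (forall z, nc z < 1 -> HT f z = HT g z) -> f = g.
Proof.
move=> fg; apply/eqP; rewrite -subr_eq0 -scaleN1r; apply/eqP; apply: HT_injective => z z1.
by rewrite HTD// HTZ// fg// mulN1r subrr.
Qed.

(** The preimage under the transform of the power series with coefficients [a]. *)
Definition of_coef a : L2 R :=
  xget 0 [set f | forall z, nc z < 1 -> HT f z = ps a z].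

Lemma of_coefP a z : l2 a -> nc z < 1 -> HT (of_coef a) z = ps a z.
Proof. by move=> al; exact: (xgetPex 0 (HT_surjective al)). Qed.

Lemma of_coefD a b : l2 a -> l2 b ->
  of_coef (fun n => a n + b n) = of_coef a + of_coef b.
Proof.
move=> al bl; have [K _ aK] := l2_bnd al; have [L _ bL] := l2_bnd bl.
apply: HT_inj => z z1; rewrite HTD// !of_coefP//; last exact: l2D.
exact: psD aK bL z1.
Qed.

Lemma of_coefZ c a : l2 a -> of_coef (fun n => c * a n) = c *: of_coef a.
Proof.
move=> al; have [K _ aK] := l2_bnd al.
apply: HT_inj => z z1; rewrite HTZ// !of_coefP//; last exact: l2Z.
exact: psZ aK z1.
Qed.

Lemma lcoefK f : of_coef (lcoef f) = f.
Proof.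
by apply: HT_inj => z z1; rewrite of_coefP ?HT_ps//; exact: l2_lcoef (sq_L2 f).
Qed.

Variable A : {linear L2 R -> L2 R}.
Hypothesis A_neq0 : forall f, minimum_phase f ->
  forall z, nc z < 1 -> HT (A f) z != 0.

Let one := A (of_coef (@delta0 R)).
Let idz := A (of_coef (mulz (@delta0 R))).
Let symbol z := HT idz z / HT one z.

(** The operator is a weighted composition operator on the disk. *)
Lemma weighted_composition z : nc z < 1 ->
  [/\ nc (symbol z) < 1, HT one z != 0 &
      forall f, HT (A f) z = ps (lcoef f) (symbol z) * HT one z].
Proof.
move=> z1; pose psi a := HT (A (of_coef a)) z.
have psiD a b : l2 a -> l2 b -> psi (fun n => a n + b n) = psi a + psi b.
  by move=> al bl; rewrite /psi of_coefD// linearD HTD.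
have psiZ c a : l2 a -> psi (fun n => c * a n) = c * psi a.
  by move=> al; rewrite /psi of_coefZ// linearZ HTZ.
have psi0 b lam n : l2 b -> fejer_ge 1 b -> 1 <= nc lam ->
    psi (iter n (linmul lam) b) != 0.
  move=> bl b1 l1; apply: A_neq0 => //; apply: (outer_fejer (n := n) bl b1 l1) => y y1.
  by rewrite of_coefP ?ps_linmuln//; exact: l2_linmuln.
split; first exact: (psi_point_disk psiD psiZ psi0).
  exact: (psi_delta0_neq0 psi0).
move=> f; have := functional_evaluation psiD psiZ psi0 (l2_lcoef (sq_L2 f)).
by rewrite /psi lcoefK.
Qed.

(** Two distinct elements of a basis on one line are linearly dependent. *)
Lemma rank_le1 (v : L2 R) : (forall f, exists c, A f = c *: v) -> ~ rank_ge 2 A.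
Proof.
move=> Av [B [indep span]] /card_leP/unsquash G.
pose mk i (h : `I_2 i) : `I_2 := exist (fun j => j \in `I_2) i (mem_set h).
pose F i : L2 R := if i is 0%N then val (G (mk 0%N isT)) else val (G (mk 1%N isT)).
have inB i : B (F i) by case: i => [|i]; exact: set_valP.
have F01 : F 0%N != F 1%N.
  apply/eqP => /val_inj h.
  have := @inj _ _ _ G _ _ (mem_set I) (mem_set I) h.
  by move/(congr1 (fun x : `I_2 => val x)).
have line (y : L2 R) : B y -> exists c, y = c *: v.
  move=> By; have : range A y.
    rewrite -span; exists [:: y], (fun=> 1); split.
      by move=> x; rewrite inE => /eqP ->.
    by rewrite big_seq1 scale1r.
  by move=> [f _ <-]; exact: Av.
have [c0 e0] := line _ (inB 0%N); have [c1 e1] := line _ (inB 1%N).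
pose k (y : L2 R) : C := if y == F 0%N then c1 else - c0.
have := indep [:: F 0%N; F 1%N] k.
have uq : uniq [:: F 0%N; F 1%N] by rewrite /= inE F01.
have inBs : {in [:: F 0%N; F 1%N], forall y : L2 R, B y}.
  by move=> y; rewrite !inE => /orP[] /eqP ->; exact: inB.
move=> /(_ uq inBs); rewrite big_cons big_seq1 /k eqxx eq_sym (negbTE F01).
rewrite {1}e0 {1}e1 !scalerA -scalerDl mulNr [c1 * c0]mulrC subrr scale0r.
move=> /(_ erefl) h.
have h0 := h (F 0%N); have h1 := h (F 1%N).
move: h0 h1; rewrite !inE !eqxx orbT [F 1%N == F 0%N]eq_sym (negbTE F01) => h0 h1.
have c1z : c1 = 0 by exact: h0.
have c0z : c0 = 0 by apply/eqP; rewrite -oppr_eq0; apply/eqP; exact: h1.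
by move/eqP: F01; apply; rewrite e0 e1 c0z c1z.
Qed.

(** A constant symbol would make the range one-dimensional. *)
Lemma symbol_nonconstant : rank_ge 2 A ->
  exists z1 z2, [/\ nc z1 < 1, nc z2 < 1 & symbol z1 != symbol z2].
Proof.
move=> rk; apply: contrapT => cst.
have same z : nc z < 1 -> symbol z = symbol 0.
  move=> z1; apply: contrapT => h; apply: cst; exists z, 0; split => //.
    by rewrite nc0.
  exact/eqP.
apply: (@rank_le1 one _ rk) => f; exists (ps (lcoef f) (symbol 0)).
apply: HT_inj => z z1; have [_ _ h] := weighted_composition z1.
by rewrite h (HTZ _ _ z1) (same z z1).
Qed.

Lemma ps_continuous a z (e : R) : l2 a -> nc z < 1 -> 0 < e ->
  exists2 del : R, 0 < del &
    forall x : C, nc (z - x) < del -> nc x < 1 /\ nc (ps a z - ps a x) < e.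
Proof.
move=> al z1 e0; have [K K0 aK] := l2_bnd al.
have d0 : 0 < (1 - nc z) / 2 by rewrite divr_gt0// subr_gt0.
set d := (1 - nc z) / 2 in d0.
pose L := K / (1 - nc z) / d.
have L0 : 0 <= L by rewrite !divr_ge0// ?subr_ge0 ltW.
exists (Num.min d (e / (L + 1))); first by rewrite lt_min d0 divr_gt0// ltr_wpDl.
move=> x; rewrite lt_min => /andP[xd xe].
have x1 : nc x <= 1 - d.
  have -> : 1 - d = nc z + d by rewrite /d; field.
  have -> : x = z - (z - x) by ring.
  by apply: le_trans (ncB _ _) _; rewrite lerD2l ltW.
have x1' : nc x < 1 by apply: le_lt_trans x1 _; rewrite gtrBl.
split => //.
have -> : ps a z - ps a x = (z - x) * ps (dquot a z) x.
  by rewrite -[LHS]opprB (ps_dquot aK z1 x1'); ring.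
rewrite ncM; apply: (@le_lt_trans _ _ (nc (z - x) * L)).
  apply: ler_wpM2l; first exact: nc_ge0.
  apply: le_trans (nc_ps_le (bounded_dquot aK z1) x1') _.
  rewrite /L; apply: ler_wpM2l; first by rewrite divr_ge0// subr_ge0 ltW.
  by rewrite lef_pV2 ?posrE ?subr_gt0// lerBrDr -lerBrDl.
apply: (@le_lt_trans _ _ (e / (L + 1) * L)).
  by apply: ler_wpM2r => //; exact: ltW.
by rewrite mulrAC ltr_pdivrMr ?ltr_wpDl// ltr_pM2l// ltrDl.
Qed.

Section Path.
Variables z1 z2 : C.
Hypotheses (z1d : nc z1 < 1) (z2d : nc z2 < 1) (ne : symbol z1 != symbol z2).
Let pt (t : R) : C := z1 + t%:C * (z2 - z1).

Let pt_disk t : t \in `[0, 1] -> nc (pt t) < 1.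
Proof.
rewrite in_itv/= => /andP[t0 t1].
have -> : pt t = (1 - t)%:C * z1 + t%:C * z2.
  by rewrite /pt rmorphB rmorph1; ring.
apply: le_lt_trans (ncD _ _) _; rewrite !ncM !ncR !ger0_norm ?subr_ge0//.
have := nc_ge0 z1; have := nc_ge0 z2; move: (nc z1) (nc z2) z1d z2d => x y x1 y1 x0 y0.
have ht : 0 <= t * (1 - y) by rewrite mulr_ge0// subr_ge0 ltW.
have hs : 0 <= (1 - t) * (1 - x) by apply: mulr_ge0; rewrite subr_ge0// ltW.
have [t2|t2] := lerP t 2^-1.
  have hp : 0 < (1 - t) * (1 - x) by apply: mulr_gt0; lra.
  by lra.
have hp : 0 < t * (1 - y) by apply: mulr_gt0; lra.
by lra.
Qed.

Let pt_continuous t : pt s @[s --> t] --> pt t.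
Proof.
apply/cvgC => e e0; pose D := nc (z2 - z1) + 1.
have D0 : 0 < D by rewrite ltr_wpDl// nc_ge0.
have : \forall s \near t, `|t - s| < e / D.
  by move: (@cvg_id R (nbhs t)) => /cvgrPdist_lt; apply; rewrite divr_gt0.
apply: filterS => s ts.
have -> : pt t - pt s = (t - s)%:C * (z2 - z1) by rewrite /pt rmorphB; ring.
rewrite ncM ncR; apply: (@le_lt_trans _ _ (`|t - s| * D)).
  by apply: ler_wpM2l => //; rewrite lerDl.
by rewrite -ltr_pdivlMr.
Qed.

Let coord_continuous f t : t \in `[0, 1] ->
  Re (HT f (pt s)) @[s --> t] --> Re (HT f (pt t)) /\
  Im (HT f (pt s)) @[s --> t] --> Im (HT f (pt t)).
Proof.
move=> t01; have pd := pt_disk t01.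
have fl := l2_lcoef (sq_L2 f).
have cvH : HT f (pt s) @[s --> t] --> HT f (pt t).
  apply/cvgC => e e0; have [del del0 hdel] := ps_continuous fl pd e0.
  have /cvgC/(_ _ del0) := pt_continuous (t := t); apply: filterS => s /hdel[sd hs].
  by rewrite !HT_ps.
by split; [exact: cvgC_Re cvH|exact: cvgC_Im cvH].
Qed.

Let num (c : C) t := Re (HT idz (pt t) * (cj (HT one (pt t)) * c)).
Let den t := nc (HT one (pt t)) ^+ 2.

Let symbolE (c : C) t : t \in `[0, 1] -> Re (symbol (pt t) * c) = num c t / den t.
Proof.
move=> t01; have [_ n0 _] := weighted_composition (pt_disk t01).
have -> : symbol (pt t) * c =
    (den t)^-1%:C * (HT idz (pt t) * (cj (HT one (pt t)) * c)).
  have -> : (den t)^-1%:C = (HT one (pt t) * cj (HT one (pt t)))^-1.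
    by rewrite mulCJ fmorphV.
  rewrite /symbol; move: (HT one (pt t)) n0 (HT idz (pt t)) => y y0 x; field.
  by rewrite y0 -nc_eq0 nc_conj nc_eq0 y0.
by rewrite cReZ mulrC.
Qed.

Let den_continuous t : t \in `[0, 1] -> den s @[s --> t] --> den t.
Proof.
move=> t01; have [c1 c2] := coord_continuous one t01.
have -> : den = (fun s => Re (HT one (pt s)) * Re (HT one (pt s)) +
    Im (HT one (pt s)) * Im (HT one (pt s))).
  by apply/funext => s; rewrite /den normc2E !expr2.
apply: cvgD; apply: cvgM; [exact: c1|exact: c1|exact: c2|exact: c2].
Qed.

Let symbol_continuous (c : C) t : t \in `[0, 1] ->
  num c s / den s @[s --> t] --> num c t / den t.
Proof.
move=> t01; have [_ n0 _] := weighted_composition (pt_disk t01).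
have [c1 c2] := coord_continuous one t01.
have [c3 c4] := coord_continuous idz t01.
apply: cvgM; last first.
  apply: cvgV; last exact: den_continuous.
  by rewrite /den expf_eq0 /= nc_eq0.
have E s : num c s =
    Re (HT idz (pt s)) * (Re (HT one (pt s)) * Re c + Im (HT one (pt s)) * Im c) -
    Im (HT idz (pt s)) * (Re (HT one (pt s)) * Im c - Im (HT one (pt s)) * Re c).
  rewrite /num; move: (HT idz (pt s)) (HT one (pt s)) c => [x1 x2] [y1 y2] [d1 d2].
  by rewrite /=; ring.
have -> : num c = (fun s => 
    Re (HT idz (pt s)) * (Re (HT one (pt s)) * Re c + Im (HT one (pt s)) * Im c) -
    Im (HT idz (pt s)) * (Re (HT one (pt s)) * Im c - Im (HT one (pt s)) * Re c)).
  by apply/funext => s; exact: E.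
have cZ (v : R -> R) (l k : R) : v s @[s --> t] --> l -> v s * k @[s --> t] --> l * k.
  by move=> cv; apply: cvgM; [exact: cv|exact: cvg_cst].
apply: cvgB; apply: cvgM.
- exact: c3.
- by apply: cvgD; apply: cZ; [exact: c1|exact: c2].
- exact: c4.
- by apply: cvgB; apply: cZ; [exact: c1|exact: c2].
Qed.

(** The symbol is continuous on a segment joining two points where it differs,
    hence takes infinitely many values in a compact part of the disk. *)
Lemma symbol_many_values a : (forall z, nc z < 1 -> ps a (symbol z) = 0) ->
  exists2 rho, rho < 1 & many_zeros rho a.
Proof.
move=> az.
have [rho rho1 hrho] : exists2 rho : R, rho < 1 &
    forall t, t \in `[0, 1] -> nc (symbol (pt t)) <= rho.
  pose u t := (num 1 t / den t) * (num 1 t / den t) + (num 'i t / den t) * (num 'i t / den t).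
  have uE t : t \in `[0, 1] -> u t = nc (symbol (pt t)) ^+ 2.
    move=> t01; rewrite /u -!symbolE// normc2E mulr1.
    by rewrite cReM /=; ring.
  have uc : {within `[0, 1], continuous u}.
    apply: continuous_in_subspaceT => t; rewrite mem_setE => t01.
    by apply: cvgD; apply: cvgM; exact: symbol_continuous.
  have [t0 t001 ht0] := EVT_max ler01 uc.
  have [w1 _ _] := weighted_composition (pt_disk t001).
  exists (nc (symbol (pt t0))); first exact: w1.
  move=> t t01; move: (ht0 t t01); rewrite (uE t t01) (uE t0 t001) ler_sqr.
  - exact: id.
  - by rewrite nnegrE; exact: nc_ge0.
  - by rewrite nnegrE; exact: nc_ge0.
exists rho => // N.
(* The component of the symbol along d runs from 0 to D and attains every
   D / (k + 1). *)
pose d := symbol z2 - symbol z1; pose D := nc d ^+ 2.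
have D0 : 0 < D by rewrite exprn_gt0// nc_gt0 subr_eq0 eq_sym.
pose h t := num (cj d) t / den t - Re (symbol z1 * cj d).
have hE t : t \in `[0, 1] -> h t = Re (symbol (pt t) * cj d) - Re (symbol z1 * cj d).
  by move=> t01; rewrite /h symbolE.
have in0 : (0 : R) \in `[0, 1] by rewrite in_itv/= lexx ler01.
have in1 : (1 : R) \in `[0, 1] by rewrite in_itv/= lexx ler01.
have pt0 : pt 0 = z1 by rewrite /pt rmorph0 mul0r addr0.
have pt1 : pt 1 = z2 by rewrite /pt rmorph1 mul1r addrCA subrr addr0.
have h0 : h 0 = 0 by rewrite hE// pt0 subrr.
have h1 : h 1 = D by rewrite hE// pt1 -cReB -mulrBl -/d mulCJ.
have hc : {within `[0, 1], continuous h}.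
  apply: continuous_in_subspaceT => t; rewrite mem_setE => t01.
  by apply: cvgB; [exact: symbol_continuous|exact: cvg_cst].
have val (k : nat) : exists t, t \in `[0, 1] /\ h t = D / k.+1%:R.
  have v0 : 0 <= D / k.+1%:R by rewrite divr_ge0// ltW.
  have vD : D / k.+1%:R <= D by rewrite ler_pdivrMr ?ltr0Sn// ler_peMr ?ler1n// ltW.
  have [|t t01 ht] := @IVT R h 0 1 (D / k.+1%:R) ler01 hc.
    by rewrite h0 h1 ge_min le_max v0 vD orbT.
  by exists t.
have [t ht] := choice val.
exists [seq symbol (pt (t k)) | k <- iota 0 N]; split.
- rewrite map_inj_in_uniq; [exact: iota_uniq|move=> i j _ _ e].
  have [ti hi] := ht i; have [tj hj] := ht j.
  have : D / i.+1%:R = D / j.+1%:R by rewrite -hi -hj (hE _ ti) (hE _ tj) e.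
  move/(mulfI (lt0r_neq0 D0))/invr_inj/eqP; rewrite eqr_nat => /eqP.
  by case.
- by rewrite size_map size_iota.
move=> w /mapP[k _ ->]; have [tk _] := ht k.
by split; [exact: hrho|apply: az; exact: pt_disk].
Qed.

End Path.

(** The power series of a function in the kernel vanishes at all values of the
    symbol, hence identically. *)
Theorem injective_of_nonvanishing : rank_ge 2 A -> injective A.
Proof.
move=> rk; have [z1 [z2 [z1d z2d ne]]] := symbol_nonconstant rk.
suff ker f : A f = 0 -> f = 0.
  move=> f g fg; apply/eqP; rewrite -subr_eq0; apply/eqP; apply: ker.
  by rewrite linearB fg subrr.
move=> Af; have fl := l2_lcoef (sq_L2 f).
have HT0 z : nc z < 1 -> HT (0 : L2 R) z = 0.
  by move=> zd; have := HTZ 0 (0 : L2 R) zd; rewrite scale0r mul0r.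
have az z : nc z < 1 -> ps (lcoef f) (symbol z) = 0.
  move=> zd; have [_ n0 h] := weighted_composition zd.
  have := h f; rewrite Af HT0// => /esym/eqP.
  by rewrite mulf_eq0 (negbTE n0) orbF => /eqP.
have [rho rho1 many] := symbol_many_values z1d z2d ne az.
have a0 := ps_identity fl rho1 many.
apply: HT_injective => z zd; rewrite HT_ps//.
by rewrite (@ps_finite R 0) ?/psum ?big_ord0.
Qed.

End Operator.

Theorem mainTheorem3 (R : realType) (A : {linear L2 R -> L2 R}) :
  rank_ge 2 A ->
  A @` @delayed_minimum_phase R `<=` @delayed_minimum_phase R \/
  A @` @minimum_phase R `<=` @minimum_phase R ->
  injective A.
Proof.
move=> rk stable; apply: injective_of_nonvanishing rk => f mf z z1.
case: stable => [AM|AM]; last by apply: outer_neq0 z1; apply: AM; exists f.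
have [|tau [g [mg ->]]] := AM (A f).
  by exists f => //; exists 0%:nng, f; rewrite translate0.
by rewrite HT_translate// mulf_neq0 ?cexp_neq0//; exact: outer_neq0 mg z1.
Qed.
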